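(* Let $N\ge 1$, $0<R\leq\infty$, and let $V_{2}\geq 0$ and $W_{2}$ be smooth functions on $(0,R)$ such that for all $u\in C_{0}^{\infty}(0,R)$ $$2\int_{0}^{R}V_{2}(r)r^{N-3}|u'|^{2}dr-\int_{0}^{R}V_{2}''(r)r^{N-3}|u|^{2}dr-(N-5)\int_{0}^{R}V_{2}'(r)r^{N-4}|u|^{2}dr+(5N-9)\int_{0}^{R}V_{2}(r)r^{N-5}|u|^{2}dr-\int_{0}^{R}W_{2}(r)r^{N-3}|u|^{2}dr\geq 0.$$ Then $$\int_{B_{R}}V_{2}(|x|)\,|\Delta v|^{2}\,dx\geq\int_{B_{R}}W_{2}(|x|)\,|\nabla v|^{2}\,dx\quad\text{for all }v\in C_{0}^{\infty}(B_{R}\setminus\{0\})$$ if and only if both of the following inequalities hold for all $u\in C_{0}^{\infty}((0,R))$, where $c_{1}=N-1$: (node $k=0$) $$\int_{0}^{R}V_{2}(r)r^{N-1}|u''|^{2}dr+(N-1)\int_{0}^{R}V_{2}(r)r^{N-3}|u'|^{2}dr-(N-1)\int_{0}^{R}V_{2}'(r)r^{N-2}|u'|^{2}dr\geq\int_{0}^{R}W_{2}(r)r^{N-1}|u'|^{2}dr,$$ and (node $k=1$) $$\begin{aligned}&\int_{0}^{R}V_{2}(r)r^{N-1}|u''|^{2}dr+\big((N-1)+2c_{1}\big)\int_{0}^{R}V_{2}(r)r^{N-3}|u'|^{2}dr+\big(c_{1}^{2}+2(N-4)c_{1}\big)\int_{0}^{R}V_{2}(r)r^{N-5}|u|^{2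}dr\\&\quad-(N-1)\int_{0}^{R}V_{2}'(r)r^{N-2}|u'|^{2}dr-(N-5)c_{1}\int_{0}^{R}V_{2}'(r)r^{N-4}|u|^{2}dr-c_{1}\int_{0}^{R}V_{2}''(r)r^{N-3}|u|^{2}dr\\&\geq\int_{0}^{R}W_{2}(r)r^{N-1}|u'|^{2}dr+c_{1}\int_{0}^{R}W_{2}(r)r^{N-3}|u|^{2}dr.\end{aligned}$$
   Context: $B_R$ is the open ball of radius $R$ centered at the origin in $\mathbb{R}^N$ (with $B_\infty=\mathbb{R}^N$). $C_0^\infty(\Omega)$ is the space of smooth functions with compact support in $\Omega$. The constant $c_1=N-1$ is the value at $k=1$ of $c_k=k(N+k-2)$, the eigenvalues of (minus) the Laplace–Beltrami operator on the sphere $S^{N-1}$. *)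

(* Defs.v *)
From HB Require Import structures.
From mathcomp Require Import all_boot all_order all_algebra.
From mathcomp Require Import all_classical all_reals all_analysis.
Set Implicit Arguments.
Unset Strict Implicit.
Unset Printing Implicit Defensive.
Import Order.TTheory GRing.Theory Num.Theory.
Import numFieldNormedType.Exports.
Local Open Scope classical_set_scope.
Local Open Scope ring_scope.

(* The sigma-algebra on R^n generated by the coordinates, i.e. the Borel
   sigma-algebra. *)
Section measurable_rV.
Context {R : realType} (n : nat).

Let coord (i : 'I_n) (x : 'rV[R]_n) : measurableTypeR R := x ord0 i.

Let rV_set0 : g_sigma_preimage coord set0.
Proof. exact: sigma_algebra0. Qed.

Let rV_setC A : g_sigma_preimage coord A -> g_sigma_preimage coord (~` A).
Proof. exact: sigma_algebraC. Qed.

Let rV_bigcup (F : _^nat) : (forall i, g_sigma_preimage coord (F i)) ->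
  g_sigma_preimage coord (\bigcup_i (F i)).
Proof. exact: sigma_algebra_bigcup. Qed.

HB.instance Definition _ := @isMeasurable.Build default_measure_display
  'rV[R]_n (g_sigma_preimage coord) rV_set0 rV_setC rV_bigcup.

Lemma measurable_rV_coord (i : 'I_n) :
  measurable_fun [set: 'rV[R]_n] (fun x => x ord0 i : measurableTypeR R).
Proof.
move=> _ Y mY; rewrite setTI; apply: sub_sigma_algebra => /=.
rewrite -bigcup_seq/=; exists i => /=; first by rewrite mem_index_enum.
by exists Y => //; rewrite setTI.
Qed.

Lemma measurable_fun_rV d (T : measurableType d) (f : T -> 'rV[R]_n) :
  (forall i, measurable_fun setT (fun t => f t ord0 i : measurableTypeR R)) ->
  measurable_fun setT f.
Proof.
move=> mf.
suff : g_sigma_preimage (fun i => coord i \o f) `<=` measurable.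
  by rewrite g_sigma_preimage_comp => H _ A mA; apply: H; exists A.
apply: smallest_sub; first exact: sigma_algebra_measurable.
move=> A; rewrite -bigcup_seq => -[i _ [B mB <-]].
exact: mf.
Qed.

End measurable_rV.

Section lebesgue_rV.
Context {R : realType}.

Definition consrV n (p : measurableTypeR R * 'rV[R]_n) : 'rV[R]_n.+1 :=
  row_mx (const_mx p.1 : 'rV_1) p.2.

Lemma consrV0 n p : @consrV n p ord0 ord0 = p.1.
Proof.
rewrite (_ : ord0 = lshift n (ord0 : 'I_1)); last exact: ord_inj.
by apply: etrans (row_mxEl _ _ _ _) _; rewrite mxE.
Qed.

Lemma consrVS n p i : @consrV n p ord0 (lift ord0 i) = p.2 ord0 i.
Proof. by rewrite -rshift1; exact: row_mxEr. Qed.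

Lemma measurable_consrV n : measurable_fun setT (@consrV n).
Proof.
apply: measurable_fun_rV => i; case: (unliftP ord0 i) => [j|] ->.
  under eq_fun do rewrite consrVS.
  exact: (measurableT_comp (measurable_rV_coord j) measurable_snd).
by under eq_fun do rewrite consrV0; exact: measurable_fst.
Qed.

HB.instance Definition _ n := isMeasurableFun.Build _ _ _ _ (@consrV n)
  (@measurable_consrV n).

Section step.
Variables (n : nat) (m : {sigma_finite_measure set 'rV[R]_n -> \bar R}).

Definition lebesgue_rV_step : set 'rV[R]_n.+1 -> \bar R :=
  pushforward (lebesgue_measure \x m)%E (@consrV n).

Let step0 : lebesgue_rV_step set0 = 0%E.
Proof. exact: measure0. Qed.

Let step_ge0 A : (0 <= lebesgue_rV_step A)%E.
Proof. exact: measure_ge0. Qed.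

Let step_sigma_additive : semi_sigma_additive lebesgue_rV_step.
Proof. exact: measure_semi_sigma_additive. Qed.

HB.instance Definition _ := isMeasure.Build _ _ _ lebesgue_rV_step
  step0 step_ge0 step_sigma_additive.

Let step_sigma_finite : sigma_finite setT lebesgue_rV_step.
Proof.
have /sigma_finiteP[F [TF ndF Foo]] := sigma_finiteT (@lebesgue_measure R).
have /sigma_finiteP[G [TG ndG Goo]] := sigma_finiteT m.
pose g (x : 'rV[R]_n.+1) : measurableTypeR R * 'rV[R]_n :=
  (lsubmx (x : 'rV_(1 + n)) ord0 ord0, rsubmx (x : 'rV_(1 + n))).
have gK : cancel (@consrV n) g.
  by case=> a v; rewrite /g /consrV/= row_mxKl row_mxKr mxE.
have mg : measurable_fun setT g.
  apply/measurable_fun_pair.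
    rewrite (_ : (fun t => _) = fun t : 'rV[R]_n.+1 => t ord0 (lshift n (ord0 : 'I_1))).
      exact: measurable_rV_coord.
    by apply/funext => t; rewrite mxE.
  apply: measurable_fun_rV => i.
  rewrite (_ : (fun t => _) = fun t : 'rV[R]_n.+1 => t ord0 (rshift 1 i)).
    exact: measurable_rV_coord.
  by apply/funext => t; rewrite mxE.
exists (fun k => g @^-1` (F k `*` G k)).
  rewrite -preimage_bigcup -(_ : setT = \bigcup_k (F k `*` G k)) ?preimage_setT//.
  rewrite -setXTT TF TG predeqE => -[x y]; split.
    move=> [/= [k _ Fx] [l _ Gy]]; exists (maxn k l) => //; split.
      by move: x Fx; exact/subsetPset/ndF/leq_maxl.
    by move: y Gy; exact/subsetPset/ndG/leq_maxr.
  by move=> [k _ []/= ? ?]; split; exists k.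
move=> k; have [mF Flt] := Foo k; have [mG Glt] := Goo k.
have mFG : measurable (F k `*` G k) by exact: measurableX.
split; first by rewrite -[X in measurable X]setTI; exact: mg.
rewrite /lebesgue_rV_step /pushforward -comp_preimage.
rewrite (_ : g \o _ = id); last by apply/funext => x /=; rewrite gK.
by rewrite preimage_id product_measure1E// lte_mul_pinfty// ge0_fin_numE.
Qed.

HB.instance Definition _ := Measure_isSigmaFinite.Build _ _ _ lebesgue_rV_step
  step_sigma_finite.

End step.

(* n-dimensional Lebesgue measure: iterated product, see [lebesgue_rV_box]. *)
Fixpoint lebesgue_rV n : {sigma_finite_measure set 'rV[R]_n -> \bar R} :=
  match n with
  | 0 => \d_(0 : 'rV[R]_0)
  | n'.+1 => lebesgue_rV_step (lebesgue_rV n')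
  end.

End lebesgue_rV.

Lemma lebesgue_rV_box (R : realType) n (B : 'I_n -> set (measurableTypeR R)) :
  (forall i, measurable (B i)) ->
  lebesgue_rV n [set x : 'rV[R]_n | forall i, B i (x ord0 i)] =
  (\prod_(i < n) lebesgue_measure (B i))%E.
Proof.
elim: n B => [|n IHn] B mB.
  rewrite big_ord0 /= diracE mem_set//; by case.
rewrite big_ord_recl -IHn => [|i]; last exact: mB.
rewrite -product_measure1E//.
  rewrite /= /lebesgue_rV_step /pushforward; congr product_measure1.
  apply/seteqP; split=> -[a v]; rewrite /=.
    move=> Bx; split=> [|i]; first by have := Bx ord0; rewrite consrV0.
    by have := Bx (lift ord0 i); rewrite consrVS.
  move=> [/= Ba Bv] i.
  by case: (unliftP ord0 i) => [j|] ->; rewrite ?consrVS ?consrV0//; exact: Bv.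
rewrite (_ : mkset _ = \bigcap_(i in [set: 'I_n])
    ((fun x : 'rV[R]_n => x ord0 i : measurableTypeR R) @^-1` B (lift ord0 i))).
  apply: fin_bigcap_measurable => // i _.
  by rewrite -[X in measurable X]setTI; exact: measurable_rV_coord.
by apply/seteqP; split=> x /= Bx i; [move=> _|]; exact: Bx.
Qed.

Section test_functions.
Context {R : realType}.

(* [iter_derive [:: v1; ..; vk] f] is the iterated directional derivative
   D_v1 (.. (D_vk f)).  For an open [U] of finite dimension, [smooth_on U f] is
   the C^oo property on [U]; it does not depend on the values of [f] outside. *)
Definition iter_derive (V : normedModType R) (s : seq V) (f : V -> R) : V -> R :=
  foldr (fun v g => 'D_v g) f s.

Definition smooth_on (V : normedModType R) (U : set V) (f : V -> R) : Prop :=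
  forall s x, U x -> differentiable (iter_derive s f) x.

(* C_0^oo(U), its elements being extended by zero to the whole space. *)
Definition test_function (V : normedModType R) (U : set V) (f : V -> R) : Prop :=
  [/\ smooth_on setT f, compact (closure [set x | f x != 0])
    & closure [set x | f x != 0] `<=` U].

End test_functions.

Section euclidean.
Context {R : realType} {N : nat}.
Implicit Types (x : 'rV[R]_N) (v : 'rV[R]_N -> R).

(* The library norm on 'rV is the sup norm. *)
Definition enorm x : R := Num.sqrt (\sum_(i < N) x ord0 i ^+ 2).

Definition eball (Rad : \bar R) : set 'rV[R]_N :=
  [set x | ((enorm x)%:E < Rad)%E].

Definition gradient v x : 'rV[R]_N := \row_(i < N) 'D_(delta_mx 0 i) v x.

Definition laplacian v x : R := \sum_(i < N) 'D_(delta_mx 0 i) ('D_(delta_mx 0 i) v) x.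

End euclidean.

(* The open interval (0, Rad), with Rad possibly infinite. *)
Definition radii {R : realType} (Rad : \bar R) : set R :=
  [set r | 0 < r /\ (r%:E < Rad)%E].

(* Main.v *)
Require Import Defs.
From mathcomp Require Import all_boot all_order all_algebra.
From mathcomp Require Import all_classical all_reals all_analysis.
From mathcomp Require Import measurable_realfun ring lra.
Set Implicit Arguments.
Unset Strict Implicit.
Unset Printing Implicit Defensive.
Import Order.TTheory GRing.Theory Num.Theory.
Import numFieldNormedType.Exports.
Local Open Scope ring_scope.
Local Open Scope classical_set_scope.

(** Write B(v) for the right-hand side minus the left-hand side of the inequality
    on the ball, seen as a quadratic form in v, and let c_k = k(N+k-2).

    Separation of variables.  On a product v = g(|x|) Y(x) of a radial function
    and a harmonic homogeneous polynomial Y of degree k, integration over the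
    spheres gives B(v) = m(Y^2) q_c(u), where c = c_k, u = r^k g, m is the mean
    over the unit sphere up to a positive factor, and
<<
      q_c(u) = int_0^R ( V (u'' + (N-1) u'/r - c u/r^2)^2
                         - W (u'^2 + c u^2/r^2) ) r^(N-1) dr,
>>
    while products with different k are orthogonal for B ([Bform_rad]).
    Integrating the mixed products by parts turns q_0 >= 0 and q_(N-1) >= 0 into
    the two one-dimensional inequalities, k = 0 and k = 1 ([qf_expand]).

    Necessity: take Y = 1, respectively Y = a coordinate, so that every test
    function u on (0,R) occurs as the radial factor of a test function v on the
    punctured ball ([mode_ge0]).

    Sufficiency.  The expanded form is quadratic in c, and
<<
      q_c(u) - q_(c_1)(u)
        = (c - c_1) (H(u) + (c - c_2) int_0^R V r^(N-5) u^2 dr),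
>>
    where H(u) >= 0 is the standing hypothesis and c_2 = 2N.  As V >= 0, the
    inequality for k = 1 implies those for all k >= 2 ([qf_ge0]).  For a finite
    sum v of products g_a(|x|) Y_a(x), orthogonality regroups B(v) into the sum
    over k of the integrals in x of w_k(|x|) q_(c_k)(sum_a Y_a(x) u_a), where the
    weight w_k is nonnegative and a runs over the terms of degree k.  Hence
    B(v) >= 0 ([Bform_sum_rad_ge0]).

    Finite sums are enough.  Convolution with a multiple of (1 - |z|^2/(4b^2))^n
    produces polynomials that are uniformly close to v together with the first
    and the pure second derivatives on a ball of radius b ([polyn_approx]); by the
    Fischer decomposition every polynomial is a combination of products |x|^(2j) h
    with h harmonic ([fisch_of_hpoly]); multiplied by a radial cut-off that is 1
    on the support of v it is a finite sum as above.  The error in B is at most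
    eps times a constant that depends only on v and the cut-off ([Bform_ge0]).

    The change to polar coordinates is replaced by the divergence theorem.  For H
    homogeneous of degree d, div(x F(|x|) H) = ((N+d) F + r F')(|x|) H, so
    F |-> int F(|x|) H dx vanishes on the F with r^(N+d-1) F the derivative of a
    compactly supported function, and is therefore a multiple of
    F |-> int F r^(N+d-1) dr ([intV_polar]).  Partial integration against a
    harmonic factor gives the orthogonality of different degrees
    ([sphere_mean_orthogonal]). *)

(** * Continuous functions of compact support *)

Section integral_cc.
Context {R : realType}.
Notation mu := (@lebesgue_measure R).

Lemma rV_sup_norm n (x : 'rV[R]_n) (e : R) : 0 < e ->
  (forall i, `|x ord0 i| < e) -> `|x| < e.
Proof.
move=> e0 xe; rewrite /Num.Def.normr/= mx_normrE.
apply/bigmax_ltP; split=> // -[i j] _ /=; rewrite (ord1 i); exact: xe.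
Qed.

Lemma ler_coord_norm n (x : 'rV[R]_n) i : `|x ord0 i| <= `|x|.
Proof.
rewrite [leRHS]/Num.Def.normr/= mx_normrE.
exact: (le_bigmax _ (fun ij : 'I_1 * 'I_n => `|x ij.1 ij.2|) (ord0, i)).
Qed.

(** The sigma-algebra is generated by the coordinates, so open sets are not measurable by
    definition.  A continuous function is the pointwise limit of its values at the points
    of finer and finer grids, which are constant on countably many boxes. *)
Lemma continuous_measurable_rV n (f : 'rV[R]_n -> R) :
  continuous f -> measurable_fun setT (f : 'rV[R]_n -> measurableTypeR R).
Proof.
move=> cf.
pose fl k (x : 'rV[R]_n) : 'rV[int]_n :=
  \row_i Num.floor (x ord0 i * k.+1%:R).
pose q k (z : 'rV[int]_n) : 'rV[R]_n := \row_i ((z ord0 i)%:~R / k.+1%:R).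
apply: (@measurable_fun_cvg _ _ _ _ (fun k x => f (q k (fl k x)))) => //.
  move=> k _ Y mY; rewrite setTI.
  rewrite (_ : _ @^-1` Y = \bigcup_(z in [set: 'rV[int]_n])
     ((if f (q k z) \in Y then setT else set0) `&` [set x | fl k x = z])).
    apply: countable_bigcupT_measurable => // z; apply: measurableI.
      by case: ifP.
    rewrite (_ : mkset _ = \bigcap_(i in [set: 'I_n])
      ((fun x : 'rV[R]_n => x ord0 i : measurableTypeR R) @^-1`
        `[ (z ord0 i)%:~R / k.+1%:R, (z ord0 i + 1)%:~R / k.+1%:R [%classic)).
      apply: fin_bigcap_measurable => // i _.
      rewrite -[X in measurable X]setTI.
      by apply: measurable_rV_coord => //; exact: measurable_itv.
    apply/seteqP; split => [x/= <- i _|x/= H].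
      rewrite /= in_itv/= mxE ler_pdivrMr// ltr_pdivlMr//.
      by rewrite ge_floor/= floorD1_gt.
    apply/rowP => i; have := H i Logic.I.
    rewrite /= in_itv/= mxE ler_pdivrMr// ltr_pdivlMr// => /andP[? ?].
    by apply: floor_def; apply/andP; split.
  apply/seteqP; split => [x/= Yx|x/= [z _ [Hz zE]]].
    exists (fl k x) => //; split => //; rewrite ifT//; exact/mem_set.
  by move: Hz; rewrite -zE; case: ifPn => // /set_mem.
move=> x _; apply: continuous_cvg; first exact: cf.
apply/cvgrPdist_lt => e e0.
near=> k.
apply: rV_sup_norm => // i; rewrite !mxE.
have k0 : 0 < k.+1%:R :> R by [].
rewrite -(ltr_pM2r k0) -[X in _ * X < _](gtr0_norm k0) -normrM mulrBl.
rewrite divfK ?gt_eqF// ger0_norm ?subr_ge0 ?ge_floor//.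
apply: (@lt_trans _ _ 1).
  by rewrite ltrBlDr addrC; have := floorD1_gt (x ord0 i * k.+1%:R); rewrite intrD.
rewrite -ltr_pdivrMl// mulr1.
near: k.
have := near_infty_natSinv_lt (PosNum e0).
by apply: filterS => k /= h; rewrite invf_plt ?posrE.
Unshelve. all: by end_near. Qed.

End integral_cc.

(** The class of integrands used in all dimensions: it is stable under the
    operations below, and every member is integrable. *)
Definition cc {R : realType} {V : normedModType R} (F : V -> R) : Prop :=
  continuous F /\ exists M, forall x, M < `|x| -> F x = 0.

Section cc_algebra.
Context {R : realType} {V : normedModType R}.
Implicit Types F G : V -> R.

Lemma cc0 : cc (fun _ : V => 0 : R).
Proof. by split; [move=> x; exact: cvg_cst|exists 0]. Qed.

Lemma ccD F G : cc F -> cc G -> cc (fun x => F x + G x).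
Proof.
move=> [cF [M FM]] [cG [L GL]]; split.
  by move=> x; apply: cvgD; [exact: cF|exact: cG].
by exists (Num.max M L) => x; rewrite gt_max => /andP[/FM-> /GL->]; rewrite addr0.
Qed.

Lemma ccMl F G : continuous F -> cc G -> cc (fun x => F x * G x).
Proof.
move=> cF [cG [L GL]]; split.
  by move=> x; apply: cvgM; [exact: cF|exact: cG].
by exists L => x /GL->; rewrite mulr0.
Qed.

Lemma ccZ a F : cc F -> cc (fun x => a * F x).
Proof. by apply: ccMl => x; exact: cvg_cst. Qed.

Lemma ccMr F G : cc F -> continuous G -> cc (fun x => F x * G x).
Proof. by move=> cF cG; under eq_fun do rewrite mulrC; exact: ccMl. Qed.

Lemma cc_sum n (F : 'I_n -> V -> R) :
  (forall i, cc (F i)) -> cc (fun x => \sum_(i < n) F i x).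
Proof.
elim: n F => [|n IH] F cF; first by under eq_fun do rewrite big_ord0; exact: cc0.
by under eq_fun do rewrite big_ord_recl; apply: ccD => //; exact: IH.
Qed.

Lemma cc_norm F : cc F -> cc (fun x => `|F x|).
Proof.
move=> [cF [M FM]]; split; last by exists M => x /FM->; rewrite normr0.
by move=> x; apply: (@cvg_norm _ R^o); exact: cF.
Qed.

Lemma cc_comp (W : normedModType R) (F : V -> R) (h : W -> V) :
  continuous h -> (forall M, exists L, forall y, L < `|y| -> M < `|h y|) ->
  cc F -> cc (F \o h).
Proof.
move=> ch hinf [cF [M FM]]; split.
  by move=> x; apply: continuous_comp; [exact: ch|exact: cF].
by have [L hL] := hinf M; exists L => y /hL; exact: FM.
Qed.

Lemma cc_bounded F :
  (forall M : R, 0 < M -> compact [set x : V | `|x| <= M]) ->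
  cc F -> exists2 C : R, 0 <= C & forall x, `|F x| <= C.
Proof.
move=> cpt [cF [M FM]].
have M0 : 0 < Num.max M 1 by rewrite lt_max ltr01 orbT.
(* The maximum with 1 keeps the radius positive when the support is trivial. *)
have : compact (F @` [set x : V | `|x| <= Num.max M 1]).
  apply: continuous_compact; last exact: cpt.
  exact: continuous_subspaceT.
move=> /compact_bounded[C [_ hC]].
exists (`|C| + 1); first by rewrite addr_ge0.
move=> x; have [xM|xM] := leP `|x| (Num.max M 1).
  by apply: hC; [rewrite (le_lt_trans (ler_norm _))// ltrDl|exists x].
by rewrite FM ?normr0 ?addr_ge0// (le_lt_trans _ xM)// le_max lexx.
Qed.

(** Difference quotients of [f] and [g] agree when [f] restricted to one affine
    line is [g] restricted to another one.  This transports derivatives through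
    slices, translations and reflections. *)
Lemma derive_line (W : normedModType R) (f : V -> R) (g : W -> R) a v b w :
  (forall h : R, f (h *: v + a) = g (h *: w + b)) ->
  'D_v f a = 'D_w g b /\ (derivable f a v <-> derivable g b w).
Proof.
move=> fg; have q : (fun h : R => h^-1 *: ((f \o shift a) (h *: v) - f a)) =
  (fun h : R => h^-1 *: ((g \o shift b) (h *: w) - g b)).
  apply/funext => h /=; rewrite fg.
  by have := fg 0; rewrite !scale0r !add0r => ->.
by rewrite /derive /derivable q.
Qed.

(** The way in which every derivative below is seen to have the support of the
    function. *)
Lemma derive_near0 (F : V -> R) a v :
  (\forall x \near a, F x = 0) -> 'D_v F a = 0 /\ derivable F a v.
Proof.
move=> F0; have F0' : \forall x \near a, cst 0 x = F x by apply: filterS F0 => x /= ->.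
split; first by rewrite -(near_eq_derive v F0') derive_cst.
by apply: (near_eq_derivable F0'); exact: derivable_cst.
Qed.

Lemma cc_derive F v : cc F -> continuous ('D_v F) -> cc ('D_v F).
Proof.
move=> [cF [M FM]] cDF; split => //; exists M => x Mx.
apply: (proj1 (derive_near0 _ _)).
have : \forall y \near x, M < `|y|.
  by apply: (cvgr_gt `|x|) => //; exact: norm_continuous.
by apply: filterS => y; exact: FM.
Qed.
End cc_algebra.

(** * Integrals over the line *)

Section integral_cc1.
Context {R : realType}.
Notation mu := (@lebesgue_measure R).
Implicit Types F : R -> R.

Lemma cc1_bounded F : cc F -> exists2 C : R, 0 <= C & forall x, `|F x| <= C.
Proof.
apply: cc_bounded => M M0.
rewrite (_ : mkset _ = `[(- M), M]%classic); first exact: segment_compact.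
by apply/seteqP; split => x /=; rewrite in_itv/= ler_norml.
Qed.

Lemma integrable_supp d (T : measurableType d) (m : {measure set T -> \bar R})
    (A : set T) (F : T -> R) (C : R) :
  measurable A -> (m A < +oo)%E -> measurable_fun setT F ->
  (forall x, `|F x| <= C) -> (forall x, ~ A x -> F x = 0) ->
  m.-integrable setT (EFin \o F).
Proof.
move=> mA Aoo mF FC FA.
have : m.-integrable A (EFin \o F).
  apply: measurable_bounded_integrable => //; first exact: measurable_funTS.
  by exists C; split; [exact: num_real|move=> x Cx y _; apply: (le_trans (FC y)); exact: ltW].
move/(integrable_mkcond _ mA); congr (integrable _ _ _).
apply/funext => x; rewrite /patch; case: ifPn => // /negP xA /=.
by rewrite FA// => Ax; apply: xA; exact/mem_set.
Qed.

Lemma Rintegral_gt0 d (T : measurableType d) (m : {measure set T -> \bar R})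
    (A : set T) (F : T -> R) (c : R) :
  measurable A -> (0 < m A < +oo)%E -> 0 < c -> m.-integrable setT (EFin \o F) ->
  (forall x, 0 <= F x) -> (forall x, A x -> c <= F x) -> 0 < \int[m]_x F x.
Proof.
move=> mA /andP[A0 Aoo] c0 iF F0 FA.
have iA k : 0 <= k -> m.-integrable setT (EFin \o (fun x => k * \1_A x)).
  move=> k0; apply: (@integrable_supp _ _ _ A _ k) => //; first exact: measurable_funM.
    by move=> x; rewrite normrM !ger0_norm// indicE; case: (x \in A); rewrite ?mulr1 ?mulr0.
  by move=> x xA; rewrite indicE memNset// mulr0.
apply: (@lt_le_trans _ _ (\int[m]_x (c * \1_A x))).
  rewrite RintegralZl//; last by have := iA 1 ler01; under eq_fun do rewrite mul1r.
  by rewrite mulr_gt0// /Rintegral integral_indic// setIT fine_gt0// A0.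
apply: le_Rintegral => //; first by apply: iA; exact: ltW.
move=> x _; rewrite indicE; case: (boolP (x \in A)) => [/set_mem /FA|_]; first by rewrite mulr1.
by rewrite mulr0.
Qed.

Lemma cc1_integrable F : cc F -> mu.-integrable setT (EFin \o F).
Proof.
move=> cF; have [C C0 FC] := cc1_bounded cF; have [cF' [M FM]] := cF.
apply: (@integrable_supp _ _ mu `[- M, M]%classic F C) => //.
- by rewrite [X in (X < _)%E]lebesgue_measure_itv/=; case: ifP => //; rewrite -EFinB ltry.
- exact: continuous_measurable_fun.
- move=> x; rewrite /= in_itv/= -ler_norml => /negP; rewrite -ltNge; exact: FM.
Qed.

Lemma Rintegral_itv_supp F (a b : R) : (forall x, x < a \/ b < x -> F x = 0) ->
  \int[mu]_x F x = \int[mu]_(x in `[a, b]) F x.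
Proof.
move=> F0; rewrite [RHS]Rintegral_mkcond; apply: eq_Rintegral => x _.
rewrite /patch; case: ifPn => // /negP xab; rewrite F0//.
have [?|?] := ltP x a; first by left.
right; rewrite ltNge; apply/negP => ?; apply: xab; apply/mem_set.
by rewrite /= in_itv/=; apply/andP.
Qed.

Lemma Rintegral_FTC (F G : R -> R) (a b : R) : a < b -> continuous F -> continuous G ->
  (forall x, derivable G x 1) -> (forall x, derive1 G x = F x) ->
  \int[mu]_(x in `[a, b]) F x = G b - G a.
Proof.
move=> ab cF cG dG G'.
rewrite /Rintegral (@continuous_FTC2 _ F G)//.
- exact: continuous_subspaceT.
- split => //; [exact: cvg_at_right_filter (cG _)|exact: cvg_at_left_filter (cG _)].
Qed.

Lemma derivable1_continuous F : (forall x, derivable F x 1) -> continuous F.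
Proof. by move=> dF x; apply: differentiable_continuous; apply/derivable1_diffP. Qed.

(** The integral is that over a segment containing the support, at the ends of
    which [F] vanishes. *)
Lemma Rintegral_derive_cc F : cc F -> (forall x, derivable F x 1) ->
  continuous (derive1 F) -> \int[mu]_x derive1 F x = 0.
Proof.
move=> [cF [M FM]] dF cDF.
have M1 : 0 < `|M| + 1 by rewrite ltr_wpDl.
have FM' x : `|M| + 1 <= `|x| -> F x = 0.
  by move=> h; apply: FM; rewrite (lt_le_trans _ h)// (le_lt_trans (ler_norm _))// ltrDl.
rewrite (@Rintegral_itv_supp _ (- (`|M| + 1)) (`|M| + 1)).
  rewrite (@Rintegral_FTC (derive1 F) F)//; last by rewrite gtrN.
  by rewrite !FM' ?subrr// ?normrN (gtr0_norm M1).
have nM := normr_ge0 M.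
move=> x xM; rewrite derive1E; apply: (proj1 (derive_near0 _ _)).
have : \forall y \near x, `|M| + 1 < `|y|.
  apply: (cvgr_gt `|x| (@norm_continuous _ _ x)).
  by case: xM => xM; [rewrite [ltRHS]ltr0_norm; lra|rewrite [ltRHS]gtr0_norm; lra].
by apply: filterS => y /ltW; exact: FM'.
Qed.

Lemma Rintegral_primitive F : cc F ->
  let G x := \int[mu]_(t in `]-oo, x]) F t in
  (forall x, derivable G x 1) /\ (forall x, derive1 G x = F x).
Proof.
move=> cF G.
have H x : derivable G x 1 /\ derive1 G x = F x.
  apply: (@continuous_FTC1 R F (BInfty _ true) x (x + 1)) => //=.
  - by rewrite ltrDl.
  - by apply: integrableS (cc1_integrable cF) => //; exact: measurable_itv.
  - by rewrite ltNyr.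
  - exact: (proj1 cF x).
by split => x; have [] := H x.
Qed.

Lemma Rintegral_reflect F c : cc F -> \int[mu]_x F (c - x) = \int[mu]_x F x.
Proof.
move=> cF; have [dG G'] := Rintegral_primitive cF.
set G := (fun x => _) in dG G'.
have [cF' [M FM]] := cF.
pose L := `|M| + `|c| + 1.
have L0 : 0 < L by rewrite ltr_wpDl.
have FL x : `|M| < `|x| -> F x = 0.
  by move=> h; apply: FM; rewrite (le_lt_trans (ler_norm _)).
have nM := normr_ge0 M.
have cc_ : - `|c| <= c <= `|c| by rewrite -ler_norml.
rewrite (@Rintegral_itv_supp _ (- L) L); last first.
  move=> x xL; apply: FL; rewrite /L in xL; case: xL => ?.
    by rewrite [ltRHS]gtr0_norm; lra.
  by rewrite [ltRHS]ltr0_norm; lra.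
rewrite (@Rintegral_itv_supp F (c - L) (c + L)); last first.
  move=> x xL; apply: FL; rewrite /L in xL; case: xL => ?.
    by rewrite [ltRHS]ltr0_norm; lra.
  by rewrite [ltRHS]gtr0_norm; lra.
have cG : continuous G by exact: derivable1_continuous.
rewrite (@Rintegral_FTC F G)//; last by lra.
have dH (x : R) : is_derive x 1 (fun x : R => - G (c - x)) (F (c - x)).
  have h1 : is_derive x 1 (fun x : R => c - x) (-1).
    have := @is_deriveB _ _ _ (cst c) id x 1 0 1 _ _; rewrite sub0r; exact.
  have h2 : is_derive (c - x) 1 G (F (c - x)).
    by apply: DeriveDef => //; rewrite -derive1E G'.
    have := @is_derive1_comp _ G (fun x : R => c - x) x _ _ h2 h1 => h.
  by apply: is_derive_eq; rewrite mulrN1 opprK.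
have dH1 (x : R) : derivable (fun x : R => - G (c - x)) x 1 by have [] := dH x.
rewrite (@Rintegral_FTC _ (fun x => - G (c - x)))//.
- by rewrite opprK addrC opprK.
- lra.
- move=> x; apply: continuous_comp; last exact: cF'.
  by apply: cvgB => //; exact: cvg_cst.
- exact: derivable1_continuous.
- by move=> x; rewrite derive1E; have [_ ->] := dH x.
Qed.
End integral_cc1.

(** * Integrals over the Euclidean space as iterated integrals *)

Section integral_ccn.
Context {R : realType}.
Notation mu := (@lebesgue_measure R).
(** Functions supported in an annulus of the ball have the same integral over the ball, by
    [intV_eball], so that all integrals can be taken over the whole space. *)
Definition intV n (F : 'rV[R]_n -> R) : R := \int[lebesgue_rV n]_x F x.

Lemma compact_ball_rV n (M : R) : compact [set x : 'rV[R]_n | `|x| <= M].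
Proof.
apply: bounded_closed_compact.
  by exists M; split; [exact: num_real|move=> r Mr x /= xM; exact: le_trans xM (ltW Mr)].
apply: (@preimage_closed _ _ (Num.norm : 'rV[R]_n -> R) [set r : R | r <= M]).
  by move=> x _; exact: norm_continuous.
exact: closed_le.
Qed.

Lemma ccn_bounded n (F : 'rV[R]_n -> R) :
  cc F -> exists2 C : R, 0 <= C & forall x, `|F x| <= C.
Proof. by apply: cc_bounded => M _; exact: compact_ball_rV. Qed.

Definition cube n (M : R) : set 'rV[R]_n :=
  [set x | forall i, `[- M, M]%classic (x ord0 i)].

Lemma measurable_cube n M : measurable (@cube n M).
Proof.
rewrite (_ : cube _ = \bigcap_(i in [set: 'I_n])
    ((fun x : 'rV[R]_n => x ord0 i : measurableTypeR R) @^-1` `[- M, M]%classic)).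
  apply: fin_bigcap_measurable => // i _.
  rewrite -[X in measurable X]setTI.
  by apply: measurable_rV_coord => //; exact: measurable_itv.
by apply/seteqP; split => x /= xM i; [move=> _|]; exact: xM.
Qed.

Lemma cube_finite n M : (lebesgue_rV n (@cube n M) < +oo)%E.
Proof.
have -> : lebesgue_rV n (@cube n M) = (\prod_(i < n) mu (`[(- M)%R, M%R]%classic : set R))%E.
  by rewrite -lebesgue_rV_box// => i; exact: measurable_itv.
apply: (@proj2 (0 <= \prod_(i < n) mu (`[(- M)%R, M%R]%classic : set R))%E).
apply: (@big_ind _ (fun x : \bar R => 0 <= x /\ x < +oo)%E) => //.
- by split; rewrite ?lee_fin// ltry.
- by move=> x y [x0 xoo] [y0 yoo]; split; [exact: mule_ge0|apply: lte_mul_pinfty => //; rewrite ge0_fin_numE].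
move=> i _; split; first exact: measure_ge0.
by rewrite [X in (X < _)%E]lebesgue_measure_itv/=; case: ifP => //; rewrite -EFinB ltry.
Qed.

Lemma notin_cube n M (x : 'rV[R]_n) : ~ cube M x -> exists i, M < `|x ord0 i|.
Proof.
apply: contra_notP => /forallNP H i /=.
by rewrite in_itv/= -ler_norml leNgt; apply/negP/H.
Qed.

Lemma ccn_integrable n (F : 'rV[R]_n -> R) :
  cc F -> (lebesgue_rV n).-integrable setT (EFin \o F).
Proof.
move=> cF; have [C C0 FC] := ccn_bounded cF; have [cF' [M FM]] := cF.
apply: (@integrable_supp _ _ _ _ (@cube n M) F C) => //.
- exact: measurable_cube.
- exact: cube_finite.
- exact: continuous_measurable_rV.
- by move=> x /notin_cube[i xi]; apply: FM; exact: lt_le_trans xi (ler_coord_norm _ _).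
Qed.

Lemma norm_consrV_l n a (y : 'rV[R]_n) : `|a| <= `|consrV (a, y)|.
Proof. by have := ler_coord_norm (consrV (a, y)) ord0; rewrite consrV0. Qed.

Lemma norm_consrV_r n a (y : 'rV[R]_n) : `|y| <= `|consrV (a, y)|.
Proof.
rewrite {1}/Num.Def.normr/= mx_normrE; apply/bigmax_leP; split => //= -[i j] _ /=.
by have := ler_coord_norm (consrV (a, y)) (lift ord0 j); rewrite consrVS/= (ord1 i).
Qed.

Lemma consrV_integrable n (F : 'rV[R]_n.+1 -> R) : cc F ->
  (lebesgue_measure \x lebesgue_rV n)%E.-integrable setT (EFin \o (F \o @consrV R n)).
Proof.
move=> cF; have [C C0 FC] := ccn_bounded cF; have [cF' [M FM]] := cF.
refine (@integrable_supp _ _ _ (mu \x lebesgue_rV n)%E (`[- M, M]%classic `*` @cube n M) (F \o @consrV R n) C _ _ _ _ _) => //.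
- by apply: measurableX; [exact: measurable_itv|exact: measurable_cube].
- have := product_measure1E mu (lebesgue_rV n) (@measurable_itv R _ : measurable (`[- M, M]%classic : set R)) (@measurable_cube n M).
  move=> E; rewrite [X in (X < _)%E]E; apply: lte_mul_pinfty; last exact: cube_finite.
    exact: measure_ge0.
  by rewrite [X in X \is a fin_num]lebesgue_measure_itv/=; case: ifP.
- apply: (measurableT_comp (continuous_measurable_rV cF')); exact: measurable_consrV.
- by move=> p; exact: FC.
- move=> -[a y] /= /not_andP[|].
    rewrite in_itv/= -ler_norml => /negP; rewrite -ltNge => aM.
    by apply: FM; exact: lt_le_trans aM (norm_consrV_l _ _).
  move=> /notin_cube[i yi]; apply: FM; apply: lt_le_trans yi _.
  exact: le_trans (ler_coord_norm _ _) (norm_consrV_r _ _).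
Qed.

Lemma continuous_rV (T : topologicalType) n (f : T -> 'rV[R]_n) :
  (forall i, continuous (fun t => f t ord0 i)) -> continuous f.
Proof.
move=> cf t; apply/cvgrPdist_lt => e e0.
have : \forall s \near t, forall i, `|f t ord0 i - f s ord0 i| < e.
  apply: filter_forall => i.
  by have /cvgrPdist_lt := cf i t; apply.
apply: filterS => s H; apply: rV_sup_norm => // i.
by rewrite !mxE.
Qed.

Lemma continuous_consrV_r n (a : R) : continuous (fun y => @consrV R n (a, y)).
Proof.
apply: continuous_rV => i; case: (unliftP ord0 i) => [j|] ->.
  rewrite (_ : (fun _ => _) = fun y : 'rV[R]_n => y ord0 j); first exact: coord_continuous.
  by apply/funext => y; rewrite consrVS.
rewrite (_ : (fun _ => _) = cst a); first exact: cst_continuous.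
by apply/funext => y; rewrite consrV0.
Qed.

Lemma continuous_consrV_l n (y : 'rV[R]_n) : continuous (fun a => @consrV R n (a, y)).
Proof.
apply: continuous_rV => i; case: (unliftP ord0 i) => [j|] ->.
  rewrite (_ : (fun _ => _) = cst (y ord0 j)); first exact: cst_continuous.
  by apply/funext => a; rewrite consrVS.
rewrite (_ : (fun _ => _) = @idfun R); first by move=> a; exact: cvg_id.
by apply/funext => a; rewrite consrV0.
Qed.

Lemma cc_consrV_l n (F : 'rV[R]_n.+1 -> R) y : cc F -> cc (fun a => F (consrV (a, y))).
Proof.
apply: cc_comp; first exact: continuous_consrV_l.
by move=> M; exists M => a aM; exact: lt_le_trans aM (norm_consrV_l _ _).
Qed.

Lemma cc_consrV_r n (F : 'rV[R]_n.+1 -> R) a : cc F -> cc (fun y => F (consrV (a, y))).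
Proof.
apply: cc_comp; first exact: continuous_consrV_r.
by move=> M; exists M => y yM; exact: lt_le_trans yM (norm_consrV_r _ _).
Qed.

(** Lebesgue measure is an iterated product, so Fubini's theorem gives both orders
    of integration.  They start the inductions on the dimension below. *)
Lemma Rintegral_consrV n (F : 'rV[R]_n.+1 -> R) : cc F ->
  intV F = \int[mu]_a intV (fun y => F (consrV (a, y))) /\
  intV F = intV (fun y => \int[mu]_a F (consrV (a, y))).
Proof.
move=> cF; have iF := consrV_integrable cF.
have -> : intV F = fine (\int[lebesgue_measure \x lebesgue_rV n]_p (EFin \o (F \o @consrV R n)) p)%E.
  congr fine; apply: etrans (@integral_pushforward _ _ _ _ _ (@consrV R n) _
    (mu \x lebesgue_rV n)%E setT (EFin \o F) _ _ _) _ => //.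
  - exact: (proj2 (measurable_EFinP setT F) (continuous_measurable_rV (proj1 cF))).
split.
  rewrite -(integral12_prod_meas1 iF) /intV /Rintegral; congr fine; apply: eq_integral => a _.
  rewrite /fubini_F fineK//.
  by apply: integrable_fin_num => //; exact: ccn_integrable (cc_consrV_r a cF).
rewrite -(integral21_prod_meas1 iF) /intV /Rintegral; congr fine; apply: eq_integral => y _.
rewrite /fubini_G fineK//.
by apply: integrable_fin_num => //; exact: cc1_integrable (cc_consrV_l y cF).
Qed.

End integral_ccn.

Notation "''d_' i F" := (derive F ^~ (delta_mx 0 i))
  (at level 10, i at level 2, F at next level, format "''d_' i  F").

(** * Partial integration, reflection and positivity *)

Section intV_theory.
Context {R : realType}.
Notation mu := (@lebesgue_measure R).

Lemma intVD n (F G : 'rV[R]_n -> R) : cc F -> cc G ->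
  intV (fun x => F x + G x) = intV F + intV G.
Proof. by move=> cF cG; rewrite /intV RintegralD//; exact: ccn_integrable. Qed.

Lemma intVZ n a (F : 'rV[R]_n -> R) : cc F -> intV (fun x => a * F x) = a * intV F.
Proof. by move=> cF; rewrite /intV RintegralZl//; exact: ccn_integrable. Qed.

Lemma intVB n (F G : 'rV[R]_n -> R) : cc F -> cc G ->
  intV (fun x => F x - G x) = intV F - intV G.
Proof. by move=> cF cG; rewrite /intV RintegralB//; exact: ccn_integrable. Qed.

Lemma intV_sum n m (F : 'I_m -> 'rV[R]_n -> R) : (forall i, cc (F i)) ->
  intV (fun x => \sum_(i < m) F i x) = \sum_(i < m) intV (F i).
Proof.
elim: m F => [|m IH] F cF.
  by under eq_fun do rewrite big_ord0; rewrite big_ord0 /intV Rintegral_cst ?mul0r.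
under eq_fun do rewrite big_ord_recl.
by rewrite intVD ?big_ord_recl ?IH//; exact: cc_sum.
Qed.

Lemma le_intV n (F G : 'rV[R]_n -> R) : cc F -> cc G ->
  (forall x, F x <= G x) -> intV F <= intV G.
Proof. by move=> cF cG FG; apply: le_Rintegral => //; exact: ccn_integrable. Qed.

Lemma ler_norm_intV n (F : 'rV[R]_n -> R) : cc F ->
  `|intV F| <= intV (fun x => `|F x|).
Proof. by move=> cF; apply: le_normr_Rintegral => //; exact: ccn_integrable. Qed.

Lemma line_coord n (h : R) i j (x : 'rV[R]_n) :
  (h *: delta_mx 0 i + x) ord0 j = h * (j == i)%:R + x ord0 j.
Proof. by rewrite !mxE. Qed.

Lemma sub_coord n (x y : 'rV[R]_n) j : (x - y) ord0 j = x ord0 j - y ord0 j.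
Proof. by rewrite !mxE. Qed.

Lemma consrV_line0 n (a h : R) (y : 'rV[R]_n) :
  h *: delta_mx 0 ord0 + consrV (a, y) = consrV (h * 1 + a, y).
Proof.
apply/rowP => i; rewrite line_coord; case: (unliftP ord0 i) => [j|] ->.
  by rewrite !consrVS eq_sym (negbTE (neq_lift _ _)) mulr0 add0r.
by rewrite !consrV0 eqxx.
Qed.

Lemma consrV_lineS n (a h : R) (y : 'rV[R]_n) j :
  h *: delta_mx 0 (lift ord0 j) + consrV (a, y) = consrV (a, h *: delta_mx 0 j + y).
Proof.
apply/rowP => i; rewrite line_coord; case: (unliftP ord0 i) => [k|] ->.
  by rewrite !consrVS line_coord (inj_eq (@lift_inj _ _)).
by rewrite !consrV0 (negbTE (neq_lift _ _)) mulr0 add0r.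
Qed.

(** By Fubini, integrate first in the variable of differentiation: if it is the
    first coordinate the inner integral is that of a derivative on the line,
    otherwise the slices satisfy the induction hypothesis. *)
Lemma intV_derive n i (F : 'rV[R]_n -> R) : cc F ->
  (forall x, derivable F x (delta_mx 0 i)) -> continuous ('d_i F) ->
  intV ('d_i F) = 0.
Proof.
elim: n i F => [[]//|n IH] i F cF dF cDF.
have cD := cc_derive cF cDF.
have [E1 E2] := Rintegral_consrV cD.
case: (unliftP ord0 i) => [j|] iE; subst i.
  rewrite E1.
  have H a : intV (fun y => 'd_(lift ord0 j) F (consrV (a, y))) = 0.
    pose G y := F (consrV (a, y)).
    have HG y := @derive_line _ _ _ F G (consrV (a, y)) (delta_mx 0 (lift ord0 j))
      y (delta_mx 0 j) (fun h => congr1 F (consrV_lineS a h y j)).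
    have GE : (fun y => 'd_(lift ord0 j) F (consrV (a, y))) = 'd_j G.
      by apply/funext => y; have [-> _] := HG y.
    rewrite GE; apply: IH.
    - exact: cc_consrV_r.
    - by move=> y; exact: (proj1 (proj2 (HG y)) (dF _)).
    - by rewrite -GE; have [] := cc_consrV_r a cD.
  under eq_Rintegral do rewrite H.
  by rewrite Rintegral_cst ?mul0r.
rewrite E2.
have H y : \int[mu]_a 'd_ord0 F (consrV (a, y)) = 0.
  pose G a := F (consrV (a, y)).
  have HG a := @derive_line _ _ _ F G (consrV (a, y)) (delta_mx 0 ord0)
      a 1 (fun h => congr1 F (consrV_line0 a h y)).
  have GE : (fun a => 'd_ord0 F (consrV (a, y))) = derive1 G.
    by apply/funext => a; rewrite derive1E; have [-> _] := HG a.
  rewrite GE; apply: Rintegral_derive_cc.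
  - exact: cc_consrV_l.
  - by move=> a; exact: (proj1 (proj2 (HG a)) (dF _)).
  - by rewrite -GE; have [] := cc_consrV_l y cD.
rewrite /intV; under eq_Rintegral do rewrite H.
by rewrite Rintegral_cst ?mul0r.
Qed.

Lemma cc_reflect (V : normedModType R) (c : V) (F : V -> R) :
  cc F -> cc (fun x => F (c - x)).
Proof.
apply: cc_comp.
  by move=> x; apply: cvgB; [exact: cvg_cst|exact: cvg_id].
move=> M; exists (M + `|c|) => y yM.
have : `|y| <= `|c| + `|c - y|.
  by rewrite -{1}(subKr c y) (le_trans (ler_normB _ _)).
by move: yM; lra.
Qed.

(** The reflection is composed of a reflection of the first coordinate and one of
    the others; each acts on one of the two factors of the product measure. *)
Lemma intV_reflect n c (F : 'rV[R]_n -> R) : cc F ->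
  intV (fun x => F (c - x)) = intV F.
Proof.
elim: n c F => [|n IH] c F cF.
  by congr intV; apply/funext => x; congr F; apply/rowP => -[].
pose c' : 'rV[R]_n := \row_i c ord0 (lift ord0 i).
have cE a y : c - consrV (a, y) = consrV (c ord0 ord0 - a, c' - y).
  apply/rowP => i; rewrite sub_coord; case: (unliftP ord0 i) => [j|] ->.
    by rewrite !consrVS sub_coord mxE.
  by rewrite !consrV0.
pose h (x : 'rV[R]_n.+1) : 'rV[R]_n.+1 :=
  \row_i (if i == ord0 then c ord0 ord0 - x ord0 ord0 else x ord0 i).
have hE a y : h (consrV (a, y)) = consrV (c ord0 ord0 - a, y).
  apply/rowP => i; rewrite mxE; case: (unliftP ord0 i) => [j|] ->.
    by rewrite !consrVS.
  by rewrite !consrV0.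
have ch : continuous h.
  apply: continuous_rV => i; case: (unliftP ord0 i) => [j|] ->.
    rewrite (_ : (fun _ => _) = fun x : 'rV[R]_n.+1 => x ord0 (lift ord0 j)).
      exact: coord_continuous.
    by apply/funext => x; rewrite mxE.
  rewrite (_ : (fun _ => _) = fun x : 'rV[R]_n.+1 => c ord0 ord0 - x ord0 ord0).
    move=> x; apply: (@continuousB _ _ _ (cst (c ord0 ord0)) (fun x : 'rV[R]_n.+1 => x ord0 ord0)).
      exact: cst_continuous.
    exact: coord_continuous.
  by apply/funext => x; rewrite mxE.
have cFh : cc (F \o h).
  apply: cc_comp cF; first exact: ch.
  move=> M; exists (`|M| + `|c|) => x xM.
  rewrite ltNge; apply/negP => hM; move: xM; apply/negP; rewrite -leNgt.
  rewrite {1}/Num.Def.normr/= mx_normrE.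
  apply/bigmax_leP; split => /=; first by rewrite addr_ge0.
  move=> -[i j] _ /=; rewrite (ord1 i).
  have hM' : `|h x| <= `|M| by exact: le_trans hM (ler_norm _).
  case: (unliftP ord0 j) => [k|] ->.
    have := ler_coord_norm (h x) (lift ord0 k); rewrite mxE/= => hx.
    by apply: le_trans hx _; rewrite (le_trans hM')// lerDl.
  have := ler_coord_norm (h x) ord0; rewrite mxE/= => hx.
  have := ler_coord_norm c ord0 => hc.
  have := ler_normB (c ord0 ord0) (c ord0 ord0 - x ord0 ord0).
  by rewrite subKr; lra.
have [-> _] := Rintegral_consrV (cc_reflect c cF).
transitivity (intV (F \o h)).
  have [-> _] := Rintegral_consrV cFh.
  apply: eq_Rintegral => a _ /=.
  under eq_fun do rewrite cE.
  rewrite (IH c' (fun y => F (consrV (c ord0 ord0 - a, y))) (cc_consrV_r _ cF)).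
  by congr intV; apply/funext => y; rewrite hE.
have [_ ->] := Rintegral_consrV cFh.
have [_ ->] := Rintegral_consrV cF.
apply: eq_Rintegral => y _ /=.
under eq_Rintegral do rewrite hE.
exact: (Rintegral_reflect (c ord0 ord0) (cc_consrV_l y cF)).
Qed.

Lemma intV_ge0 n (F : 'rV[R]_n -> R) : (forall x, 0 <= F x) -> 0 <= intV F.
Proof. by move=> F0; apply: Rintegral_ge0. Qed.

(** The function is at least [F x0 / 2] on a cube around [x0], and cubes have
    positive measure. *)
Lemma intV_gt0 n (F : 'rV[R]_n -> R) x0 : cc F -> (forall x, 0 <= F x) ->
  0 < F x0 -> 0 < intV F.
Proof.
move=> cF F0 Fx0.
(* A radius of the sup norm, so that the ball is a box. *)
have [d /= d0 hd] : exists2 d : R, 0 < d & forall x, `|x0 - x| < d -> F x0 / 2 < F x.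
  have : \forall x \near x0, F x0 / 2 < F x.
    by apply: (cvgr_gt (F x0) (proj1 cF x0)); rewrite ltr_pdivrMr// ltr_pMr// ltr1n.
  by move=> /nbhs_ballP[d d0 hd]; exists d => // x xd; apply: hd; rewrite -ball_normE.
pose B (i : 'I_n) : set (measurableTypeR R) :=
  `]x0 ord0 i - d, x0 ord0 i + d[%classic.
pose A := [set x : 'rV[R]_n | forall i, B i (x ord0 i)].
have mA : measurable A.
  rewrite (_ : A = \bigcap_(i in [set: 'I_n])
    ((fun x : 'rV[R]_n => x ord0 i : measurableTypeR R) @^-1` B i)).
    apply: fin_bigcap_measurable => // i _.
    rewrite -[X in measurable X]setTI.
    by apply: measurable_rV_coord => //; exact: measurable_itv.
  by apply/seteqP; split => x /= xM i; [move=> _|]; exact: xM.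
have lB i : mu (B i) = (d + d)%:E.
  rewrite lebesgue_measure_itv/= lte_fin ifT; last by lra.
  by rewrite -EFinB; congr EFin; lra.
have lA : lebesgue_rV n A = ((d + d) ^+ n)%:E.
  rewrite lebesgue_rV_box; last by move=> i; exact: measurable_itv.
  under eq_bigr do rewrite lB.
  by rewrite prodEFin big_const_ord iter_mulr_1.
apply: (@Rintegral_gt0 _ _ _ _ A _ (F x0 / 2)) => //; first 1 last.
- by rewrite divr_gt0.
- exact: ccn_integrable.
- move=> x Ax; apply/ltW/hd; apply: rV_sup_norm => // i; rewrite !mxE.
  by have := Ax i; rewrite /B/= in_itv/= => /andP[? ?]; rewrite ltr_norml; lra.
by rewrite [X in (_ < X < _)%E]lA ltry lte_fin exprn_gt0//; lra.
Qed.

End intV_theory.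

(** * Smooth functions of one variable and cut-offs *)

Section smooth1.
Context {R : realType}.
Implicit Types (U : set R) (f g : R -> R).

(** Differentiability up to a finite order is the notion that can be proved by
    induction for products and compositions. *)
Definition diffk (k : nat) U f : Prop :=
  forall j x, (j <= k)%N -> U x -> derivable (derive1n j f) x 1.

Definition smooth1 U f : Prop := forall k, diffk k U f.

Lemma diffk0 U f : diffk 0 U f <-> (forall x, U x -> derivable f x 1).
Proof.
split=> [H x Ux|H j x]; first exact: (H 0%N x).
by rewrite leqn0 => /eqP ->; exact: H.
Qed.

Lemma diffkS k U f : diffk k.+1 U f <->
  (forall x, U x -> derivable f x 1) /\ diffk k U (derive1 f).
Proof.
split=> [H|[H0 H] [|j] x].
  by split=> [x Ux|j x jk Ux]; [exact: (H 0%N x)|rewrite -derive1Sn; exact: H].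
  by move=> _; exact: H0.
by rewrite derive1Sn; exact: H.
Qed.

Lemma diffk_derivable k U f x : diffk k U f -> U x -> derivable f x 1.
Proof. by move=> H Ux; exact: (H 0%N x). Qed.

Lemma diffkW k U f : diffk k.+1 U f -> diffk k U f.
Proof. by move=> H j x jk; apply: H; exact: leqW. Qed.

Lemma derive1_eq_on U f g : open U -> (forall x, U x -> f x = g x) ->
  forall x, U x -> derive1 f x = derive1 g x.
Proof.
move=> oU fg x Ux; rewrite !derive1E; apply: near_eq_derive.
have : \forall y \near x, U y by exact: open_nbhs_nbhs.
exact: filterS.
Qed.

Lemma derivable_eq_on U f g x : open U -> (forall x, U x -> f x = g x) ->
  U x -> derivable f x 1 -> derivable g x 1.
Proof.
move=> oU fg Ux; apply: near_eq_derivable.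
have : \forall y \near x, U y by exact: open_nbhs_nbhs.
exact: filterS.
Qed.

Lemma diffk_eq k U f g : open U -> (forall x, U x -> f x = g x) ->
  diffk k U f -> diffk k U g.
Proof.
move=> oU; elim: k f g => [|k IH] f g fg.
  by move=> /diffk0 H; apply/diffk0 => x Ux; exact: (derivable_eq_on oU fg Ux (H _ Ux)).
move=> /diffkS[H H']; apply/diffkS; split.
  by move=> x Ux; exact: (derivable_eq_on oU fg Ux (H _ Ux)).
by apply: IH H'; exact: derive1_eq_on.
Qed.

Lemma diffkD k U f g : open U -> diffk k U f -> diffk k U g ->
  diffk k U (fun x => f x + g x).
Proof.
move=> oU; elim: k f g => [|k IH] f g.
  move=> /diffk0 H /diffk0 H'; apply/diffk0 => x Ux.
  by apply: derivableD; [exact: H|exact: H'].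
move=> /diffkS[H K] /diffkS[H' K']; apply/diffkS; split.
  by move=> x Ux; apply: derivableD; [exact: H|exact: H'].
apply: (diffk_eq oU _ (IH _ _ K K')) => x Ux.
by rewrite !derive1E deriveD//; [exact: H|exact: H'].
Qed.

Lemma diffkM k U f g : open U -> diffk k U f -> diffk k U g ->
  diffk k U (fun x => f x * g x).
Proof.
move=> oU; elim: k f g => [|k IH] f g.
  move=> /diffk0 H /diffk0 H'; apply/diffk0 => x Ux.
  by apply: derivableM; [exact: H|exact: H'].
move=> fk gk; have /diffkS[H K] := fk; have /diffkS[H' K'] := gk.
apply/diffkS; split.
  by move=> x Ux; apply: derivableM; [exact: H|exact: H'].
apply: (diffk_eq oU _ (diffkD oU (IH _ _ (diffkW fk) K') (IH _ _ (diffkW gk) K))) => x Ux.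
by rewrite !derive1E deriveM//; [exact: H|exact: H'].
Qed.

Lemma diffk_cst k U c : diffk k U (fun _ => c).
Proof.
elim: k c => [|k IH] c; first by apply/diffk0 => x _; exact: derivable_cst.
apply/diffkS; split=> [x _|]; first exact: derivable_cst.
by rewrite (_ : derive1 _ = fun _ => 0)//; apply/funext => x; rewrite derive1_cst.
Qed.

Lemma diffk_id k U : diffk k U id.
Proof.
case: k => [|k]; first by apply/diffk0 => x _; exact: derivable_id.
apply/diffkS; split=> [x _|]; first exact: derivable_id.
rewrite (_ : derive1 _ = fun _ => 1 : R); first exact: diffk_cst.
by apply/funext => x; rewrite derive1_id.
Qed.

Lemma diffkZ k U c f : open U -> diffk k U f -> diffk k U (fun x => c * f x).
Proof. by move=> oU; apply: diffkM => //; exact: diffk_cst. Qed.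

Lemma diffk_comp k U W f g : open U -> open W -> (forall x, U x -> W (g x)) ->
  diffk k W f -> diffk k U g -> diffk k U (fun x => f (g x)).
Proof.
move=> oU oW UW; elim: k f g UW => [|k IH] f g UW.
  move=> /diffk0 H /diffk0 H'; apply/diffk0 => x Ux.
  apply/derivable1_diffP; apply: differentiable_comp.
    by apply/derivable1_diffP; exact: H'.
  by apply/derivable1_diffP/H/UW.
move=> fk gk; have /diffkS[H K] := fk; have /diffkS[H' K'] := gk.
apply/diffkS; split.
  move=> x Ux; apply/derivable1_diffP; apply: differentiable_comp.
    by apply/derivable1_diffP; exact: H'.
  by apply/derivable1_diffP/H/UW.
apply: (diffk_eq oU _ (diffkM oU (IH (derive1 f) g UW K (diffkW gk)) K')) => x Ux.
by have := derive1_comp (H' x Ux) (H (g x) (UW x Ux)) => /esym.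
Qed.

Lemma open_neq0 : open [set x : R | x != 0].
Proof. exact: open_neq. Qed.

Lemma diffk_inv k : diffk k [set x : R | x != 0] (fun x => x^-1).
Proof.
have dV (x : R) : x != 0 -> derivable (fun x : R => x^-1) x 1.
  by move=> x0; apply: (@derivableV _ _ id) => //; exact: derivable_id.
elim: k => [|k IH]; first by apply/diffk0 => x; exact: dV.
apply/diffkS; split=> [x|]; first exact: dV.
apply: (diffk_eq open_neq0 _ (@diffkZ _ _ (-1) _ open_neq0 (diffkM open_neq0 IH IH))).
move=> x x0; rewrite derive1E (@deriveV _ _ id)//.
by rewrite derive_id scaleNr mulN1r expr2 invfM /GRing.scale/= mulr1.
Qed.

(** At 0 the difference quotient is O(h) by the quadratic bound. *)
Lemma is_derive_pos_part f f' C (x : R) :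
  (forall y : R, 0 < y -> is_derive y 1 f (f' y)) ->
  (forall y : R, 0 < y <= 1 -> `|f y| <= C * y ^+ 2) ->
  is_derive x 1 (fun y : R => if 0 < y then f y else 0) (if 0 < x then f' x else 0).
Proof.
move=> df fC; set g := fun y => _.
have [x0|x0|<-] := ltgtP 0 x.
- have fE : \forall y \near x, f y = g y.
    have : \forall y \near x, 0 < y by exact: lt_nbhsr.
    by apply: filterS => y y0; rewrite /g y0.
  exact: near_eq_is_derive fE (df x x0).
- have fE : \forall y \near x, 0 = g y.
    have : \forall y \near x, y < 0 by exact: lt_nbhsl.
    by apply: filterS => y y0; rewrite /g ltNge ltW.
  by apply: (near_eq_is_derive fE); exact: is_derive_cst.
have H : (h^-1 *: ((g \o shift 0) (h *: 1) - g 0)) @[h --> 0^'] --> (0 : R).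
  rewrite /g ltxx; apply/cvgrPdist_le => e e0.
  have C0 : 0 < `|C| + 1 by [].
  near=> h.
  rewrite sub0r normrN /= subr0 addr0 /GRing.scale/= mulr1.
  case: ifPn => [h0|]; last by rewrite mulr0 normr0 ltW.
  have h1 : `|h| <= 1 by near: h; exact: dnbhs0_le.
  have he : `|h| <= e / (`|C| + 1) by near: h; apply: dnbhs0_le; exact: divr_gt0.
  rewrite gtr0_norm// in h1 he; have := fC h; rewrite h0 h1 => /(_ erefl) fh.
  rewrite normrM normfV (gtr0_norm h0) ler_pdivrMl//; apply: le_trans fh _.
  rewrite expr2 mulrCA ler_pM2l//; rewrite ler_pdivlMr// in he.
  by have := ler_norm C; nra.
apply: DeriveDef; first by apply/cvg_ex; exists 0.
exact/cvg_lim.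
Unshelve. all: by end_near. Qed.

(** The family contains x |-> exp(-1/x) extended by 0, and its linear span is stable
    under derivation, which makes its members smooth. *)
Definition flat n (x : R) : R := if 0 < x then x^-1 ^+ n * expR (- x^-1) else 0.

Lemma flat_ge0 n x : 0 <= flat n x.
Proof.
rewrite /flat; case: ifPn => // x0.
by rewrite mulr_ge0 ?expR_ge0// exprn_ge0// invr_ge0 ltW.
Qed.

(** Compares exp(1/x) with a power of 1/x; applied to [flat n.+1], it gives the quadratic
    bound of [flat n] near 0. *)
Lemma flat_le n x : 0 < x -> flat n x <= n.+1%:R ^+ n.+1 * x.
Proof.
move=> x0; rewrite /flat x0.
have t0 : 0 < x^-1 by rewrite invr_gt0.
set t := x^-1 in t0 *.
have -> : x = t^-1 by rewrite /t invrK.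
rewrite ler_pdivlMr// mulrAC -exprSr.
have E : expR t = expR (t / n.+1%:R) ^+ n.+1.
  by rewrite -expRM_natl mulrCA mulfV ?mulr1.
have : (t / n.+1%:R) ^+ n.+1 <= expR t.
  rewrite E; apply: lerXn2r; rewrite ?nnegrE ?expR_ge0//.
    by rewrite divr_ge0// ltW.
  by apply: le_trans (expR_ge1Dx _); rewrite lerDr.
rewrite expr_div_n ler_pdivrMr ?exprn_gt0// => H.
by rewrite expRN ler_pdivrMr ?expR_gt0// mulrC.
Qed.

Lemma flat_derive n (x : R) : is_derive x 1 (flat n) (flat n.+2 x - n%:R * flat n.+1 x).
Proof.
pose f (y : R) := y^-1 ^+ n * expR (- y^-1).
pose f' (y : R) := y^-1 ^+ n.+2 * expR (- y^-1) - n%:R * (y^-1 ^+ n.+1 * expR (- y^-1)).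
have -> : flat n.+2 x - n%:R * flat n.+1 x = if 0 < x then f' x else 0.
  by rewrite /flat; case: ifP => // _; rewrite mulr0 subr0.
apply: (@is_derive_pos_part f f' (n.+2%:R ^+ n.+2)) => y; last first.
  move=> /andP[y0 _]; have := flat_le n.+1 y0; rewrite /flat y0 exprS -mulrA -/(f y).
  rewrite ler_pdivrMl// mulrCA -expr2 ger0_norm//.
  by rewrite mulr_ge0 ?expR_ge0// exprn_ge0// invr_ge0 ltW.
move=> y0; have yN0 : y != 0 by rewrite gt_eqF.
have h1 : is_derive y 1 (fun y : R => y^-1) (- y ^- 2).
  apply: DeriveDef; first by apply: (@derivableV _ _ id) => //; exact: derivable_id.
  by rewrite (@deriveV _ _ id)// derive_id /GRing.scale/= mulr1.
have h2 : is_derive y 1 (fun y : R => expR (- y^-1)) (expR (- y^-1) * y ^- 2).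
  have hN : is_derive y 1 (fun y : R => - y^-1) (y ^- 2).
    by have := @is_deriveN _ _ _ _ y 1 _ h1; rewrite opprK.
  by have := @is_derive1_comp _ expR (fun y : R => - y^-1) y _ _ (is_derive_expR _) hN.
have := is_deriveM (is_deriveX n h1) h2.
rewrite exprfctE => D; apply: (is_derive_eq D).
rewrite /f' /GRing.scale/= -!exprVn.
by case: n {f f' D} => [|n] /=; rewrite ?expr0 ?exprS; ring.
Qed.

Lemma smooth_flat n : smooth1 setT (flat n).
Proof.
move=> k; elim: k n => [|k IH] n.
  by apply/diffk0 => x _; have [] := flat_derive n x.
apply/diffkS; split=> [x _|]; first by have [] := flat_derive n x.
have -> : derive1 (flat n) = fun x => flat n.+2 x + (- n%:R) * flat n.+1 x.
  by apply/funext => x; rewrite derive1E; have [_ ->] := flat_derive n x; rewrite mulNr.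
by apply: diffkD; [exact: openT|exact: IH|apply: diffkZ; [exact: openT|exact: IH]].
Qed.

Lemma flat_nondecreasing x y : x <= y -> flat 0 x <= flat 0 y.
Proof.
move=> xy; rewrite /flat !mul1r; case: ifPn => x0.
  rewrite (lt_le_trans x0 xy) ler_expR lerN2 lef_pV2// posrE//.
  exact: lt_le_trans xy.
by case: ifPn => //; rewrite expR_ge0.
Qed.

Lemma flat_gt0 x : 0 < x -> 0 < flat 0 x.
Proof. by move=> x0; rewrite /flat x0 mul1r expR_gt0. Qed.

Lemma flat_eq0 n x : x <= 0 -> flat n x = 0.
Proof. by move=> x0; rewrite /flat ltNge x0. Qed.

(** With e = [flat 0], the product phi(x) = e(x - a') e(b' - x) vanishes outside
    of the interval from a' to b' and is at least d > 0 between a and b.  Then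
    e(1 - phi/d) is e(1) where phi = 0 and 0 where phi >= d, so an affine function
    of it is a cut-off. *)
Lemma cutoff_exists (a' a b b' : R) : a' < a -> b < b' ->
  exists chi : R -> R, [/\ smooth1 setT chi,
    forall x, a <= x <= b -> chi x = 1 &
    forall x, x < a' \/ b' < x -> chi x = 0].
Proof.
move=> aa bb.
(* Positive exactly between a' and b'. *)
pose phi x := flat 0 (x - a') * flat 0 (b' - x).
pose d := flat 0 (a - a') * flat 0 (b' - b).
have d0 : 0 < d by rewrite mulr_gt0// flat_gt0// subr_gt0.
have e0 := @flat_gt0 1 ltr01.
exists (fun x => 1 + (- (flat 0 1)^-1) * flat 0 (1 + (- d^-1) * phi x)); split.
- have oT : open [set: R] := openT.
  have flat_comp k f : diffk k setT f -> diffk k setT (fun x => flat 0 (f x)).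
    exact: (@diffk_comp k setT setT (flat 0) f oT oT (fun _ _ => Logic.I) (@smooth_flat 0 k)).
  have sphi k : diffk k setT phi.
    apply: (@diffkM k setT (fun x => flat 0 (x - a')) (fun x => flat 0 (b' - x)) oT).
      exact: flat_comp (diffkD oT (@diffk_id k setT) (@diffk_cst k setT (- a'))).
    apply: flat_comp; apply: (@diffk_eq k setT (fun x => b' + (-1) * x) _ oT).
      by move=> x _; rewrite mulN1r.
    exact: (diffkD oT (@diffk_cst k setT b') (diffkZ oT (@diffk_id k setT))).
  move=> k; apply: (diffkD oT (@diffk_cst k setT 1)); apply: (diffkZ oT); apply: flat_comp.
  exact: (diffkD oT (@diffk_cst k setT 1) (diffkZ oT (sphi k))).
- move=> x /andP[ax xb]; rewrite [X in _ * X]flat_eq0 ?mulr0 ?addr0//.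
  rewrite mulNr subr_le0 mulrC ler_pdivlMr// mul1r.
  by apply: ler_pM; rewrite ?flat_ge0// flat_nondecreasing//; lra.
move=> x xab; have -> : phi x = 0.
  by rewrite /phi; case: xab => h; [rewrite flat_eq0 ?mul0r//|rewrite [X in _ * X]flat_eq0 ?mulr0//]; lra.
by rewrite mulr0 addr0 mulNr mulVf ?subrr// gt_eqF.
Qed.

End smooth1.

(** * Test functions of the radius *)

Section radial_test_functions.
Context {R : realType}.
Notation mu := (@lebesgue_measure R).
Variable Rad : \bar R.
Hypothesis Rad_gt0 : (0 < Rad)%E.
Implicit Types (u w F G : R -> R).

(** A support condition by explicit bounds; the upper bound is strict in the
    extended reals, which covers an infinite radius. *)
Definition supp u : Prop := exists a b : R,
  [/\ 0 < a, (b%:E < Rad)%E & forall x, x < a \/ b < x -> u x = 0].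

(** Shown to be the test functions on the interval in [test_function_tf]. *)
Definition tf u : Prop := smooth1 setT u /\ supp u.

(** The integrands on the interval of radii. *)
Definition ccr F : Prop := continuous F /\ supp F.

Lemma open_radii : open (radii Rad).
Proof.
rewrite (_ : radii Rad = [set r | 0 < r] `&` [set r | (r%:E < Rad)%E]).
  apply: openI; first exact: open_gt.
  case: Rad => [r||].
  - rewrite (_ : mkset _ = [set x | x < r]); first exact: open_lt.
    by apply/seteqP; split => x /=; rewrite lte_fin.
  - rewrite (_ : mkset _ = setT); first exact: openT.
    by apply/seteqP; split => x //= _; rewrite ltry.
  - rewrite (_ : mkset _ = set0); first exact: open0.
    by apply/seteqP; split => x //=; rewrite ltNge leNye.
by apply/seteqP; split => x.
Qed.

Lemma radii_gt0 r : radii Rad r -> 0 < r.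
Proof. by case. Qed.

Lemma radii_neq0 r : radii Rad r -> r != 0.
Proof. by move=> /radii_gt0; rewrite lt0r => /andP[]. Qed.

Lemma supp_radii a b r : 0 < a -> (b%:E < Rad)%E -> a <= r <= b -> radii Rad r.
Proof.
move=> a0 bR /andP[ar rb]; split; first exact: lt_le_trans ar.
by apply: le_lt_trans bR; rewrite lee_fin.
Qed.

Lemma supp_common u w : supp u -> supp w -> exists a b : R,
  [/\ 0 < a, (b%:E < Rad)%E, forall x, x < a \/ b < x -> u x = 0 &
      forall x, x < a \/ b < x -> w x = 0].
Proof.
move=> [a [b [a0 bR H]]] [a' [b' [a0' bR' H']]].
exists (Num.min a a'), (Num.max b b'); split.
- by rewrite lt_min a0.
- by rewrite EFin_max gt_max bR.
- by move=> x; rewrite lt_min gt_max => -[/andP[? ?]|/andP[? ?]]; apply: H; [left|right].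
- by move=> x; rewrite lt_min gt_max => -[/andP[? ?]|/andP[? ?]]; apply: H'; [left|right].
Qed.

Lemma supp_le u w : supp u -> (forall x, u x = 0 -> w x = 0) -> supp w.
Proof. by move=> [a [b [a0 bR H]]] uw; exists a, b; split => // x /H /uw. Qed.

Lemma supp_nearr u x : supp u -> ~ radii Rad x -> \forall y \near x, u y = 0.
Proof.
move=> [a [b [a0 bR H]]] xR.
have xab : x < a \/ b < x.
  have [|ax] := ltP x a; first by left.
  right; rewrite ltNge; apply/negP => xb; apply: xR.
  by apply: (supp_radii a0 bR); rewrite ax.
case: xab => h.
  have : \forall y \near x, y < a by exact: lt_nbhsl.
  by apply: filterS => y ya; apply: H; left.
have : \forall y \near x, b < y by exact: lt_nbhsr.
by apply: filterS => y ya; apply: H; right.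
Qed.

Lemma supp_out u x : supp u -> ~ radii Rad x -> u x = 0.
Proof. by move=> su /(supp_nearr su); exact: nbhs_singleton. Qed.

Lemma ccr_cc F : ccr F -> cc F.
Proof.
move=> [cF [a [b [a0 _ H]]]]; split => //; exists `|b| => x bx; apply: H.
have [x0|x0] := leP x 0; first by left; exact: le_lt_trans a0.
by right; move: bx; rewrite [ltRHS]gtr0_norm//; exact: le_lt_trans (ler_norm _).
Qed.

Lemma ccrD F G : ccr F -> ccr G -> ccr (fun x => F x + G x).
Proof.
move=> [cF sF] [cG sG]; split.
  by move=> x; apply: cvgD; [exact: cF|exact: cG].
have [a [b [a0 bR Fab Gab]]] := supp_common sF sG.
by exists a, b; split => // x xab; rewrite Fab ?Gab ?addr0.
Qed.

(** The factor [w] may be singular at the ends of the interval, like the weights and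
    the powers of 1/r, since the product vanishes near them. *)
Lemma ccrM w F : (forall x, radii Rad x -> {for x, continuous w}) -> ccr F ->
  ccr (fun x => w x * F x).
Proof.
move=> cw [cF sF]; split; last by apply: supp_le sF _ => x ->; rewrite mulr0.
move=> x; have [xR|xR] := pselect (radii Rad x).
  by apply: cvgM; [exact: cw|exact: cF].
have : {near x, (cst 0 : R -> R) =1 (fun x => w x * F x)}.
  by have := supp_nearr sF xR; apply: filterS => y /= ->; rewrite mulr0.
move=> E; rewrite /continuous_at -(nbhs_singleton E).
by apply: (cvg_trans (near_eq_cvg E)); exact: cvg_cst.
Qed.

Lemma ccrZ a F : ccr F -> ccr (fun x => a * F x).
Proof. by apply: ccrM => x _; exact: cvg_cst. Qed.

Definition intR F : R := \int[mu]_(r in radii Rad) F r.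

Lemma intR_T F : supp F -> intR F = \int[mu]_r F r.
Proof.
move=> sF; rewrite /intR Rintegral_mkcond; apply: eq_Rintegral => x _.
rewrite /patch; case: ifPn => // /negP xab; rewrite (supp_out sF)// => xR.
by apply: xab; exact/mem_set.
Qed.

Lemma eq_intR F G : (forall r, radii Rad r -> F r = G r) -> intR F = intR G.
Proof. by move=> FG; apply: eq_Rintegral => x /set_mem; exact: FG. Qed.

Lemma ccr_integrable F : ccr F -> mu.-integrable (radii Rad) (EFin \o F).
Proof.
move=> /ccr_cc /cc1_integrable; apply: integrableS => //.
exact: open_measurable open_radii.
Qed.

Lemma measurable_radii : measurable (radii Rad : set (measurableTypeR R)).
Proof. exact: open_measurable open_radii. Qed.

Lemma intRD F G : ccr F -> ccr G -> intR (fun x => F x + G x) = intR F + intR G.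
Proof.
move=> cF cG; rewrite /intR RintegralD//; first exact: measurable_radii.
  exact: ccr_integrable.
exact: ccr_integrable.
Qed.

Lemma intRZ a F : ccr F -> intR (fun x => a * F x) = a * intR F.
Proof.
move=> cF; rewrite /intR RintegralZl//; first exact: measurable_radii.
exact: ccr_integrable.
Qed.

Lemma intR_ge0 F : (forall r, radii Rad r -> 0 <= F r) -> 0 <= intR F.
Proof. by move=> F0; apply: Rintegral_ge0. Qed.

Lemma ccr0 : ccr (fun _ => 0).
Proof.
split; first by move=> x; exact: cvg_cst.
by exists 1, 0; split.
Qed.

Lemma ccr_sum n (F : 'I_n -> R -> R) : (forall i, ccr (F i)) ->
  ccr (fun x => \sum_(i < n) F i x).
Proof.
elim: n F => [|n IH] F cF; first by under eq_fun do rewrite big_ord0; exact: ccr0.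
by under eq_fun do rewrite big_ord_recl; apply: ccrD => //; exact: IH.
Qed.

Lemma intR_sum n (F : 'I_n -> R -> R) : (forall i, ccr (F i)) ->
  intR (fun x => \sum_(i < n) F i x) = \sum_(i < n) intR (F i).
Proof.
elim: n F => [|n IH] F cF.
  under eq_fun do rewrite big_ord0.
  by rewrite big_ord0 intR_T ?Rintegral_cst ?mul0r//; have [] := ccr0.
under eq_fun do rewrite big_ord_recl.
by rewrite intRD ?big_ord_recl ?IH//; exact: ccr_sum.
Qed.

Lemma diffkU k (U W : set R) u : diffk k U u -> diffk k W u -> diffk k (U `|` W) u.
Proof. by move=> hU hW j x jk [Ux|Wx]; [exact: hU|exact: hW]. Qed.

(** The complement of the support and the interval are two open sets that cover
    the line. *)
Lemma diffk_supp k u : diffk k (radii Rad) u -> supp u -> diffk k setT u.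
Proof.
move=> du [a [b [a0 bR H]]].
have oO : open ([set x : R | x < a] `|` [set x | b < x]).
  by apply: openU; [exact: open_lt|exact: open_gt].
have dO : diffk k ([set x : R | x < a] `|` [set x | b < x]) u.
  apply: (@diffk_eq _ k _ (fun _ => 0)) => //; last exact: diffk_cst.
  by move=> x xab; rewrite H.
move=> j x jk _; apply: (diffkU du dO) => //.
have [|ax] := ltP x a; first by right; left.
have [|bx] := ltP b x; first by right; right.
by left; apply: (supp_radii a0 bR); rewrite ax.
Qed.

Lemma tf_intro u : smooth1 (radii Rad) u -> supp u -> tf u.
Proof. by move=> du su; split => // k; exact: diffk_supp. Qed.

Lemma smooth1T U u : smooth1 setT u -> smooth1 U u.
Proof. by move=> h k j x jk _; exact: (h k j x jk Logic.I). Qed.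

Lemma tfD u w : tf u -> tf w -> tf (fun x => u x + w x).
Proof.
move=> [du su] [dw sw]; split.
  by move=> k; apply: (diffkD (@openT R)); [exact: du|exact: dw].
have [a [b [a0 bR Fab Gab]]] := supp_common su sw.
by exists a, b; split => // x xab; rewrite Fab ?Gab ?addr0.
Qed.

Lemma tfM w u : smooth1 (radii Rad) w -> tf u -> tf (fun x => w x * u x).
Proof.
move=> dw [du su]; apply: tf_intro.
  move=> k; apply: (diffkM open_radii); first exact: dw.
  exact: (smooth1T du).
by apply: supp_le su _ => x ->; rewrite mulr0.
Qed.

Lemma tfZ a u : tf u -> tf (fun x => a * u x).
Proof. by apply: tfM => k; exact: diffk_cst. Qed.

Lemma tf0 : tf (fun _ => 0).
Proof. by split; [move=> k; exact: diffk_cst|case: ccr0]. Qed.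

Lemma tf_sum n (F : 'I_n -> R -> R) : (forall i, tf (F i)) ->
  tf (fun x => \sum_(i < n) F i x).
Proof.
elim: n F => [|n IH] F cF; first by under eq_fun do rewrite big_ord0; exact: tf0.
by under eq_fun do rewrite big_ord_recl; apply: tfD => //; exact: IH.
Qed.

Lemma smooth1_derive U u : smooth1 U u -> smooth1 U (derive1 u).
Proof. by move=> du k; have /diffkS[] := du k.+1. Qed.

Lemma smooth1_derivable U u x : smooth1 U u -> U x -> derivable u x 1.
Proof. by move=> du; exact: (diffk_derivable (du 0%N)). Qed.

Lemma smooth1_continuous U u x : smooth1 U u -> U x -> {for x, continuous u}.
Proof.
move=> du Ux; apply: differentiable_continuous; apply/derivable1_diffP.
exact: smooth1_derivable Ux.
Qed.

Lemma tf_derive u : tf u -> tf (derive1 u).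
Proof.
move=> [du su]; split; first exact: smooth1_derive.
move: su => [a [b [a0 bR H]]]; exists a, b; split => // x xab.
rewrite derive1E; apply: (proj1 (derive_near0 _ _)).
case: xab => h.
  have : \forall y \near x, y < a by exact: lt_nbhsl.
  by apply: filterS => y ya; apply: H; left.
have : \forall y \near x, b < y by exact: lt_nbhsr.
by apply: filterS => y ya; apply: H; right.
Qed.

Lemma tf_derivable u (x : R) : tf u -> derivable u x 1.
Proof. by move=> [du _]; exact: smooth1_derivable du _. Qed.

Lemma tf_ccr u : tf u -> ccr u.
Proof. by move=> [du su]; split => // x; exact: smooth1_continuous du _. Qed.

Lemma tf_is_derive u (x : R) : tf u -> is_derive x 1 u (derive1 u x).
Proof. by move=> tu; rewrite derive1E; apply: derivableP; exact: tf_derivable. Qed.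

Lemma smooth1_is_derive U u (x : R) : smooth1 U u -> U x -> is_derive x 1 u (derive1 u x).
Proof. by move=> tu Ux; rewrite derive1E; apply: derivableP; exact: smooth1_derivable Ux. Qed.

Lemma intR_derive u : tf u -> intR (derive1 u) = 0.
Proof.
move=> tu; have [cu' su'] := tf_ccr (tf_derive tu).
rewrite intR_T//; apply: Rintegral_derive_cc => [|x|].
- exact: ccr_cc (tf_ccr tu).
- exact: tf_derivable.
- exact: cu'.
Qed.

Lemma smooth1_inv : smooth1 (radii Rad) (fun x => x^-1).
Proof. by move=> k j x jk /radii_neq0 x0; exact: diffk_inv. Qed.

Lemma smooth1M U u w : open U -> smooth1 U u -> smooth1 U w ->
  smooth1 U (fun x => u x * w x).
Proof. by move=> oU du dw k; exact: diffkM. Qed.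

Lemma smooth1X U u n : open U -> smooth1 U u -> smooth1 U (fun x => u x ^+ n).
Proof.
move=> oU du; elim: n => [|n IH].
  by under eq_fun do rewrite expr0; move=> k; exact: diffk_cst.
by under eq_fun do rewrite exprS; exact: smooth1M.
Qed.

Lemma smooth_on_smooth1 (U : set R) u : smooth_on U u -> smooth1 U u.
Proof.
move=> du k j x _ Ux; apply/derivable1_diffP.
have -> : derive1n j u = iter_derive (nseq j (1 : R)) u.
  elim: j => [|j IH]; first by rewrite derive1n0.
  by rewrite derive1nS IH /=; apply/funext => y; rewrite derive1E.
exact: du.
Qed.

Lemma smooth1_smooth_on u : smooth1 setT u -> smooth_on setT u.
Proof.
move=> du s x _.
have dd n y : differentiable (derive1n n u) y.
  by apply/derivable1_diffP; exact: (du n n).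
have [c ->] : exists c : R, iter_derive s u = fun x => c * derive1n (size s) u x.
  elim: s => [|v s [c IH]] /=.
    by exists 1; apply/funext => y; rewrite mul1r.
  exists (c * v); rewrite IH; apply/funext => y.
  rewrite deriveE; last by apply: differentiableZ.
  rewrite -[v in LHS]mulr1 -[v * 1]/(v *: (1 : R)) linearZ/=.
  rewrite -deriveE; last by apply: differentiableZ.
  rewrite deriveZ; last exact: diff_derivable.
  by rewrite -derive1E /GRing.scale/=; ring.
exact: differentiableZ.
Qed.

(** A compact subset of the interval has a least and a greatest element, which are
    the bounds in [supp]. *)
Lemma test_function_tf u : test_function (radii Rad) u <-> tf u.
Proof.
split=> [[su cu suppu]|[du [a [b [a0 bR H]]]]].
  split; first exact: smooth_on_smooth1.
  set K := closure _ in cu suppu.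
  have [K0|/set0P K0] := eqVneq K set0.
    exists 1, 0; split => // x _; apply/eqP/negPn/negP => ux.
    have : K x by exact: subset_closure.
    by rewrite K0.
  have cid : {within K, continuous (@idfun R)}.
    by apply: continuous_subspaceT => x; exact: cvg_id.
  have [b /set_mem Kb hb] := compact_EVT_max K0 cu cid.
  have [a /set_mem Ka ha] := compact_EVT_min K0 cu cid.
  exists a, b; split; first by have [] := suppu _ Ka.
    by have [] := suppu _ Kb.
  move=> x xab; apply/eqP/negPn/negP => ux.
  have /mem_set Kx : K x by exact: subset_closure.
  have := hb _ Kx; have := ha _ Kx; rewrite /= => h1 h2.
  by case: xab; rewrite ltNge ?h1 ?h2.
have sub : closure [set x | u x != 0] `<=` `[a, b]%classic.
  have cl : closed `[a, b]%classic by exact: itv_closed.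
  rewrite [X in _ `<=` X](proj1 (closure_id _) cl).
  apply: closureS => x /= ux; rewrite in_itv/=; apply/andP; split.
    by rewrite leNgt; apply/negP => xa; move/eqP: ux; apply; apply: H; left.
  by rewrite leNgt; apply/negP => xa; move/eqP: ux; apply; apply: H; right.
split.
- exact: smooth1_smooth_on.
- apply: (subclosed_compact _ (@segment_compact _ a b)) => //; exact: closed_closure.
- by move=> x /sub /=; rewrite in_itv/=; exact: supp_radii.
Qed.

End radial_test_functions.

(** * Derivatives at a point *)

Section derive_pointwise.
Context {R : realType}.
Implicit Types (f g : R -> R) (r : R).

Lemma is_derive_mul f g r df dg : is_derive r 1 f df -> is_derive r 1 g dg ->
  is_derive r 1 (fun x => f x * g x) (df * g r + f r * dg).
Proof.
by move=> hf hg; apply: (is_derive_eq (is_deriveM hf hg)); rewrite /GRing.scale/=; ring.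
Qed.

Lemma is_derive_add f g r df dg : is_derive r 1 f df -> is_derive r 1 g dg ->
  is_derive r 1 (fun x => f x + g x) (df + dg).
Proof. by move=> hf hg; exact: (is_deriveD hf hg). Qed.

Lemma is_derive_scale a f r df : is_derive r 1 f df ->
  is_derive r 1 (fun x => a * f x) (a * df).
Proof. by move=> hf; exact: (is_deriveZ a hf). Qed.

Lemma is_derive_derive1 f r df : is_derive r 1 f df -> derive1 f r = df.
Proof. by move=> [_ <-]; rewrite derive1E. Qed.

Lemma derive_invX n (r : R) : r != 0 ->
  is_derive r 1 (fun x => x^-1 ^+ n) (- n%:R * r^-1 ^+ n.+1).
Proof.
move=> r0.
have h1 : is_derive r 1 (fun y : R => y^-1) (- r ^- 2).
  apply: DeriveDef; first by apply: (@derivableV _ _ id) => //; exact: derivable_id.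
  by rewrite (@deriveV _ _ id)// derive_id /GRing.scale/= mulr1.
have D := is_deriveX n h1; rewrite exprfctE in D.
apply: (is_derive_eq D); rewrite /GRing.scale/= -exprVn.
by case: n {D} => [|n] /=; rewrite ?exprS; ring.
Qed.

Lemma is_derive_X n r : r != 0 ->
  is_derive r 1 (fun x => x ^+ n) (n%:R * (r^-1 * r ^+ n)).
Proof.
move=> r0; have := is_deriveX n (is_derive_id r 1).
rewrite exprfctE /GRing.scale/= mulr1 => D; apply: (is_derive_eq D).
by case: n {D} => [|n] /=; [rewrite !mul0r|rewrite exprS mulKf].
Qed.

Lemma is_derive_V r : r != 0 -> is_derive r 1 (fun x => x^-1) (- r^-1 ^+ 2).
Proof. by move=> r0; have := derive_invX 1 r0; under eq_fun do rewrite expr1; rewrite mulN1r. Qed.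

Lemma is_derive_bigsum n (F : 'I_n -> R -> R) r (dF : 'I_n -> R) :
  (forall i, is_derive r 1 (F i) (dF i)) ->
  is_derive r 1 (fun x => \sum_(i < n) F i x) (\sum_(i < n) dF i).
Proof.
move=> hF; have := is_derive_sum hF.
by rewrite (_ : \sum_(i < n) F i = fun x => \sum_(i < n) F i x)//; apply/funext => x; rewrite fct_sumE.
Qed.

End derive_pointwise.

Lemma differentiable_near_eq (R : numFieldType) (V W : normedModType R) (f g : V -> W) x :
  (\forall y \near x, f y = g y) -> differentiable f x -> differentiable g x.
Proof.
move=> fg df.
have fgx : f x = g x by exact: nbhs_singleton fg.
have cd : continuous ('d f x) by exact: diff_continuous.
have E : g \o shift x = cst (g x) + 'd f x +o_ (0 : V) id.
  apply/eqaddoP => e e0.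
  rewrite -fgx.
  have : f \o shift x = cst (f x) + 'd f x +o_ (0 : V) id by exact: (proj2 ((diff_locallyP x f).1 df)).
  move=> /eqaddoP/(_ e e0).
  have : \forall h \near (0 : V), f (h + x) = g (h + x) by move: fg; rewrite (near_shift 0) /=; apply: filterS => h; rewrite subr0.
  by apply: filterS2 => h; rewrite !fctE /= => ->.
have dg := diff_unique cd E.
by apply/diff_locallyP; rewrite dg.
Qed.

(** * Homogeneous polynomials and radial functions *)

Section radial.
Context {R : realType} {N : nat}.
Implicit Types (x : 'rV[R]_N) (Y Z : 'rV[R]_N -> R).

Lemma enorm_ge0 x : 0 <= enorm x.
Proof. exact: sqrtr_ge0. Qed.

Lemma sum_sqr_ge0 x : 0 <= \sum_(i < N) x ord0 i ^+ 2.
Proof. by apply: sumr_ge0 => i _; exact: sqr_ge0. Qed.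

Lemma enorm_sqr x : enorm x ^+ 2 = \sum_(i < N) x ord0 i ^+ 2.
Proof. by rewrite /enorm sqr_sqrtr// sum_sqr_ge0. Qed.

Lemma enorm_eq0 x : (enorm x == 0) = (x == 0).
Proof.
apply/eqP/eqP => [x0|->]; last by rewrite /enorm big1 ?sqrtr0// => i _; rewrite mxE expr0n.
have := enorm_sqr x; rewrite x0 expr0n => /esym/eqP.
rewrite psumr_eq0; last by move=> i _; exact: sqr_ge0.
move=> /allP H; apply/rowP => i; rewrite mxE; apply/eqP.
by have := H i (mem_index_enum _); rewrite sqrf_eq0.
Qed.

Lemma norm_le_enorm x : `|x| <= enorm x.
Proof.
rewrite {1}/Num.Def.normr/= mx_normrE; apply/bigmax_leP; split => /=; first exact: enorm_ge0.
move=> -[i j] _ /=; rewrite (ord1 i) -sqrtr_sqr /enorm ler_wsqrtr//.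
by rewrite (bigD1 j)//= lerDl sumr_ge0// => k _; exact: sqr_ge0.
Qed.

Lemma chain_derive (V : normedModType R) (f : R -> R) (g : V -> R) (x v : V) :
  differentiable g x -> derivable f (g x) 1 ->
  differentiable (fun y => f (g y)) x /\
  'D_v (fun y => f (g y)) x = derive1 f (g x) * 'D_v g x.
Proof.
move=> dg /derivable1_diffP df.
have dc : differentiable (fun y => f (g y)) x by exact: differentiable_comp.
split => //; rewrite !deriveE// (diff_comp dg df)/=.
by rewrite derive1E' // -[in LHS](mulr1 ('d g x v)) -[X in 'd f _ X]/(('d g x v) *: (1 : R)) linearZ/= /GRing.scale/= mulrC.
Qed.

Lemma derive_coord (x : 'rV[R]_N) i j :
  'D_(delta_mx 0 i) (fun y : 'rV[R]_N => y ord0 j) x = (i == j)%:R /\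
  differentiable (fun y : 'rV[R]_N => y ord0 j) x.
Proof.
have D : differentiable (fun y : 'rV[R]_N => y ord0 j) x by exact: differentiable_coord.
split => //; apply/cvg_lim => //.
have -> : (fun h : R => h^-1 *: (((fun y : 'rV[R]_N => y ord0 j) \o shift x) (h *: delta_mx 0 i) - x ord0 j))
  = (fun h : R => h^-1 * (h * (i == j)%:R)).
  by apply/funext => h; rewrite /= line_coord addrK eq_sym.
apply: (@cvg_near_cst _ _ _ _ _); near=> h.
by rewrite mulrA mulVf ?mul1r//; near: h; exact: nbhs_dnbhs_neq.
Unshelve. all: by end_near. Qed.

Lemma derive_coordM i j Y x : differentiable Y x ->
  'd_i (fun y : 'rV[R]_N => y ord0 j * Y y) x = (i == j)%:R * Y x + x ord0 j * 'd_i Y x.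
Proof.
move=> dY; have [E D] := derive_coord x i j.
rewrite (@deriveM _ _ (fun y : 'rV[R]_N => y ord0 j) Y); [|exact: diff_derivable..].
by rewrite E /GRing.scale/= addrC [X in X + _ = _]mulrC.
Qed.

Lemma derive_bigsum n (F : 'I_n -> 'rV[R]_N -> R) x v :
  (forall j, differentiable (F j) x) ->
  differentiable (fun y => \sum_(j < n) F j y) x /\
  'D_v (fun y => \sum_(j < n) F j y) x = \sum_(j < n) 'D_v (F j) x.
Proof.
move=> dF; have -> : (fun y => \sum_(j < n) F j y) = \sum_(j < n) F j.
  by apply/funext => y; rewrite fct_sumE.
split; first exact: differentiable_sum.
by rewrite derive_sum// => j; exact: diff_derivable.
Qed.

Lemma derive_sqr_enorm x i :
  differentiable (fun y : 'rV[R]_N => \sum_(j < N) y ord0 j ^+ 2) x /\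
  'd_i (fun y : 'rV[R]_N => \sum_(j < N) y ord0 j ^+ 2) x = 2 * x ord0 i.
Proof.
have dj j : differentiable (fun y : 'rV[R]_N => y ord0 j ^+ 2) x.
  under eq_fun do rewrite expr2.
  by apply: differentiableM; exact: differentiable_coord.
have [D ->] := derive_bigsum (delta_mx 0 i) dj; split => //.
have E j : 'd_i (fun y : 'rV[R]_N => y ord0 j ^+ 2) x = 2 * (i == j)%:R * x ord0 j.
  under eq_fun do rewrite expr2.
  rewrite derive_coordM; last exact: differentiable_coord.
  by have [-> _] := derive_coord x i j; ring.
rewrite (bigD1 i)//= big1 ?addr0 => [|j ji]; first by rewrite E eqxx mulr1.
by rewrite E eq_sym (negbTE ji) mulr0 mul0r.
Qed.

(** The norm is the square root of a polynomial which is positive away from 0. *)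
Lemma enorm_derive x i : x != 0 ->
  differentiable (@enorm R N) x /\ 'd_i (@enorm R N) x = (enorm x)^-1 * x ord0 i.
Proof.
move=> x0.
pose S := fun y : 'rV[R]_N => \sum_(j < N) y ord0 j ^+ 2.
have S0 : 0 < S x by rewrite -[S x]enorm_sqr exprn_gt0// lt_neqAle eq_sym enorm_eq0 x0 enorm_ge0.
have [dS dS'] := derive_sqr_enorm x i.
have h := is_derive1_sqrt S0.
have [h1 h2] := @chain_derive _ Num.sqrt S x (delta_mx 0 i) dS ltac:(by case: h).
split => //; rewrite [LHS]h2 dS' derive1E; have [_ ->] := h.
by rewrite -[Num.sqrt (S x)]/(enorm x) invfM; field; rewrite enorm_eq0 x0.
Qed.

Lemma continuous_enorm : continuous (@enorm R N).
Proof.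
move=> x; apply: (@continuous_comp _ _ _ (fun y : 'rV[R]_N => \sum_(j < N) y ord0 j ^+ 2) Num.sqrt).
  apply: differentiable_continuous.
  by apply: (proj1 (derive_bigsum 0 _)) => j; under eq_fun do rewrite expr2;
     apply: differentiableM; exact: differentiable_coord.
exact: sqrt_continuous.
Qed.

(** The products of the separation of variables; the densities that they give rise to are
    sums of such products again. *)
Definition rad (g : R -> R) Y x : R := g (enorm x) * Y x.

(** Homogeneous polynomial functions, presented so that their properties are proved by
    induction on the construction.  The null function has every degree. *)
Inductive hpoly : nat -> ('rV[R]_N -> R) -> Prop :=
| hpolyC c : hpoly 0 (fun _ => c)
| hpolyX d i Y : hpoly d Y -> hpoly d.+1 (fun x => x ord0 i * Y x)
| hpoly0 d : hpoly d (fun _ => 0)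
| hpolyD d Y Z : hpoly d Y -> hpoly d Z -> hpoly d (fun x => Y x + Z x).

Lemma hpoly_diff d Y x : hpoly d Y -> differentiable Y x.
Proof.
elim=> [c|{}d i {}Y _ IH|{}d|{}d {}Y Z _ IHY _ IHZ].
- exact: differentiable_cst.
- by apply: differentiableM => //; exact: differentiable_coord.
- exact: differentiable_cst.
- exact: differentiableD.
Qed.

Lemma hpoly_continuous d Y : hpoly d Y -> continuous Y.
Proof. by move=> hY x; apply: differentiable_continuous; exact: hpoly_diff hY. Qed.

Lemma hpolyZ d a Y : hpoly d Y -> hpoly d (fun x => a * Y x).
Proof.
elim=> [c|{}d i {}Y _ IH|{}d|{}d {}Y Z _ IHY _ IHZ].
- exact: hpolyC.
- by under eq_fun do rewrite mulrCA; exact: hpolyX.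
- by under eq_fun do rewrite mulr0; exact: hpoly0.
- by under eq_fun do rewrite mulrDr; exact: hpolyD.
Qed.

Lemma hpolyM d e Y Z : hpoly d Y -> hpoly e Z -> hpoly (d + e) (fun x => Y x * Z x).
Proof.
move=> hY hZ; elim: hY => [c|{}d i {}Y _ IH|{}d|{}d {}Y Y' _ IHY _ IHZ].
- exact: hpolyZ.
- by under eq_fun do rewrite -mulrA; rewrite addSn; exact: hpolyX.
- by under eq_fun do rewrite mul0r; exact: hpoly0.
- by under eq_fun do rewrite mulrDl; exact: hpolyD.
Qed.

Lemma hpoly_sum d n (Y : 'I_n -> 'rV[R]_N -> R) : (forall i, hpoly d (Y i)) ->
  hpoly d (fun x => \sum_(i < n) Y i x).
Proof.
elim: n Y => [|n IH] Y hY; first by under eq_fun do rewrite big_ord0; exact: hpoly0.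
by under eq_fun do rewrite big_ord_recl; apply: hpolyD => //; exact: IH.
Qed.

Lemma hpoly_coord i : hpoly 1 (fun x => x ord0 i).
Proof. by have := hpolyX i (hpolyC 1); under eq_fun do rewrite mulr1. Qed.

Lemma hpoly_derive d Y i : hpoly d Y ->
  hpoly d.-1 ('d_i Y) /\ (d = 0%N -> forall x, 'd_i Y x = 0).
Proof.
elim=> [c|{}d j {}Y hY [IH1 IH2]|{}d|{}d {}Y Z hY [IHY IHY0] hZ [IHZ IHZ0]].
- split; last by move=> _ x; rewrite derive_cst.
  rewrite (_ : 'd_i _ = fun _ => 0); first exact: hpoly0.
  by apply/funext => x; rewrite derive_cst.
- split => //=.
  rewrite (_ : 'd_i _ = fun x => (i == j)%:R * Y x + x ord0 j * 'd_i Y x).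
    apply: hpolyD; first exact: hpolyZ.
    case: d hY IH1 IH2 => [|d] hY IH1 IH2; last exact: hpolyX.
    by under eq_fun do rewrite (IH2 erefl) mulr0; exact: hpoly0.
  by apply/funext => x; rewrite derive_coordM//; exact: hpoly_diff hY.
- split; last by move=> _ x; rewrite derive_cst.
  rewrite (_ : 'd_i _ = fun _ => 0); first exact: hpoly0.
  by apply/funext => x; rewrite derive_cst.
have E : 'd_i (fun x => Y x + Z x) = fun x => 'd_i Y x + 'd_i Z x.
  apply/funext => x; rewrite deriveD//; apply: diff_derivable; first exact: hpoly_diff hY.
  exact: hpoly_diff hZ.
split; first by rewrite E; exact: hpolyD.
by move=> d0 x; rewrite [LHS](congr1 (@^~ x) E) IHY0 ?IHZ0 ?addr0.
Qed.

Lemma hpoly_euler d Y x : hpoly d Y -> \sum_(i < N) x ord0 i * 'd_i Y x = d%:R * Y x.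
Proof.
elim=> [c|{}d j {}Y hY IH|{}d|{}d {}Y Z hY IHY hZ IHZ].
- by rewrite big1 ?mul0r// => i _; rewrite derive_cst mulr0.
- have dY := hpoly_diff x hY.
  under eq_bigr do rewrite derive_coordM// mulrDr mulrCA [X in _ + X]mulrCA.
  rewrite big_split/= -mulr_sumr IH (bigD1 j)//= eqxx big1 ?addr0 => [|i ij].
    by rewrite -natr1 (_ : true%:R = 1 :> R)//; ring.
  by rewrite (negbTE ij) mul0r.
- by rewrite big1 ?mulr0// => i _; rewrite derive_cst mulr0.
have dY := hpoly_diff x hY; have dZ := hpoly_diff x hZ.
rewrite mulrDr -IHY -IHZ -big_split/=; apply: eq_bigr => i _.
by rewrite deriveD ?mulrDr//; exact: diff_derivable.
Qed.

Lemma hpoly_opp d Y x : hpoly d Y -> Y (- x) = (-1) ^+ d * Y x.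
Proof.
elim=> [c|{}d j {}Y hY IH|{}d|{}d {}Y Z hY IHY hZ IHZ].
- by rewrite expr0 mul1r.
- by rewrite IH mxE exprS; ring.
- by rewrite mulr0.
- by rewrite IHY IHZ mulrDr.
Qed.

Lemma derive_hpolyM d e Y Z i x : hpoly d Y -> hpoly e Z ->
  'd_i (fun y => Y y * Z y) x = 'd_i Y x * Z x + Y x * 'd_i Z x.
Proof.
move=> hY hZ.
have := @deriveM _ _ Y Z x (delta_mx 0 i) (diff_derivable (hpoly_diff x hY))
  (diff_derivable (hpoly_diff x hZ)).
rewrite -[Y * Z]/(fun y => Y y * Z y) => ->.
by rewrite /GRing.scale/= addrC mulrC.
Qed.

End radial.

Section radial_calculus.
Context {R : realType} {N : nat}.
Variable Rad : \bar R.
Hypothesis Rad_gt0 : (0 < Rad)%E.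
Implicit Types (x : 'rV[R]_N) (Y Z : 'rV[R]_N -> R) (g F : R -> R).

(** The regularity of a primitive of a continuous profile, which is what the proof of the
    polar formula differentiates. *)
Definition c1r g := [/\ forall x : R, derivable g x 1, ccr Rad g & ccr Rad (derive1 g)].

Lemma tf_c1r g : tf Rad g -> c1r g.
Proof.
move=> tg; split; first by move=> x; exact: tf_derivable tg.
  exact: tf_ccr.
exact: tf_ccr (tf_derive tg).
Qed.

(** The factor in grad g(|x|) = (g'(r)/r) x. *)
Definition over_r g (r : R) : R := r^-1 * derive1 g r.

Lemma ccr_over_r g : c1r g -> ccr Rad (over_r g).
Proof.
move=> [_ _ cg']; apply: ccrM => // x Rx.
exact: (smooth1_continuous (@smooth1_inv R Rad) Rx).
Qed.

Lemma tf_over_r g : tf Rad g -> tf Rad (over_r g).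
Proof. by move=> tg; apply: tfM; [exact: smooth1_inv|exact: tf_derive]. Qed.

Lemma cc_rad F Y : ccr Rad F -> continuous Y -> cc (rad F Y).
Proof.
move=> cF; apply: ccMr.
apply: (cc_comp _ _ (ccr_cc cF)); first exact: continuous_enorm.
move=> M; exists M => x xM; rewrite ger0_norm ?enorm_ge0//.
exact: lt_le_trans xM (norm_le_enorm x).
Qed.

Lemma near_rad0 g x : ccr Rad g -> x = 0 -> \forall y \near x, g (enorm y) = 0.
Proof.
move=> [_ [a [b [a0 _ H]]]] ->.
have : \forall y \near (0 : 'rV[R]_N), enorm y < a.
  apply: (cvgr_lt (enorm (0 : 'rV[R]_N)) (@continuous_enorm R N 0)).
  by rewrite (eqP (_ : enorm 0 == 0)) ?enorm_eq0.
by apply: filterS => y ya; apply: H; left.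
Qed.

(** Near the origin the radial factor vanishes; elsewhere this is the chain rule. *)
Lemma rad_derive g Y i x : c1r g -> differentiable Y x ->
  differentiable (rad g Y) x /\
  'd_i (rad g Y) x = rad (over_r g) (fun x => x ord0 i * Y x) x + rad g ('d_i Y) x.
Proof.
move=> cg dY; have [dg ccg _] := cg.
have [dE E] : differentiable (fun y => g (enorm y)) x /\
    'd_i (fun y => g (enorm y)) x = over_r g (enorm x) * x ord0 i.
  have [x0|x0] := eqVneq x 0.
    have H := near_rad0 ccg x0.
    have H' : \forall y \near x, (cst 0 : 'rV[R]_N -> R) y = g (enorm y).
      by apply: filterS H => y ->.
    split; last first.
      have [-> _] := @derive_near0 _ _ (fun y => g (enorm y)) x (delta_mx 0 i) H.
      by rewrite x0 mxE mulr0.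
    by apply: (differentiable_near_eq H'); exact: differentiable_cst.
  have [de E] := enorm_derive i x0.
  have [h1 h2] := @chain_derive _ _ g (@enorm R N) x (delta_mx 0 i) de (dg _).
  by split => //; rewrite h2 E /over_r; ring.
split; first exact: differentiableM.
rewrite (@deriveM _ _ (fun y => g (enorm y)) Y); [|exact: diff_derivable..].
by rewrite E /rad /GRing.scale/= addrC; congr (_ + _); ring.
Qed.

End radial_calculus.

(** * Integration of radial functions times homogeneous polynomials *)

Section polar.
Context {R : realType}.
Notation mu := (@lebesgue_measure R).
Variables (N : nat) (Rad : \bar R).
Hypothesis Rad_gt0 : (0 < Rad)%E.
Implicit Types (P Y Z H : 'rV[R]_N -> R) (g F phi rho : R -> R).

Lemma radDl F G Y : rad (fun r => F r + G r) Y = (fun x => rad F Y x + rad G Y x).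
Proof. by apply/funext => x; rewrite /rad mulrDl. Qed.

Lemma radZl a F Y : rad (fun r => a * F r) Y = (fun x => a * rad F Y x).
Proof. by apply/funext => x; rewrite /rad mulrA. Qed.

Lemma radDr F Y Z : rad F (fun x => Y x + Z x) = (fun x => rad F Y x + rad F Z x).
Proof. by apply/funext => x; rewrite /rad mulrDr. Qed.

Lemma radZr a F Y : rad F (fun x => a * Y x) = (fun x => a * rad F Y x).
Proof. by apply/funext => x; rewrite /rad mulrCA. Qed.

Lemma rad_sumr n F (Y : 'I_n -> 'rV[R]_N -> R) :
  rad F (fun x => \sum_(i < n) Y i x) = (fun x => \sum_(i < n) rad F (Y i) x).
Proof. by apply/funext => x; rewrite /rad mulr_sumr. Qed.

(** The integral of the partial derivative of F(|x|) P vanishes. *)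
Lemma intV_rad_derive F d P i : c1r Rad F -> hpoly d P ->
  intV (rad (over_r F) (fun x => x ord0 i * P x)) = - intV (rad F ('d_i P)).
Proof.
move=> cF hP; have cF' := ccr_over_r cF.
have ccF : ccr Rad F by case: cF.
have cP : cc (rad F P) by exact: (cc_rad ccF (hpoly_continuous hP)).
have E : 'd_i (rad F P) = fun x => rad (over_r F) (fun x => x ord0 i * P x) x + rad F ('d_i P) x.
  by apply/funext => x; have [_ ->] := rad_derive i cF (hpoly_diff x hP).
have c1 : cc (rad (over_r F) (fun x => x ord0 i * P x)).
  by exact: (cc_rad cF' (hpoly_continuous (hpolyX i hP))).
have c2 : cc (rad F ('d_i P)).
  by exact: (cc_rad ccF (hpoly_continuous (proj1 (hpoly_derive i hP)))).
have : intV ('d_i (rad F P)) = 0.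
  apply: intV_derive => //; last by rewrite E; have [] := ccD c1 c2.
  by move=> x; apply: diff_derivable; have [] := rad_derive i cF (hpoly_diff x hP).
by rewrite E intVD// => /eqP; rewrite addr_eq0 => /eqP.
Qed.

(** The integral of div(x F(|x|) H) vanishes; Euler's identity gives the terms in
    which H is differentiated. *)
Lemma intV_rad_euler F d H : c1r Rad F -> hpoly d H ->
  intV (rad (fun r => r * derive1 F r) H) = - (N + d)%:R * intV (rad F H).
Proof.
move=> cF hH; have cF' := ccr_over_r cF.
have ccF : ccr Rad F by case: cF.
have cH : cc (rad F H) by exact: (cc_rad ccF (hpoly_continuous hH)).
have -> : rad (fun r => r * derive1 F r) H =
    rad (over_r F) (fun x => \sum_(i < N) x ord0 i * (x ord0 i * H x)).
  apply/funext => x; rewrite /rad.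
  under eq_bigr do rewrite mulrA -expr2.
  rewrite -mulr_suml -enorm_sqr /over_r mulrA; congr (_ * _).
  have [->|r0] := eqVneq (enorm x) 0; first by rewrite invr0 !mul0r.
  by field.
rewrite rad_sumr intV_sum; last first.
  by move=> i; exact: (cc_rad cF' (hpoly_continuous (hpolyX i (hpolyX i hH)))).
under eq_bigr => i _ do rewrite (intV_rad_derive i cF (hpolyX i hH)).
rewrite sumrN -intV_sum; last first.
  by move=> i; exact: (cc_rad ccF (hpoly_continuous (proj1 (hpoly_derive i (hpolyX i hH))))).
rewrite -rad_sumr mulNr; congr (- _).
rewrite -intVZ// -radZr; congr intV; apply/funext => x; rewrite /rad; congr (_ * _).
under eq_bigr do rewrite (derive_coordM _ _ (hpoly_diff x hH)) eqxx mul1r.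
by rewrite big_split/= (hpoly_euler x hH) sumr_const card_ord natrD mulrDl (mulr_natl (H x) N).
Qed.

(** The primitive that vanishes to the left of the support also vanishes to the
    right of it, because the total integral is 0. *)
Lemma primitive_ccr phi : ccr Rad phi -> intR Rad phi = 0 ->
  exists2 G, c1r Rad G & derive1 G = phi.
Proof.
move=> cphi phi0; pose G (x : R) : R := \int[mu]_(t in `]-oo, x]) phi t.
have [dG G'] : (forall x : R, derivable G x 1) /\ (forall x, derive1 G x = phi x).
  exact: (Rintegral_primitive (ccr_cc cphi)).
have GE : derive1 G = phi by apply/funext.
exists G; last exact: GE.
split; [exact: dG| |by rewrite GE].
split; first exact: derivable1_continuous.
have [cf [a [b [a0 bR H]]]] := cphi.
exists a, b; split => // x xab; rewrite /G; case: xab => h.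
  rewrite (@eq_Rintegral _ _ _ mu _ (cst 0)); first by rewrite Rintegral_cst//= mul0r.
  move=> y /set_mem /=; rewrite in_itv/= => yx.
  by apply: H; left; exact: le_lt_trans h.
rewrite -phi0 intR_T//; last by case: cphi.
rewrite Rintegral_mkcond; apply: eq_Rintegral => y _.
rewrite /patch; case: ifPn => // /negP yx; rewrite H//; right.
rewrite (lt_trans h)// ltNge; apply/negP => yx'; apply: yx; apply/mem_set.
by rewrite /= in_itv.
Qed.

Lemma smooth1_invX n : smooth1 (radii Rad) (fun r : R => r^-1 ^+ n).
Proof. by apply: smooth1X; [exact: open_radii|exact: smooth1_inv]. Qed.

Lemma ccr_invX n phi : ccr Rad phi -> ccr Rad (fun r => r^-1 ^+ n * phi r).
Proof.
move=> cphi; apply: ccrM => // x Rx.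
exact: (smooth1_continuous (@smooth1_invX n) Rx).
Qed.

Lemma ccr_X n phi : ccr Rad phi -> ccr Rad (fun r => r ^+ n * phi r).
Proof.
move=> cphi; apply: ccrM => // x Rx.
exact: exprn_continuous.
Qed.

(** If G is a primitive of phi and F = r^-(N+d) G, then
    (N+d) F + r F' = r^-(N+d-1) phi, and the integral of the left-hand side against
    H vanishes by [intV_rad_euler]. *)
Lemma intV_rad_zero_mean d H phi : (0 < N)%N -> hpoly d H -> ccr Rad phi ->
  intR Rad phi = 0 ->
  intV (rad (fun r => r^-1 ^+ (N + d).-1 * phi r) H) = 0.
Proof.
move=> N0 hH cphi phi0.
have [G [dG cG _] G'] := primitive_ccr cphi phi0.
have Nd : (N + d).-1.+1 = (N + d)%N by rewrite prednK// addn_gt0 N0.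
set p := (N + d).-1 in Nd *.
pose F r := r^-1 ^+ p.+1 * G r.
have FE (r : R) : r != 0 -> is_derive r 1 F (r^-1 ^+ p.+1 * phi r + - p.+1%:R * (r^-1 ^+ p.+2 * G r)).
  move=> r0; have h2 : is_derive r 1 G (phi r) by apply: DeriveDef; rewrite // -derive1E G'.
  by apply: is_derive_eq (is_derive_mul (derive_invX p.+1 r0) h2) _; ring.
(* F is only known to be differentiable where r <> 0, and vanishes near 0. *)
have sF : supp Rad F by case: cG => _; move/supp_le; apply => x; rewrite /F => ->; rewrite mulr0.
have dF (x : R) : derivable F x 1.
  have : diffk 0 setT F.
    by apply: (diffk_supp _ sF); apply/diffk0 => y /radii_neq0 /FE [].
  by move=> /diffk0; apply.
have FE' : derive1 F = fun r => r^-1 ^+ p.+1 * phi r + - p.+1%:R * (r^-1 ^+ p.+2 * G r).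
  apply/funext => r; rewrite derive1E; have [Rr|Rr] := pselect (radii Rad r).
    by have [_ ->] := FE r (radii_neq0 Rr).
  have [-> _] := derive_near0 (1 : R) (supp_nearr sF Rr).
  by rewrite (supp_out (proj2 cphi) Rr) (supp_out (proj2 cG) Rr) !mulr0 addr0.
have cF : c1r Rad F.
  split; [exact: dF|by split; [exact: derivable1_continuous|exact: sF]|].
  by rewrite FE'; apply: ccrD; [exact: ccr_invX|apply: ccrZ; exact: ccr_invX].
have := intV_rad_euler cF hH.
have c3 : ccr Rad (fun r => r^-1 ^+ p * phi r) by exact: ccr_invX.
have ccF : ccr Rad F by case: cF.
have -> : (fun r => r * derive1 F r) = fun r => r^-1 ^+ p * phi r + (- p.+1%:R) * F r.
  apply/funext => r; rewrite FE' /F; have [->|r0] := eqVneq r 0.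
    have R0 : ~ radii Rad (0 : R) by move=> /radii_gt0; rewrite ltxx.
    by rewrite (supp_out (proj2 cphi) R0) (supp_out (proj2 cG) R0) !mulr0 addr0 mul0r.
  by rewrite !exprS; field.
rewrite radDl intVD; last first.
  - by exact: (cc_rad (ccrZ _ ccF) (hpoly_continuous hH)).
  - by exact: (cc_rad c3 (hpoly_continuous hH)).
rewrite radZl intVZ; last by exact: (cc_rad ccF (hpoly_continuous hH)).
rewrite -Nd => /eqP; rewrite -subr_eq0 addrK => /eqP.
exact.
Qed.

(** The mean of [H] over the unit sphere up to a positive factor that depends only on
    the dimension.  The profile [rho] of integral 1 replaces the restriction to the
    sphere, and the power of r cancels the homogeneity of [H] and of the volume. *)
Definition sphere_mean rho d H : R :=
  intV (rad (fun r => r^-1 ^+ (N + d).-1 * rho r) H).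

(** Integration in polar coordinates.  Both sides are linear in [F] and agree for
    F = r^-(N+d-1) rho; the difference of [F] and a multiple of this profile has
    mean zero, which is the case of [intV_rad_zero_mean]. *)
Lemma intV_polar rho d H F : (0 < N)%N -> hpoly d H ->
  ccr Rad rho -> intR Rad rho = 1 -> ccr Rad F ->
  intV (rad F H) = intR Rad (fun r => r ^+ (N + d).-1 * F r) * sphere_mean rho d H.
Proof.
move=> N0 hH crho rho1 cF.
set p := (N + d).-1.
set I := intR _ _.
have cpF := ccr_X p cF.
have cphi : ccr Rad (fun r => r ^+ p * F r + (- I) * rho r).
  by apply: ccrD => //; exact: ccrZ.
have := intV_rad_zero_mean N0 hH cphi.
rewrite intRD//; last exact: ccrZ.
rewrite intRZ// rho1 mulr1 subrr => /(_ erefl).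
have -> : (fun r => r^-1 ^+ (N + d).-1 * (r ^+ p * F r + - I * rho r)) =
    fun r => F r + (- I) * (r^-1 ^+ p * rho r).
  apply/funext => r; have [->|r0] := eqVneq r 0.
    (* At r = 0 both sides vanish, whatever the value of 1/0. *)
    have R0 : ~ radii Rad (0 : R) by move=> /radii_gt0; rewrite ltxx.
    by rewrite (supp_out (proj2 crho) R0) (supp_out (proj2 cF) R0) !mulr0 !addr0 mulr0.
  by rewrite mulrDr mulrA -exprMn mulVf// expr1n mul1r mulrCA.
rewrite radDl intVD; last first.
  - by exact: (cc_rad (ccrZ _ (ccr_invX _ crho)) (hpoly_continuous hH)).
  - by exact: (cc_rad cF (hpoly_continuous hH)).
rewrite radZl intVZ; last by exact: (cc_rad (ccr_invX _ crho) (hpoly_continuous hH)).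
by move=> /eqP; rewrite mulNr subr_eq0 => /eqP.
Qed.

Lemma radii_point : exists r, radii Rad r.
Proof.
case: Rad Rad_gt0 => [r|_|//]; last by exists 1; split; rewrite ?ltry.
by rewrite lte_fin => r0; exists (r / 2); split; rewrite ?lte_fin; lra.
Qed.

Lemma mollifier_exists : exists rho, [/\ tf Rad rho, forall r, 0 <= rho r & intR Rad rho = 1].
Proof.
have [r [r0 rR]] := radii_point.
have [chi [schi chi1 chi0]] := @cutoff_exists R (r / 4) (r / 3) (r / 2) r ltac:(lra) ltac:(lra).
have tchi : tf Rad chi by split => //; exists (r / 4), r; split => //; lra.
pose rho x := chi x * chi x.
have trho : tf Rad rho by apply: tfM => //; exact: smooth1T schi.
have I0 : 0 < intR Rad rho.
  rewrite intR_T//; last by case: trho.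
  apply: (@Rintegral_gt0 _ _ _ mu `[r / 3, r / 2]%classic _ 1) => //.
  - rewrite [X in (_ < X < _)%E]lebesgue_measure_itv/= lte_fin ifT; last by lra.
    by rewrite -EFinB lte_fin ltry andbT; lra.
  - exact: cc1_integrable (ccr_cc (tf_ccr trho)).
  - by move=> x; rewrite /rho -expr2 sqr_ge0.
  - by move=> x; rewrite /= in_itv/= => /chi1; rewrite /rho => ->; rewrite mulr1.
exists (fun x => (intR Rad rho)^-1 * rho x); split.
- exact: tfZ.
- by move=> x; rewrite mulr_ge0 ?invr_ge0 ?(ltW I0)// /rho -expr2 sqr_ge0.
- by rewrite intRZ ?mulVf ?gt_eqF//; exact: tf_ccr.
Qed.

End polar.

(** * Harmonic polynomials: Laplacian, gradients, orthogonality *)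

Section rad_laplacian.
Context {R : realType}.
Variables (N : nat) (Rad : \bar R).
Hypothesis Rad_gt0 : (0 < Rad)%E.
Implicit Types (P Y Z H : 'rV[R]_N -> R) (g h F phi rho : R -> R).

Definition harmonic Y := forall x, laplacian Y x = 0.

(** For [Y] harmonic of degree k, the Laplacian of g(|x|) Y is this profile times Y. *)
Definition lap_rad (k : nat) g r : R :=
  (N + k + k)%:R * over_r g r + r * derive1 (over_r g) r.

Lemma tf_X n g : tf Rad g -> tf Rad (fun r => r ^+ n * g r).
Proof.
move=> tg; apply: tfM => //; apply: smooth1X; first exact: open_radii.
by move=> k; exact: diffk_id.
Qed.

Lemma tf_lap_rad k g : tf Rad g -> tf Rad (lap_rad k g).
Proof.
move=> tg; have to := tf_over_r tg.
apply: tfD; first exact: tfZ.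
by have := tf_X 1 (tf_derive to); under eq_fun do rewrite expr1.
Qed.

Lemma derive_radE g Y i x : tf Rad g -> differentiable Y x ->
  'd_i (rad g Y) x = rad (over_r g) (fun x => x ord0 i * Y x) x + rad g ('d_i Y) x.
Proof. by move=> tg dY; have [_ ->] := rad_derive i (tf_c1r tg) dY. Qed.

Lemma derive_rad g Y i : tf Rad g -> (forall x, differentiable Y x) ->
  'd_i (rad g Y) = fun x => rad (over_r g) (fun x => x ord0 i * Y x) x + rad g ('d_i Y) x.
Proof. by move=> tg dY; apply/funext => x; exact: derive_radE. Qed.

Lemma derive2_rad g Y i x : tf Rad g -> (forall x, differentiable Y x) ->
  (forall x, differentiable ('d_i Y) x) ->
  differentiable ('d_i (rad g Y)) x /\
  'd_i ('d_i (rad g Y)) x =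
    (over_r (over_r g) (enorm x) * Y x) * x ord0 i ^+ 2 +
    over_r g (enorm x) * (Y x + 2 * (x ord0 i * 'd_i Y x)) +
    g (enorm x) * 'd_i ('d_i Y) x.
Proof.
move=> tg dY ddY; have to := tf_over_r tg.
rewrite (derive_rad i tg dY).
have diY : differentiable (fun x : 'rV[R]_N => x ord0 i * Y x) x.
  by apply: differentiableM => //; exact: differentiable_coord.
have [D1 E1] := rad_derive i (tf_c1r to) diY.
have [D2 E2] := rad_derive i (tf_c1r tg) (ddY x).
split; first exact: differentiableD.
rewrite (@deriveD _ _ _ (rad (over_r g) (fun x => x ord0 i * Y x)) (rad g ('d_i Y)));
  [|exact: diff_derivable..].
rewrite E1 E2 /rad (derive_coordM _ _ (dY x)) eqxx (_ : true%:R = 1 :> R)//.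
ring.
Qed.

Lemma laplacian_rad g Y k x : tf Rad g -> hpoly k Y -> harmonic Y ->
  laplacian (rad g Y) x = rad (lap_rad k g) Y x.
Proof.
move=> tg hY HY.
have dY y : differentiable Y y by exact: hpoly_diff hY.
have ddY i y : differentiable ('d_i Y) y.
  exact: hpoly_diff (proj1 (hpoly_derive i hY)).
rewrite /laplacian.
under eq_bigr => i _ do rewrite (proj2 (derive2_rad x tg dY (ddY i))).
rewrite !big_split/= -!mulr_sumr -enorm_sqr -/(laplacian Y x) HY mulr0 addr0.
rewrite big_split/= -mulr_sumr (hpoly_euler x hY) sumr_const card_ord -mulr_natl.
rewrite /rad /lap_rad {1}/over_r !natrD.
have [->|r0] := eqVneq (enorm x) 0; first by rewrite invr0; ring.
by field.
Qed.

Lemma grad_dot_rad g h Y Z k l x : tf Rad g -> tf Rad h -> hpoly k Y -> hpoly l Z ->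
  \sum_(i < N) 'd_i (rad g Y) x * 'd_i (rad h Z) x =
  rad (fun r => r ^+ 2 * (over_r g r * over_r h r) + l%:R * (over_r g r * h r)
         + k%:R * (over_r h r * g r)) (fun x => Y x * Z x) x
  + rad (fun r => g r * h r) (fun x => \sum_(i < N) 'd_i Y x * 'd_i Z x) x.
Proof.
move=> tg th hY hZ.
have dY := hpoly_diff x hY; have dZ := hpoly_diff x hZ.
under eq_bigr do rewrite (derive_radE _ tg dY) (derive_radE _ th dZ) /rad.
have E i : (over_r g (enorm x) * (x ord0 i * Y x) + g (enorm x) * 'd_i Y x) *
   (over_r h (enorm x) * (x ord0 i * Z x) + h (enorm x) * 'd_i Z x) =
   (over_r g (enorm x) * over_r h (enorm x) * (Y x * Z x)) * (x ord0 i ^+ 2) +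
   (over_r g (enorm x) * h (enorm x) * Y x) * (x ord0 i * 'd_i Z x) +
   (over_r h (enorm x) * g (enorm x) * Z x) * (x ord0 i * 'd_i Y x) +
   (g (enorm x) * h (enorm x)) * ('d_i Y x * 'd_i Z x) by ring.
under eq_bigr do rewrite E.
rewrite !big_split/= -!mulr_sumr -enorm_sqr (hpoly_euler x hY) (hpoly_euler x hZ) /rad.
ring.
Qed.

(** The integral of the derivative of r^(p-1) F vanishes. *)
Lemma intR_X_over_r p F : tf Rad F ->
  intR Rad (fun r => r ^+ p * over_r F r) =
  (1 - p%:R) * intR Rad (fun r => r ^+ p * (r^-1 ^+ 2 * F r)).
Proof.
move=> tF.
have tG : tf Rad (fun r => r ^+ p * (r^-1 * F r)).
  by apply: tf_X; apply: tfM => //; exact: smooth1_inv.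
have c1 : ccr Rad (fun r => r ^+ p * over_r F r).
  by apply: tf_ccr; apply: tf_X; exact: tf_over_r.
have c2 : ccr Rad (fun r => r ^+ p * (r^-1 ^+ 2 * F r)).
  by apply: ccr_X; apply: ccr_invX; exact: tf_ccr.
have := intR_derive tG.
rewrite (@eq_intR _ _ _ (fun r => r ^+ p * over_r F r + (p%:R - 1) * (r ^+ p * (r^-1 ^+ 2 * F r)))).
  rewrite intRD//; last exact: ccrZ.
  by rewrite intRZ// => /eqP; rewrite addr_eq0 => /eqP ->; ring.
move=> r Rr; have r0 := radii_neq0 Rr.
rewrite (is_derive_derive1 (is_derive_mul (is_derive_X p r0)
  (is_derive_mul (is_derive_V r0) (tf_is_derive r tF)))) /over_r; ring.
Qed.

(** Partial integration of F grad Y . grad Z, which moves the derivatives from [Y] to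
    the rest: as [Z] is harmonic only the derivative of F remains, and Euler's
    identity evaluates x . grad Z. *)
Lemma intV_rad_grad_dot F Y Z k l : tf Rad F -> hpoly k Y -> hpoly l Z -> harmonic Z ->
  intV (rad F (fun x => \sum_(i < N) 'd_i Y x * 'd_i Z x)) =
  - l%:R * intV (rad (over_r F) (fun x => Y x * Z x)).
Proof.
move=> tF hY hZ HZ; have cF := tf_ccr tF; have cF' := tf_ccr (tf_over_r tF).
have hd i := proj1 (hpoly_derive i hZ).
have hP i := hpolyM hY (hd i).
have hYd i := proj1 (hpoly_derive i hY).
have hQ i := hpolyM (hYd i) (hd i).
have hdd i := proj1 (hpoly_derive i (hd i)).
have hS i := hpolyM hY (hdd i).
have hYZ := hpolyM hY hZ.
have ccX i : cc (rad (over_r F) (fun x => x ord0 i * (Y x * 'd_i Z x))).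
  exact: (cc_rad cF' (hpoly_continuous (hpolyX i (hP i)))).
have ccQ i : cc (rad F (fun x => 'd_i Y x * 'd_i Z x)).
  exact: (cc_rad cF (hpoly_continuous (hQ i))).
have ccS i : cc (rad F (fun x => Y x * 'd_i ('d_i Z) x)).
  exact: (cc_rad cF (hpoly_continuous (hS i))).
have E i : intV (rad F (fun x => 'd_i Y x * 'd_i Z x)) +
   intV (rad F (fun x => Y x * 'd_i ('d_i Z) x)) =
   - intV (rad (over_r F) (fun x => x ord0 i * (Y x * 'd_i Z x))).
  rewrite (intV_rad_derive i (tf_c1r tF) (hP i)) opprK -intVD// -radDr.
  by congr intV; apply/funext => x; rewrite /rad (derive_hpolyM _ _ hY (hd i)).
have sumE G (P : 'I_N -> 'rV[R]_N -> R) : (forall i, cc (rad G (P i))) ->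
    intV (rad G (fun x => \sum_(i < N) P i x)) = \sum_(i < N) intV (rad G (P i)).
  by move=> cP; rewrite rad_sumr intV_sum.
have Es : \sum_(i < N) intV (rad F (fun x => 'd_i Y x * 'd_i Z x)) +
   \sum_(i < N) intV (rad F (fun x => Y x * 'd_i ('d_i Z) x)) =
   - \sum_(i < N) intV (rad (over_r F) (fun x => x ord0 i * (Y x * 'd_i Z x))).
  by rewrite -sumrN -big_split; apply: eq_bigr => i _; exact: E.
have := etrans (congr2 +%R (sumE _ _ ccQ) (sumE _ _ ccS))
  (etrans Es (congr1 -%R (esym (sumE _ _ ccX)))).
have -> : (fun x => \sum_(i < N) Y x * 'd_i ('d_i Z) x) = fun _ => 0.
  by apply/funext => x; rewrite -mulr_sumr -/(laplacian Z x) HZ mulr0.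
have -> : intV (rad F (fun _ : 'rV[R]_N => 0)) = 0.
  have -> : rad F (fun _ : 'rV[R]_N => 0) = fun x => 0 * rad F Y x.
    by apply/funext => x; rewrite /rad mulr0 mul0r.
  by rewrite intVZ ?mul0r//; exact: (cc_rad cF (hpoly_continuous hY)).
rewrite addr0 => ->; rewrite mulNr -intVZ; last exact: (cc_rad cF' (hpoly_continuous hYZ)).
rewrite -radZr; congr (- intV (rad _ _)); apply/funext => x.
under eq_bigr do rewrite mulrCA.
by rewrite -mulr_sumr (hpoly_euler x hZ) mulrCA.
Qed.

Variable rho : R -> R.
Hypothesis rho_tf : tf Rad rho.
Hypothesis rho1 : intR Rad rho = 1.
Hypothesis N0 : (0 < N)%N.
Notation M := (sphere_mean rho).

Lemma intV_grad_dot_polar F Y Z k l : tf Rad F -> hpoly k Y -> hpoly l Z -> harmonic Z ->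
  intV (rad F (fun x => \sum_(i < N) 'd_i Y x * 'd_i Z x)) =
  l%:R * ((N + (k + l)).-1%:R - 1) *
   intR Rad (fun r => r ^+ (N + (k + l)).-1 * (r^-1 ^+ 2 * F r)) *
   M (k + l) (fun x => Y x * Z x).
Proof.
move=> tF hY hZ HZ; rewrite (intV_rad_grad_dot tF hY hZ HZ).
rewrite (intV_polar N0 (hpolyM hY hZ) (tf_ccr rho_tf) rho1 (tf_ccr (tf_over_r tF))).
by rewrite intR_X_over_r//; ring.
Qed.

(** The reflection x |-> -x changes the sign. *)
Lemma sphere_mean_odd d H : hpoly d H -> odd d -> M d H = 0.
Proof.
move=> hH od; rewrite /sphere_mean; set F := fun r => _.
have cF : cc (rad F H).
  by apply: (@cc_rad _ _ Rad); [apply: ccr_invX; exact: tf_ccr|exact: hpoly_continuous hH].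
have := intV_reflect 0 cF.
have -> : (fun x => rad F H (0 - x)) = fun x => (-1) * rad F H x.
  apply/funext => x; rewrite /rad sub0r (hpoly_opp x hH) -signr_odd od expr1.
  rewrite (_ : enorm (- x) = enorm x); first by ring.
  by rewrite /enorm; congr Num.sqrt; apply: eq_bigr => i _; rewrite mxE sqrrN.
by rewrite intVZ// => /eqP; rewrite mulN1r eq_sym -subr_eq0 opprK -mulr2n mulrn_eq0 => /eqP.
Qed.

(** The integral of F grad Y . grad Z is symmetric in [Y] and [Z], but
    [intV_grad_dot_polar] evaluates it as a multiple of l, or of k after exchange of
    the two, with the common factor N + k + l - 2.  If this factor is not 0 the mean is
    0; otherwise k + l = 1, the integrand is odd and the mean is 0 as well. *)
Lemma sphere_mean_orthogonal Y Z k l : hpoly k Y -> hpoly l Z -> harmonic Y -> harmonic Z ->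
  k != l -> M (k + l) (fun x => Y x * Z x) = 0.
Proof.
move=> hY hZ HY HZ kl.
set p := (N + (k + l)).-1.
have tF : tf Rad (fun r => r^-1 ^+ p * (r ^+ 2 * rho r)).
  by apply: tfM; [exact: smooth1_invX|exact: tf_X].
have := intV_grad_dot_polar tF hY hZ HZ.
have -> : (fun x => \sum_(i < N) 'd_i Y x * 'd_i Z x) = (fun x => \sum_(i < N) 'd_i Z x * 'd_i Y x).
  by apply/funext => x; apply: eq_bigr => i _; rewrite mulrC.
rewrite (intV_grad_dot_polar tF hZ hY HY) [(l + k)%N]addnC -/p.
have -> : (fun x => Z x * Y x) = (fun x => Y x * Z x) by apply/funext => x; rewrite mulrC.
rewrite (@eq_intR _ _ _ rho); last first.
  by move=> r /radii_neq0 r0; rewrite !exprVn; field; rewrite expf_neq0.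
rewrite rho1 !mulr1 => /eqP; rewrite -subr_eq0 -mulrBl -mulrBl mulf_eq0 => /orP[|/eqP//].
rewrite mulf_eq0 subr_eq0 eqr_nat (negbTE kl)/= subr_eq0 => p1.
have {}p1 : p = 1%N by apply/eqP; rewrite -(eqr_nat R).
(* The remaining case N + k + l = 2 with k <> l forces k + l = 1. *)
apply: sphere_mean_odd; first exact: hpolyM.
have kl0 : (0 < k + l)%N.
  by rewrite lt0n addn_eq0; apply: contra kl => /andP[/eqP-> /eqP->].
have : (N + (k + l) = 2)%N by rewrite -[LHS]prednK ?addn_gt0 ?N0// -/p p1.
by move: N0 kl0; case: N => [//|[|n]] _; case: (k + l)%N => [//|[|m]] _ //; rewrite ?addSn ?addnS.
Qed.

End rad_laplacian.

(** * The one-dimensional quadratic forms *)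

Section radial_form.
Context {R : realType}.
Variables (N : nat) (Rad : \bar R) (V W : R -> R).
Hypothesis Rad_gt0 : (0 < Rad)%E.
Hypothesis N0 : (0 < N)%N.
Hypothesis sV : smooth1 (radii Rad) V.
Hypothesis sW : smooth1 (radii Rad) W.
Implicit Types (u w g h : R -> R) (c : R).

Lemma tf_mul u w : tf Rad u -> tf Rad w -> tf Rad (fun r => u r * w r).
Proof. by move=> [su _] tw; exact: (tfM (smooth1T su) tw). Qed.

Lemma tf_invX n u : tf Rad u -> tf Rad (fun r => r^-1 ^+ n * u r).
Proof. by apply: tfM; exact: smooth1_invX. Qed.

(** If [Y] is harmonic of degree k and c = k(N+k-2), the Laplacian of
    u(r) Y(x/|x|) is [modal c u] (r) Y(x/|x|). *)
Definition modal c u r : R :=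
  derive1 (derive1 u) r + (N%:R - 1) * (r^-1 * derive1 u r) - c * (r^-1 ^+ 2 * u r).

Lemma tf_modal c u : tf Rad u -> tf Rad (modal c u).
Proof.
move=> tu; have tu' := tf_derive tu.
rewrite (_ : modal c u = fun r => (derive1 (derive1 u) r
   + (N%:R - 1) * (r^-1 ^+ 1 * derive1 u r)) + (- c) * (r^-1 ^+ 2 * u r)).
  by apply: tfD; [apply: tfD; [exact: tf_derive|apply: tfZ; exact: tf_invX]|apply: tfZ; exact: tf_invX].
by apply/funext => r; rewrite /modal mulNr.
Qed.

Definition qf_density c u w r : R :=
  r ^+ N.-1 * (V r * (modal c u r * modal c w r)
    - W r * (derive1 u r * derive1 w r + c * (r^-1 ^+ 2 * (u r * w r)))).

(** The form q_c, polarised: the variant with two arguments is needed for sums of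
    several products with the same degree. *)
Definition qf c u w : R := intR Rad (qf_density c u w).

Lemma tf_qf_density c u w : tf Rad u -> tf Rad w -> tf Rad (qf_density c u w).
Proof.
move=> tu tw; apply: tf_X.
rewrite (_ : (fun r => _) = fun r => V r * (modal c u r * modal c w r)
    + (-1) * (W r * (derive1 u r * derive1 w r + c * (r^-1 ^+ 2 * (u r * w r))))).
  apply: tfD; first by apply: (tfM sV); apply: tf_mul; exact: tf_modal.
  apply: tfZ; apply: (tfM sW); apply: tfD; first by apply: tf_mul; exact: tf_derive.
  by apply: tfZ; apply: tf_invX; exact: tf_mul.
by apply/funext => r; rewrite mulN1r.
Qed.

(** The integrals that occur in the one-dimensional inequalities, with the power
    N-1-n of r split into natural powers of r and 1/r. *)
Definition wint (f : R -> R) (n : nat) u : R :=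
  intR Rad (fun r => r ^+ N.-1 * (r^-1 ^+ n * (f r * u r ^+ 2))).

Lemma tf_wint f n u : smooth1 (radii Rad) f -> tf Rad u ->
  tf Rad (fun r => r ^+ N.-1 * (r^-1 ^+ n * (f r * u r ^+ 2))).
Proof.
move=> sf tu; apply: tf_X; apply: tf_invX; apply: tfM => //.
by under eq_fun do rewrite expr2; exact: tf_mul.
Qed.

(** Expand the square.  The mixed products u' u'', u u'' and u u' are removed by
    subtracting the derivative of
    (N-1) V r^(N-2) u'^2 - 2c V r^(N-3) u u' - 2c V r^(N-4) u^2 + c V' r^(N-3) u^2,
    whose integral vanishes. *)
Lemma qf_expand c u : tf Rad u ->
  qf c u u = wint V 0 (derive1 (derive1 u))
    + ((N%:R - 1) + 2 * c) * wint V 2 (derive1 u)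
    + (c ^+ 2 + 2 * (N%:R - 4) * c) * wint V 4 u
    - (N%:R - 1) * wint (derive1 V) 1 (derive1 u)
    - (N%:R - 5) * c * wint (derive1 V) 3 u
    - c * wint (derive1 (derive1 V)) 2 u
    - wint W 0 (derive1 u) - c * wint W 2 u.
Proof.
move=> tu; have tu' := tf_derive tu; have tu'' := tf_derive tu'.
have sV' := smooth1_derive sV; have sV'' := smooth1_derive sV'.
have t1 := tf_wint 0 sV tu''. have t2 := tf_wint 2 sV tu'.
have t3 := tf_wint 4 sV tu. have t4 := tf_wint 1 sV' tu'.
have t5 := tf_wint 3 sV' tu. have t6 := tf_wint 2 sV'' tu.
have t7 := tf_wint 0 sW tu'. have t8 := tf_wint 2 sW tu.
pose G1 r := r ^+ N.-1 * (r^-1 ^+ 1 * (V r * (derive1 u r * derive1 u r))).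
pose G2 r := r ^+ N.-1 * (r^-1 ^+ 2 * (V r * (u r * derive1 u r))).
pose G3 r := r ^+ N.-1 * (r^-1 ^+ 3 * (V r * (u r * u r))).
pose G4 r := r ^+ N.-1 * (r^-1 ^+ 2 * (derive1 V r * (u r * u r))).
(* The primitive whose derivative contains all the mixed products. *)
pose G r := (N%:R - 1) * G1 r + (- 2 * c) * G2 r + (- 2 * c) * G3 r + c * G4 r.
have tG : tf Rad G.
  have tg f n v v' : smooth1 (radii Rad) f -> tf Rad v -> tf Rad v' ->
      tf Rad (fun r => r ^+ N.-1 * (r^-1 ^+ n * (f r * (v r * v' r)))).
    by move=> sf tv tv'; apply: tf_X; apply: tf_invX; apply: tfM => //; exact: tf_mul.
  by apply: tfD; [apply: tfD; [apply: tfD|]|]; apply: tfZ; exact: tg.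
have IG := intR_derive tG.
pose S r :=
  1 * (r ^+ N.-1 * (r^-1 ^+ 0 * (V r * derive1 (derive1 u) r ^+ 2)))
  + (((N%:R - 1) + 2 * c) * (r ^+ N.-1 * (r^-1 ^+ 2 * (V r * derive1 u r ^+ 2)))
  + ((c ^+ 2 + 2 * (N%:R - 4) * c) * (r ^+ N.-1 * (r^-1 ^+ 4 * (V r * u r ^+ 2)))
  + ((- (N%:R - 1)) * (r ^+ N.-1 * (r^-1 ^+ 1 * (derive1 V r * derive1 u r ^+ 2)))
  + ((- ((N%:R - 5) * c)) * (r ^+ N.-1 * (r^-1 ^+ 3 * (derive1 V r * u r ^+ 2)))
  + ((- c) * (r ^+ N.-1 * (r^-1 ^+ 2 * (derive1 (derive1 V) r * u r ^+ 2)))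
  + ((-1) * (r ^+ N.-1 * (r^-1 ^+ 0 * (W r * derive1 u r ^+ 2)))
  + ((- c) * (r ^+ N.-1 * (r^-1 ^+ 2 * (W r * u r ^+ 2)))
  + derive1 G r))))))).
have -> : qf c u u = intR Rad S.
  apply: eq_intR => r Rr; have r0 := radii_neq0 Rr.
  have hP := is_derive_X N.-1 r0.
  have hy n := derive_invX n r0.
  have hV := smooth1_is_derive sV Rr.
  have hV' := smooth1_is_derive sV' Rr.
  have hu := tf_is_derive r tu.
  have hu' := tf_is_derive r tu'.
  have D1 := is_derive_mul hP (is_derive_mul (hy 1%N) (is_derive_mul hV (is_derive_mul hu' hu'))).
  have D2 := is_derive_mul hP (is_derive_mul (hy 2%N) (is_derive_mul hV (is_derive_mul hu hu'))).
  have D3 := is_derive_mul hP (is_derive_mul (hy 3%N) (is_derive_mul hV (is_derive_mul hu hu))).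
  have D4 := is_derive_mul hP (is_derive_mul (hy 2%N) (is_derive_mul hV' (is_derive_mul hu hu))).
  have D := is_derive_add (is_derive_add (is_derive_add (is_derive_scale (N%:R - 1) D1)
     (is_derive_scale (- 2 * c) D2)) (is_derive_scale (- 2 * c) D3)) (is_derive_scale c D4).
  rewrite /S (is_derive_derive1 D) /qf_density /modal.
  have -> : N.-1%:R = N%:R - 1 :> R by rewrite -{2}(prednK N0) -natr1 addrK.
  move: (r ^+ N.-1) (r^-1) (N%:R : R) (V r) (derive1 V r) (derive1 (derive1 V) r) (W r)
    (u r) (derive1 u r) (derive1 (derive1 u) r) => P y n v v' v'' w a a' a''.
  by clear; ring.
have H a f F : ccr Rad f -> ccr Rad F ->
   intR Rad (fun r => a * f r + F r) = a * intR Rad f + intR Rad F.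
  by move=> cf cF; rewrite intRD ?intRZ//; exact: ccrZ.
have tH a f F : tf Rad f -> tf Rad F -> tf Rad (fun r => a * f r + F r).
  by move=> cf cF; apply: tfD => //; exact: tfZ.
have tG' := tf_derive tG.
have s8 := tH (- c) _ _ t8 tG'.
have s7 := tH (-1) _ _ t7 s8.
have s6 := tH (- c) _ _ t6 s7.
have s5 := tH (- ((N%:R - 5) * c)) _ _ t5 s6.
have s4 := tH (- (N%:R - 1)) _ _ t4 s5.
have s3 := tH (c ^+ 2 + 2 * (N%:R - 4) * c) _ _ t3 s4.
have s2 := tH ((N%:R - 1) + 2 * c) _ _ t2 s3.
rewrite /S (H _ _ _ (tf_ccr t1) (tf_ccr s2)) (H _ _ _ (tf_ccr t2) (tf_ccr s3)).
rewrite (H _ _ _ (tf_ccr t3) (tf_ccr s4)) (H _ _ _ (tf_ccr t4) (tf_ccr s5)).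
rewrite (H _ _ _ (tf_ccr t5) (tf_ccr s6)) (H _ _ _ (tf_ccr t6) (tf_ccr s7)).
rewrite (H _ _ _ (tf_ccr t7) (tf_ccr s8)) (H _ _ _ (tf_ccr t8) (tf_ccr tG')) IG.
rewrite -!/(wint _ _ _).
move: (wint _ _ _) (wint _ _ _) (wint _ _ _) (wint _ _ _) (wint _ _ _) (wint _ _ _)
  (wint _ _ _) (wint _ _ _).
by clear; move: (N%:R : R) => n *; ring.
Qed.

(** The expanded form is a quadratic polynomial in c, and with c_1 = N-1, c_2 = 2N
    its increment is q_c - q_(c_1) = (c - c_1) (H + (c - c_2) int V r^(N-5) u^2), where H
    is the quantity assumed to be nonnegative. *)
Lemma qf_ge0 c u : tf Rad u -> (forall r, radii Rad r -> 0 <= V r) ->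
  0 <= 2 * wint V 2 (derive1 u) - wint (derive1 (derive1 V)) 2 u
     - (N%:R - 5) * wint (derive1 V) 3 u + (5 * N%:R - 9) * wint V 4 u - wint W 2 u ->
  0 <= qf (N%:R - 1) u u -> 2 * N%:R <= c -> 0 <= qf c u u.
Proof.
move=> tu V0 H q1 c2.
have N1 : 1 <= N%:R :> R by rewrite ler1n.
have W0 : 0 <= wint V 4 u.
  apply: intR_ge0 => r Rr; have r0 := radii_gt0 Rr.
  by rewrite mulr_ge0 ?exprn_ge0 ?(ltW r0)// mulr_ge0 ?exprn_ge0 ?invr_ge0 ?(ltW r0)// mulr_ge0 ?sqr_ge0 ?V0.
set X := (X in 0 <= X) in H.
have -> : qf c u u = qf (N%:R - 1) u u + (c - (N%:R - 1)) * (X + (c - 2 * N%:R) * wint V 4 u).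
  rewrite (qf_expand c tu) (qf_expand (N%:R - 1) tu) /X.
  move: (wint V 0 _) (wint V 2 _) (wint V 4 _) (wint _ 1 _) (wint _ 3 _)
    (wint (derive1 _) 2 _) (wint W 0 _) (wint W 2 _) (N%:R : R).
  by clear; move=> *; ring.
apply: addr_ge0 => //; apply: mulr_ge0; first by lra.
by apply: addr_ge0 => //; apply: mulr_ge0 => //; lra.
Qed.

Lemma modal_sum c n (y : 'I_n -> R) (u : 'I_n -> R -> R) r : (forall i, tf Rad (u i)) ->
  derive1 (fun r => \sum_(i < n) y i * u i r) r = \sum_(i < n) y i * derive1 (u i) r /\
  modal c (fun r => \sum_(i < n) y i * u i r) r = \sum_(i < n) y i * modal c (u i) r.
Proof.
move=> tu.
have E : derive1 (fun r => \sum_(i < n) y i * u i r) = fun r => \sum_(i < n) y i * derive1 (u i) r.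
  apply/funext => x; apply: is_derive_derive1; apply: is_derive_bigsum => i.
  by apply: is_derive_scale; exact: tf_is_derive.
split; first by rewrite E.
rewrite /modal E.
have -> : derive1 (fun r => \sum_(i < n) y i * derive1 (u i) r) r = \sum_(i < n) y i * derive1 (derive1 (u i)) r.
  apply: is_derive_derive1; apply: is_derive_bigsum => i.
  by apply: is_derive_scale; apply: tf_is_derive; exact: tf_derive.
rewrite !mulr_sumr -sumrN -!big_split/=; apply: eq_bigr => i _; ring.
Qed.

Lemma qf_sum c n (y : 'I_n -> R) (u : 'I_n -> R -> R) : (forall i, tf Rad (u i)) ->
  qf c (fun r => \sum_(i < n) y i * u i r) (fun r => \sum_(i < n) y i * u i r) =
  \sum_(i < n) \sum_(j < n) y i * y j * qf c (u i) (u j).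
Proof.
move=> tu; rewrite /qf.
have -> : qf_density c (fun r => \sum_(i < n) y i * u i r) (fun r => \sum_(i < n) y i * u i r) =
   fun r => \sum_(i < n) \sum_(j < n) y i * y j * qf_density c (u i) (u j) r.
  apply/funext => r; rewrite /qf_density; have [-> ->] := modal_sum c y r tu.
  have sq (A : 'I_n -> R) : (\sum_(i < n) y i * A i) * (\sum_(i < n) y i * A i) =
      \sum_(i < n) \sum_(j < n) y i * y j * (A i * A j).
    rewrite big_distrlr/=; apply: eq_bigr => i _; apply: eq_bigr => j _; ring.
  rewrite !sq mulrBr !mulrDr !mulr_sumr -!big_split -sumrN -big_split/=.
  apply: eq_bigr => i _.
  rewrite !mulr_sumr -!big_split -sumrN -big_split/=.
  apply: eq_bigr => j _; ring.
have cij i j : ccr Rad (fun r => y i * y j * qf_density c (u i) (u j) r).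
  by apply: tf_ccr; apply: tfZ; exact: tf_qf_density.
rewrite intR_sum//; last by move=> i; exact: ccr_sum.
apply: eq_bigr => i _; rewrite intR_sum//.
apply: eq_bigr => j _.
by rewrite intRZ//; apply: tf_ccr; exact: tf_qf_density.
Qed.

End radial_form.

(** * Diagonalisation of the quadratic form on the ball *)

Section rellich_form.
Context {R : realType}.
Variables (N : nat) (Rad : \bar R) (V W rho : R -> R).
Hypothesis Rad_gt0 : (0 < Rad)%E.
Hypothesis N0 : (0 < N)%N.
Hypothesis sV : smooth1 (radii Rad) V.
Hypothesis sW : smooth1 (radii Rad) W.
Hypothesis rho_tf : tf Rad rho.
Hypothesis rho1 : intR Rad rho = 1.
Implicit Types (Y Z : 'rV[R]_N -> R) (g h : R -> R) (f e : 'rV[R]_N -> R).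
Notation M := (sphere_mean rho).
Notation qf := (qf N Rad V W).

(** The eigenvalues of minus the Laplace-Beltrami operator on the unit sphere. *)
Definition eigen (k : nat) : R := k%:R * (N%:R + k%:R - 2).

Definition Bdens f e x : R :=
  V (enorm x) * (laplacian f x * laplacian e x)
  - W (enorm x) * \sum_(i < N) 'd_i f x * 'd_i e x.

(** The form whose sign on the diagonal is the inequality on the ball. *)
Definition Bform f e : R := intV (Bdens f e).

Lemma lap_radE k g r : tf Rad g -> r != 0 ->
  derive1 (over_r g) r = - r^-1 ^+ 2 * derive1 g r + r^-1 * derive1 (derive1 g) r /\
  lap_rad N k g r = (N%:R + k%:R + k%:R - 1) * (r^-1 * derive1 g r) + derive1 (derive1 g) r.
Proof.
move=> tg r0.
have E : derive1 (over_r g) r = - r^-1 ^+ 2 * derive1 g r + r^-1 * derive1 (derive1 g) r.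
  apply: is_derive_derive1; apply: (is_derive_mul (is_derive_V r0)).
  exact: tf_is_derive r (tf_derive tg).
split => //; rewrite /lap_rad E /over_r !natrD; by field.
Qed.

Lemma derive_Xmul k g r : tf Rad g ->
  derive1 (fun r => r ^+ k * g r) r = k%:R * (r^-1 * (r ^+ k * g r)) + r ^+ k * derive1 g r.
Proof.
move=> tg; have tu := tf_X k tg; have tu' := tf_derive tu; have tg' := tf_derive tg.
have [Rr|Rr] := pselect (radii Rad r).
  have r0 := radii_neq0 Rr.
  rewrite (is_derive_derive1 (is_derive_mul (is_derive_X k r0) (tf_is_derive r tg))); ring.
by rewrite (supp_out (proj2 tu') Rr) (supp_out (proj2 tg) Rr) (supp_out (proj2 tg') Rr); ring.
Qed.

Lemma modal_Xmul k g r : tf Rad g -> r != 0 ->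
  modal N (eigen k) (fun r => r ^+ k * g r) r = r ^+ k * lap_rad N k g r.
Proof.
move=> tg r0; have tu := tf_X k tg; have tg' := tf_derive tg.
rewrite /modal; have [_ ->] := lap_radE k tg r0.
have -> : derive1 (fun r => r ^+ k * g r) =
   fun r => k%:R * (r^-1 * (r ^+ k * g r)) + r ^+ k * derive1 g r.
  by apply/funext => x; exact: derive_Xmul.
have hX := is_derive_X k r0.
have D := is_derive_add
  (is_derive_scale k%:R (is_derive_mul (is_derive_V r0) (is_derive_mul hX (tf_is_derive r tg))))
  (is_derive_mul hX (tf_is_derive r tg')).
rewrite (is_derive_derive1 D) /eigen.
move: (r ^+ k) (r^-1) (N%:R : R) (k%:R : R) (g r) (derive1 g r) (derive1 (derive1 g) r).
by clear; move=> *; ring.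
Qed.

(** The part of grad(g Y) . grad(h Z) that is a multiple of Y Z, by Euler's
    identity; the rest is g h times grad Y . grad Z. *)
Definition gcoef k l g h r : R :=
  r ^+ 2 * (over_r g r * over_r h r) + l%:R * (over_r g r * h r) + k%:R * (over_r h r * g r).

Lemma tf_gcoef k l g h : tf Rad g -> tf Rad h -> tf Rad (gcoef k l g h).
Proof.
move=> tg th; have tog := tf_over_r tg; have toh := tf_over_r th.
apply: tfD; first apply: tfD.
- by apply: tf_X; exact: tf_mul.
- by apply: tfZ; exact: tf_mul.
- by apply: tfZ; exact: tf_mul.
Qed.

Lemma Bdens_rad g h Y Z k l : tf Rad g -> tf Rad h -> hpoly k Y -> hpoly l Z ->
  harmonic Y -> harmonic Z ->
  Bdens (rad g Y) (rad h Z) = fun x =>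
    rad (fun r => V r * (lap_rad N k g r * lap_rad N l h r)) (fun x => Y x * Z x) x +
    (-1) * (rad (fun r => W r * gcoef k l g h r) (fun x => Y x * Z x) x +
            rad (fun r => W r * (g r * h r)) (fun x => \sum_(i < N) 'd_i Y x * 'd_i Z x) x).
Proof.
move=> tg th hY hZ HY HZ; apply/funext => x.
rewrite /Bdens (laplacian_rad _ tg hY HY) (laplacian_rad _ th hZ HZ) (grad_dot_rad _ tg th hY hZ).
rewrite /rad -/(gcoef k l g h _).
move: (V _) (W _) (gcoef _ _ _ _ _) (lap_rad _ _ _ _) (lap_rad _ _ _ _) (g _) (h _) (Y x) (Z x) (\sum_(i < N) _).
by clear; move=> *; ring.
Qed.

Lemma hpoly_grad_dot Y Z k l : hpoly k Y -> hpoly l Z ->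
  hpoly (k.-1 + l.-1) (fun x => \sum_(i < N) 'd_i Y x * 'd_i Z x).
Proof.
move=> hY hZ; apply: hpoly_sum => i.
exact: hpolyM (proj1 (hpoly_derive i hY)) (proj1 (hpoly_derive i hZ)).
Qed.

Lemma cc_Bdens_rad g h Y Z k l : tf Rad g -> tf Rad h -> hpoly k Y -> hpoly l Z ->
  harmonic Y -> harmonic Z -> cc (Bdens (rad g Y) (rad h Z)).
Proof.
move=> tg th hY hZ HY HZ; rewrite (Bdens_rad tg th hY hZ HY HZ).
have cYZ := hpoly_continuous (hpolyM hY hZ).
have tL := tf_mul (tf_lap_rad N k tg) (tf_lap_rad N l th).
apply: ccD; first exact: (cc_rad (tf_ccr (tfM sV tL)) cYZ).
apply: ccZ; apply: ccD; first exact: (cc_rad (tf_ccr (tfM sW (tf_gcoef k l tg th))) cYZ).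
exact: (cc_rad (tf_ccr (tfM sW (tf_mul tg th))) (hpoly_continuous (hpoly_grad_dot hY hZ))).
Qed.

(** Polar integration of the products of Laplacians and of the gradient terms; the
    term in grad Y . grad Z is itself a multiple of the mean of Y Z by
    [intV_grad_dot_polar].  The powers of r are absorbed by the substitution
    u = r^k g. *)
Lemma Bform_rad g h Y Z k l : tf Rad g -> tf Rad h -> hpoly k Y -> hpoly l Z ->
  harmonic Y -> harmonic Z ->
  Bform (rad g Y) (rad h Z) = (k == l)%:R * (M (k + l) (fun x => Y x * Z x) *
     qf (eigen k) (fun r => r ^+ k * g r) (fun r => r ^+ l * h r)).
Proof.
move=> tg th hY hZ HY HZ; rewrite /Bform (Bdens_rad tg th hY hZ HY HZ).
have hYZ := hpolyM hY hZ; have cYZ := hpoly_continuous hYZ.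
have tL := tfM sV (tf_mul (tf_lap_rad N k tg) (tf_lap_rad N l th)).
have tG := tfM sW (tf_gcoef k l tg th).
have tW := tfM sW (tf_mul tg th).
have c1 := cc_rad (tf_ccr tL) cYZ.
have c2 := cc_rad (tf_ccr tG) cYZ.
have c3 := cc_rad (tf_ccr tW) (hpoly_continuous (hpoly_grad_dot hY hZ)).
rewrite intVD//; last by apply: ccZ; exact: ccD.
rewrite intVZ; last exact: ccD.
rewrite intVD// (intV_grad_dot_polar rho_tf rho1 N0 tW hY hZ HZ).
rewrite (intV_polar N0 hYZ (tf_ccr rho_tf) rho1 (tf_ccr tL)).
rewrite (intV_polar N0 hYZ (tf_ccr rho_tf) rho1 (tf_ccr tG)).
have [kl|kl] := eqVneq k l; last first.
  by rewrite (sphere_mean_orthogonal rho_tf rho1 N0 hY hZ HY HZ kl); ring.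
subst l; rewrite mul1r.
set p := (N + (k + k)).-1.
have pE : p = (N.-1 + (k + k))%N by rewrite /p -{1}(prednK N0) addSn.
have pR : p%:R = N%:R + k%:R + k%:R - 1 :> R.
  by rewrite pE !natrD -{2}(prednK N0) -natr1; ring.
pose S r := r ^+ p * (V r * (lap_rad N k g r * lap_rad N k h r)) +
  ((-1) * (r ^+ p * (W r * gcoef k k g h r)) +
   (- (k%:R * (p%:R - 1))) * (r ^+ p * (r^-1 ^+ 2 * (W r * (g r * h r))))).
have -> : qf (eigen k) (fun r => r ^+ k * g r) (fun r => r ^+ k * h r) = intR Rad S.
  apply: eq_intR => r Rr; have r0 := radii_neq0 Rr.
  rewrite /qf_density !modal_Xmul// !derive_Xmul// /S pR pE !exprD /gcoef /eigen.
  have -> : r ^+ 2 * (over_r g r * over_r h r) = derive1 g r * derive1 h r.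
    by rewrite /over_r; field.
  rewrite /over_r.
  move: (r ^+ k) (r ^+ N.-1) (r^-1) (N%:R : R) (k%:R : R) (g r) (derive1 g r)
    (h r) (derive1 h r) (lap_rad N k g r) (lap_rad N k h r) (V r) (W r).
  by clear; move=> *; ring.
have s1 := tf_ccr (tf_X p tL); have s2 := tf_ccr (tf_X p tG).
have s3 := tf_ccr (tf_X p (tf_invX 2 tW)).
rewrite /S intRD//; last by apply: ccrD; exact: ccrZ.
rewrite intRD//; [|exact: ccrZ..].
by rewrite !intRZ//; ring.
Qed.

Section finite_sum.
Variables (n : nat) (k : 'I_n -> nat) (g : 'I_n -> R -> R) (Y : 'I_n -> 'rV[R]_N -> R).
Hypothesis tg : forall a, tf Rad (g a).
Hypothesis hY : forall a, hpoly (k a) (Y a).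
Hypothesis HY : forall a, harmonic (Y a).
Let f x : R := \sum_(a < n) rad (g a) (Y a) x.

Lemma derive_sum_rad i x : 'd_i f x = \sum_(a < n) 'd_i (rad (g a) (Y a)) x.
Proof.
apply: (proj2 (derive_bigsum (delta_mx 0 i) _)) => a.
by have [] := rad_derive i (tf_c1r (tg a)) (hpoly_diff x (hY a)).
Qed.

Lemma laplacian_sum_rad x : laplacian f x = \sum_(a < n) laplacian (rad (g a) (Y a)) x.
Proof.
rewrite /laplacian exchange_big/=; apply: eq_bigr => i _.
have -> : 'd_i f = fun x => \sum_(a < n) 'd_i (rad (g a) (Y a)) x.
  by apply/funext => y; exact: derive_sum_rad.
apply: (proj2 (derive_bigsum (delta_mx 0 i) _)) => a.
have dY y : differentiable (Y a) y by exact: hpoly_diff (hY a).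
have ddY y : differentiable ('d_i (Y a)) y.
  exact: hpoly_diff (proj1 (hpoly_derive i (hY a))).
by have [] := derive2_rad x (tg a) dY ddY.
Qed.

Lemma Bform_sum_rad : cc (Bdens f f) /\
  Bform f f = \sum_(a < n) \sum_(b < n) Bform (rad (g a) (Y a)) (rad (g b) (Y b)).
Proof.
have E : Bdens f f = fun x => \sum_(a < n) \sum_(b < n) Bdens (rad (g a) (Y a)) (rad (g b) (Y b)) x.
  apply/funext => x; rewrite /Bdens laplacian_sum_rad big_distrlr/=.
  have -> : \sum_(i < N) 'd_i f x * 'd_i f x = \sum_(a < n) \sum_(b < n)
      \sum_(i < N) 'd_i (rad (g a) (Y a)) x * 'd_i (rad (g b) (Y b)) x.
    transitivity (\sum_(i < N) \sum_(a < n) \sum_(b < n)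
        'd_i (rad (g a) (Y a)) x * 'd_i (rad (g b) (Y b)) x).
      by apply: eq_bigr => i _; rewrite derive_sum_rad big_distrlr.
    by rewrite exchange_big/=; apply: eq_bigr => a _; rewrite exchange_big.
  rewrite !mulr_sumr -sumrB; apply: eq_bigr => a _.
  by rewrite !mulr_sumr -sumrB.
have cab a b : cc (Bdens (rad (g a) (Y a)) (rad (g b) (Y b))).
  exact: cc_Bdens_rad (tg a) (tg b) (hY a) (hY b) (HY a) (HY b).
have ca a : cc (fun x => \sum_(b < n) Bdens (rad (g a) (Y a)) (rad (g b) (Y b)) x).
  exact: cc_sum.
split; first by rewrite E; exact: cc_sum.
rewrite /Bform E intV_sum//; apply: eq_bigr => a _.
by rewrite intV_sum.
Qed.

Hypothesis rho_ge0 : forall r, 0 <= rho r.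
Hypothesis qf_nneg : forall K u, tf Rad u -> 0 <= qf (eigen K) u u.

(** By orthogonality only pairs of the same degree contribute.  The means of Y_a Y_b are
    integrals over x, so for each degree K the double sum over a, b is the integral of a
    nonnegative weight times the values of q at the functions sum_a Y_a(x) u_a. *)
Lemma Bform_sum_rad_ge0 : 0 <= Bform f f.
Proof.
have [_ ->] := Bform_sum_rad.
pose u a r := r ^+ k a * g a r.
have tu a : tf Rad (u a) by exact: tf_X (tg a).
(* An upper bound of all the degrees, so that the sum over K is finite. *)
pose m := (\sum_(a < n) k a).+1.
have km a : (k a < m)%N by rewrite ltnS (bigD1 a)//= leq_addr.
pose X K a b := (k a == K)%:R * (k b == K)%:R *
  (M (K + K) (fun x => Y a x * Y b x) * qf (eigen K) (u a) (u b)).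
have -> : \sum_(a < n) \sum_(b < n) Bform (rad (g a) (Y a)) (rad (g b) (Y b)) =
    \sum_(K < m) \sum_(a < n) \sum_(b < n) X K a b.
  symmetry; rewrite exchange_big/=; apply: eq_bigr => a _.
  rewrite exchange_big/=; apply: eq_bigr => b _.
  rewrite (Bform_rad (tg a) (tg b) (hY a) (hY b) (HY a) (HY b)).
  rewrite (bigD1 (Ordinal (km a)))//= big1 => [|K Kk].
    rewrite addr0 /X /u/= eqxx mul1r; have [<-//|_] := eqVneq (k a) (k b).
    by rewrite (_ : false%:R = 0 :> R)// !mul0r.
  have kK : (k a == K) = false.
    by apply: contra_neqF Kk => /eqP kK; apply/val_inj; rewrite /= kK.
  by rewrite /X kK (_ : false%:R = 0 :> R)// !mul0r.
apply: sumr_ge0 => K _.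
pose F r := r^-1 ^+ (N + (K + K)).-1 * rho r.
pose y x a : R := (k a == K)%:R * Y a x.
have cF : ccr Rad F by apply: ccr_invX; exact: tf_ccr.
have XE a b : X K a b = intV (rad F (fun x => qf (eigen K) (u a) (u b) * (y x a * y x b))).
  rewrite /X /y; have [ka|ka] := eqVneq (k a) K; last first.
    rewrite !mul0r (_ : rad _ _ = fun x => 0 * rad F (Y a) x).
      by rewrite intVZ ?mul0r//; exact: (cc_rad cF (hpoly_continuous (hY a))).
    by apply/funext => x; rewrite /rad !mul0r !mulr0.
  have [kb|kb] := eqVneq (k b) K; last first.
    rewrite mulr0 !mul0r (_ : rad _ _ = fun x => 0 * rad F (Y a) x).
      by rewrite intVZ ?mul0r//; exact: (cc_rad cF (hpoly_continuous (hY a))).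
    by apply/funext => x; rewrite /rad !mul0r !mulr0.
  rewrite !mul1r mulrC -intVZ -?radZr; last first.
    exact: (cc_rad cF (hpoly_continuous (hpolyM (hY a) (hY b)))).
  by congr (intV (rad _ _)); apply/funext => x; rewrite !mul1r.
have cX a b : cc (rad F (fun x => qf (eigen K) (u a) (u b) * (y x a * y x b))).
  apply: (cc_rad cF); apply: hpoly_continuous.
  exact: hpolyZ _ (hpolyM (hpolyZ _ (hY a)) (hpolyZ _ (hY b))).
have cXa a : cc (fun x => \sum_(b < n) rad F (fun x => qf (eigen K) (u a) (u b) * (y x a * y x b)) x).
  by apply: cc_sum => b; exact: cX.
have -> : \sum_(a < n) \sum_(b < n) X K a b =
  intV (fun x => \sum_(a < n) \sum_(b < n) rad F (fun x => qf (eigen K) (u a) (u b) * (y x a * y x b)) x).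
  rewrite intV_sum//; apply: eq_bigr => a _; rewrite intV_sum//.
  by apply: eq_bigr => b _; rewrite XE.
apply: intV_ge0 => x.
have -> : \sum_(a < n) \sum_(b < n) rad F (fun x => qf (eigen K) (u a) (u b) * (y x a * y x b)) x
   = F (enorm x) * qf (eigen K) (fun r => \sum_(a < n) y x a * u a r) (fun r => \sum_(a < n) y x a * u a r).
  rewrite (qf_sum N Rad_gt0 sV sW (eigen K) (y x) tu) mulr_sumr.
  apply: eq_bigr => a _; rewrite mulr_sumr; apply: eq_bigr => b _.
  by rewrite /rad; congr (_ * _); rewrite mulrC.
apply: mulr_ge0.
  by rewrite /F mulr_ge0// exprn_ge0// invr_ge0 enorm_ge0.
by apply: qf_nneg; apply: tf_sum => // a; exact: tfZ.
Qed.
End finite_sum.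

End rellich_form.

(** * The Fischer decomposition *)

Section fischer.
Context {R : realType}.
Variable N : nat.
Implicit Types (P Y Z f h : 'rV[R]_N -> R).

Definition sqn (x : 'rV[R]_N) : R := \sum_(i < N) x ord0 i ^+ 2.

Lemma hpoly_sqn : hpoly 2 sqn.
Proof.
apply: hpoly_sum => i; under eq_fun do rewrite expr2.
exact: hpolyX (hpoly_coord i).
Qed.

Lemma hpoly_sqnX j k h : hpoly k h -> hpoly (j.*2 + k) (fun x => sqn x ^+ j * h x).
Proof.
move=> hh; elim: j => [|j IH].
  by under eq_fun do rewrite expr0 mul1r.
under eq_fun do rewrite exprS -mulrA.
by have := hpolyM hpoly_sqn IH; rewrite addnA.
Qed.

Lemma derive_sqnX j k h i x : hpoly k h ->
  'd_i (fun x => sqn x ^+ j * h x) x =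
  2 * j%:R * (sqn x ^+ j.-1 * (x ord0 i * h x)) + sqn x ^+ j * 'd_i h x.
Proof.
move=> hh; elim: j => [|j IH].
  under eq_fun do rewrite expr0 mul1r.
  by rewrite mulr0 mul0r add0r mul1r.
under eq_fun do rewrite exprS -mulrA.
rewrite (derive_hpolyM _ _ hpoly_sqn (hpoly_sqnX j hh)) IH.
have [_ ->] : differentiable sqn x /\ 'd_i sqn x = 2 * x ord0 i := derive_sqr_enorm x i.
by case: j {IH} => [|j] /=; rewrite ?exprS -?natr1 ?expr0; ring.
Qed.

Lemma laplacianD P Z x : (forall y, differentiable P y) -> (forall y, differentiable Z y) ->
  (forall i y, differentiable ('d_i P) y) -> (forall i y, differentiable ('d_i Z) y) ->
  laplacian (fun x => P x + Z x) x = laplacian P x + laplacian Z x.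
Proof.
move=> dP dZ ddP ddZ; rewrite /laplacian -big_split; apply: eq_bigr => i _ /=.
have -> : 'd_i (fun x => P x + Z x) = fun x => 'd_i P x + 'd_i Z x.
  by apply/funext => y; rewrite deriveD//; exact: diff_derivable.
by rewrite deriveD//; exact: diff_derivable.
Qed.

Lemma laplacianZ a P x : (forall y, differentiable P y) ->
  (forall i y, differentiable ('d_i P) y) ->
  laplacian (fun x => a * P x) x = a * laplacian P x.
Proof.
move=> dP ddP; rewrite /laplacian mulr_sumr; apply: eq_bigr => i _ /=.
have -> : 'd_i (fun x => a * P x) = fun x => a * 'd_i P x.
  by apply/funext => y; apply: (@deriveZ _ _ _ P); exact: diff_derivable.
by apply: (@deriveZ _ _ _ ('d_i P)); exact: diff_derivable.
Qed.

Lemma hpoly_diff2 d P i x : hpoly d P -> differentiable ('d_i P) x.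
Proof. by move=> hP; exact: hpoly_diff (proj1 (hpoly_derive i hP)). Qed.

Lemma laplacian_hpolyD d e P Z x : hpoly d P -> hpoly e Z ->
  laplacian (fun x => P x + Z x) x = laplacian P x + laplacian Z x.
Proof.
move=> hP hZ; apply: laplacianD => *.
- exact: hpoly_diff hP.
- exact: hpoly_diff hZ.
- exact: hpoly_diff2 hP.
- exact: hpoly_diff2 hZ.
Qed.

Lemma laplacian_hpolyZ a d P x : hpoly d P ->
  laplacian (fun x => a * P x) x = a * laplacian P x.
Proof.
move=> hP; apply: laplacianZ => *; first exact: hpoly_diff hP.
exact: hpoly_diff2 hP.
Qed.

Lemma hpoly_laplacian d P : hpoly d.+2 P -> hpoly d (laplacian P).
Proof.
move=> hP; apply: hpoly_sum => i.
exact: (proj1 (hpoly_derive i (proj1 (hpoly_derive i hP)))).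
Qed.

(** The factor is positive for N > 0, so that the Laplacian can be inverted on such
    products. *)
Lemma laplacian_sqnX j k h x : hpoly k h -> harmonic h ->
  laplacian (fun x => sqn x ^+ j.+1 * h x) x =
  (2 * j.+1%:R * (2 * j%:R + 2 * k%:R + N%:R)) * (sqn x ^+ j * h x).
Proof.
move=> hh Hh.
have E i : 'd_i ('d_i (fun x => sqn x ^+ j.+1 * h x)) x =
   (2 * j.+1%:R * (2 * j%:R) * (sqn x ^+ j.-1 * h x)) * (x ord0 i ^+ 2) +
   ((2 * j.+1%:R) * sqn x ^+ j * h x +
   (2 * j.+1%:R * 2 * sqn x ^+ j) * (x ord0 i * 'd_i h x)) + sqn x ^+ j.+1 * 'd_i ('d_i h) x.
  have hih := hpolyX i hh; have hdh := proj1 (hpoly_derive i hh).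
  have -> : 'd_i (fun x => sqn x ^+ j.+1 * h x) = fun x =>
      (2 * j.+1%:R) * (sqn x ^+ j * (x ord0 i * h x)) + sqn x ^+ j.+1 * 'd_i h x.
    by apply/funext => y; rewrite (derive_sqnX _ _ _ hh).
  have h1 := hpolyZ (2 * j.+1%:R) (hpoly_sqnX j hih).
  have h2 := hpoly_sqnX j.+1 hdh.
  rewrite deriveD; [|exact: diff_derivable (hpoly_diff x h1)|exact: diff_derivable (hpoly_diff x h2)].
  rewrite (@deriveZ _ _ _ (fun y => sqn y ^+ j * (y ord0 i * h y))); last first.
    exact: diff_derivable (hpoly_diff x (hpoly_sqnX j hih)).
  rewrite (derive_sqnX _ _ _ hih) (derive_sqnX _ _ _ hdh).
  rewrite (derive_coordM _ _ (hpoly_diff x hh)) eqxx (_ : true%:R = 1 :> R)// /GRing.scale/=.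
  ring.
rewrite /laplacian; under eq_bigr do rewrite E.
rewrite !big_split/= -!mulr_sumr -/(sqn x) (hpoly_euler x hh) -/(laplacian h x) Hh.
rewrite mulr0 addr0 sumr_const card_ord -mulr_natl.
by case: j E => [|j] _ /=; rewrite ?exprS; ring.
Qed.

(** Sums of products |x|^(2j) h with h harmonic and total degree d. *)
Inductive fisch : nat -> ('rV[R]_N -> R) -> Prop :=
| fisch0 d : fisch d (fun _ => 0)
| fisch_add d j k h f : (j.*2 + k)%N = d -> hpoly k h -> harmonic h -> fisch d f ->
    fisch d (fun x => sqn x ^+ j * h x + f x).

Lemma fisch_hpoly d f : fisch d f -> hpoly d f.
Proof.
elim=> [{}d|{}d j k h {}f jk hh _ _ IH]; first exact: hpoly0.
by apply: hpolyD => //; rewrite -jk; exact: hpoly_sqnX.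
Qed.

Lemma fisch_sqn d f : fisch d f -> fisch d.+2 (fun x => sqn x * f x).
Proof.
elim=> [{}d|{}d j k h {}f jk hh Hh _ IH].
  by under eq_fun do rewrite mulr0; exact: fisch0.
under eq_fun do rewrite mulrDr mulrA -exprS.
by apply: (@fisch_add _ j.+1 k) => //; rewrite doubleS -jk.
Qed.

(** On a product |x|^(2j) h the Laplacian of |x|^2 q is solved by a multiple of the same
    product, by [laplacian_sqnX]. *)
Lemma fisch_laplacian_surj d f : (0 < N)%N -> fisch d f ->
  exists2 q, fisch d q & forall x, laplacian (fun x => sqn x * q x) x = f x.
Proof.
move=> N0; elim=> [{}d|{}d j k h {}f jk hh Hh _ [q fq qf]].
  exists (fun _ => 0); first exact: fisch0.
  move=> x; under [X in laplacian X]eq_fun do rewrite mulr0.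
  by rewrite /laplacian big1// => i _; rewrite (_ : 'd_i _ = cst 0) ?derive_cst//; apply/funext => y; rewrite derive_cst.
pose a : R := (2 * j.+1%:R * (2 * j%:R + 2 * k%:R + N%:R))^-1.
have hah := hpolyZ a hh.
exists (fun x => sqn x ^+ j * (a * h x) + q x).
  by apply: (fisch_add jk hah _ fq) => x; rewrite (laplacian_hpolyZ _ _ hh) Hh mulr0.
move=> x.
have -> : (fun x => sqn x * (sqn x ^+ j * (a * h x) + q x)) =
    fun x => a * (sqn x ^+ j.+1 * h x) + sqn x * q x.
  by apply/funext => y; rewrite exprS; ring.
rewrite (@laplacian_hpolyD (j.+1.*2 + k) d.+2); last first.
- exact: fisch_hpoly (fisch_sqn fq).
- exact: hpolyZ (hpoly_sqnX _ hh).
rewrite (laplacian_hpolyZ _ _ (hpoly_sqnX _ hh)) (laplacian_sqnX _ _ hh Hh) qf mulrA mulVf ?mul1r//.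
apply: lt0r_neq0; rewrite mulr_gt0//.
by rewrite ltr_wpDl ?ltr0n// addr_ge0// mulr_ge0.
Qed.

(** Induction on the degree: the Laplacian of f is decomposed by induction, hence is
    the Laplacian of |x|^2 q for a decomposed q, and f - |x|^2 q is harmonic. *)
Lemma fisch_of_hpoly d f : (0 < N)%N -> hpoly d f -> fisch d f.
Proof.
move=> N0; elim/ltn_ind: d f => d IH f hf.
have [q fq Hq] : exists2 q, fisch d q & (hpoly d q /\ harmonic (fun x => f x + (-1) * q x)).
  case: d IH hf => [|[|d]] IH hf.
  - exists (fun _ => 0); first exact: fisch0.
    split=> [|x]; first exact: hpoly0.
    under [X in laplacian X]eq_fun do rewrite mulr0 addr0.
    rewrite /laplacian big1// => i _; rewrite (_ : 'd_i f = cst 0) ?derive_cst//.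
    by apply/funext => y; rewrite (proj2 (hpoly_derive i hf)).
  - exists (fun _ => 0); first exact: fisch0.
    split=> [|x]; first exact: hpoly0.
    under [X in laplacian X]eq_fun do rewrite mulr0 addr0.
    rewrite /laplacian big1// => i _.
    by rewrite (proj2 (hpoly_derive i (proj1 (hpoly_derive i hf)))).
  have [q fq qf] := fisch_laplacian_surj N0 (IH d (leqnSn _) _ (hpoly_laplacian hf)).
  exists (fun x => sqn x * q x); first exact: fisch_sqn.
  split=> [|x]; first exact: fisch_hpoly (fisch_sqn fq).
  have hq := fisch_hpoly (fisch_sqn fq).
  by rewrite (laplacian_hpolyD _ hf (hpolyZ (-1) hq)) (laplacian_hpolyZ _ _ hq) qf mulN1r subrr.
case: Hq => hq Hq.
have -> : f = fun x => sqn x ^+ 0 * (f x + (-1) * q x) + q x.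
  by apply/funext => x; rewrite expr0; ring.
by apply: (@fisch_add d 0 d) => //; apply: hpolyD => //; exact: hpolyZ.
Qed.

End fischer.

(** * Approximate identities from powers of 1 - c|z|^2 *)

Section positive_power.
Context {R : realType}.

(** The positive part of t^m; of class C^1 for m >= 2, hence suitable for partial
    integration. *)
Definition ppow (m : nat) (t : R) : R := if 0 < t then t ^+ m else 0.

Lemma ppow_ge0 m t : 0 <= ppow m t.
Proof. by rewrite /ppow; case: ifPn => // /ltW t0; rewrite exprn_ge0. Qed.

Lemma ppow_derive m (t : R) : is_derive t 1 (ppow m.+2) (m.+2%:R * ppow m.+1 t).
Proof.
have -> : m.+2%:R * ppow m.+1 t = if 0 < t then m.+2%:R * t ^+ m.+1 else 0.
  by rewrite /ppow; case: ifP => // _; rewrite mulr0.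
apply: (@is_derive_pos_part _ (fun y => y ^+ m.+2) (fun y => m.+2%:R * y ^+ m.+1) 1) => y y0.
  have := is_deriveX m.+2 (is_derive_id y 1).
  by rewrite exprfctE /GRing.scale/= mulr1.
move: y0 => /andP[/ltW y0 y1]; rewrite mul1r ger0_norm ?exprn_ge0//.
by rewrite -addn2 exprD ler_piMl ?sqr_ge0// exprn_ile1.
Qed.

Lemma ppow_continuous m : continuous (ppow m.+2).
Proof.
by apply: derivable1_continuous => t; have [] := ppow_derive m t.
Qed.

End positive_power.

Section kernel.
Context {R : realType}.
Variables (N : nat) (c : R).
Hypothesis N0 : (0 < N)%N.
Hypothesis c0 : 0 < c.
Implicit Types (x z : 'rV[R]_N) (f : 'rV[R]_N -> R).

Lemma sqn_ge0 z : 0 <= sqn z.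
Proof. exact: sum_sqr_ge0. Qed.

Lemma norm_sqr_le_sqn z : `|z| ^+ 2 <= sqn z.
Proof. by rewrite /sqn -enorm_sqr lerXn2r ?nnegrE ?enorm_ge0// norm_le_enorm. Qed.

Lemma sqnD_le x z : sqn (x - z) <= 2 * sqn x + 2 * sqn z.
Proof.
rewrite /sqn !mulr_sumr -big_split/=; apply: ler_sum => i _; rewrite sub_coord.
have := sqr_ge0 (x ord0 i + z ord0 i).
by move: (x _ _) (z _ _) => s t; nra.
Qed.

(** Uniform continuity handles small z; for the others |z| is bounded below and the
    bound of |f| is absorbed by A |z|^2.  The quadratic form of the error matches the
    second moment of the kernels. *)
Lemma uniform_modulus f e : cc f -> 0 < e ->
  exists2 A : R, 0 <= A & forall x z, `|f (x - z) - f x| <= e + A * sqn z.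
Proof.
move=> ccf e0; have [cf [M fM]] := ccf; have [C C0 fC] := ccn_bounded ccf.
pose K := [set x : 'rV[R]_N | `|x| <= M + 1].
have /compact_near_coveringP cK : compact K by exact: compact_ball_rV.
have H : \forall z \near (0 : 'rV[R]_N), K `<=` (fun x => `|f (x - z) - f x| < e).
  apply: (cK _ (nbhs (0 : 'rV[R]_N)) (fun z x => `|f (x - z) - f x| < e)) => x _.
  have e2 : 0 < e / 2 by rewrite divr_gt0.
  have H1 : \forall x' \near x & z \near (0 : 'rV[R]_N), `|f x - f (x' - z)| < e / 2.
    have h : (fun p : 'rV[R]_N * 'rV[R]_N => f (p.1 - p.2)) @ (x, (0 : 'rV[R]_N)) --> f x.
      apply: (@cvg_comp _ _ _ (fun p : 'rV[R]_N * 'rV[R]_N => p.1 - p.2) f _ (nbhs (x - 0))).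
        exact: (@sub_continuous 'rV[R]_N (x, 0)).
      by rewrite subr0; exact: cf.
    by have /cvgrPdist_lt/(_ _ e2) := h.
  have H2 : \forall x' \near x & z \near (0 : 'rV[R]_N), `|f x - f x'| < e / 2.
    have /cvgrPdist_lt/(_ _ e2) h := cf x.
    by exists ([set x' | `|f x - f x'| < e / 2], setT) => /=; [split => //; exact: filterT|case=> x' z []].
  apply: filterS2 H1 H2 => -[x' z] /= h1 h2.
  rewrite (_ : _ - _ = (f x - f x') - (f x - f (x' - z))); last by ring.
  by rewrite (le_lt_trans (ler_normB _ _))// (splitr e) ltrD.
have [d d0 hd] : exists2 d : R, 0 < d & forall z, `|z| < d -> forall x, `|x| <= M + 1 -> `|f (x - z) - f x| < e.
  move: H => /nbhs_ballP[d /= d0 hd]; exists d => // z zd x xK.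
  by apply: (hd z) => //; rewrite -ball_normE/= sub0r normrN.
(* With |z| < 1, a point x beyond M + 1 has both f x and f (x - z) equal to 0. *)
pose d' := Num.min d 1.
have d'0 : 0 < d' by rewrite lt_min d0 ltr01.
have A0 : 0 <= 2 * C / d' ^+ 2 by apply: divr_ge0; [exact: mulr_ge0|exact: sqr_ge0].
exists (2 * C / d' ^+ 2) => //.
move=> x z; have [zd|zd] := ltP `|z| d'.
  apply: (@le_trans _ _ e); last first.
    by rewrite lerDl; apply: mulr_ge0 => //; exact: sqn_ge0.
  move: zd; rewrite lt_min => /andP[zd z1].
  have [xM|xM] := leP `|x| (M + 1); first by apply/ltW/hd.
  rewrite !fM ?subrr ?normr0 ?ltW//; first by lra.
  by have := lerB_dist x z; move: xM z1; lra.
apply: (@le_trans _ _ (2 * C)).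
  by apply: le_trans (ler_normB _ _) _; have := fC x; have := fC (x - z); lra.
apply: (@le_trans _ _ (2 * C / d' ^+ 2 * sqn z)); last by rewrite lerDr ltW.
rewrite -mulrA ler_peMr ?mulr_ge0// mulrC ler_pdivlMr ?exprn_gt0// mul1r.
apply: le_trans (norm_sqr_le_sqn z); rewrite lerXn2r ?nnegrE ?normr_ge0//; exact: ltW.
Unshelve. all: by end_near. Qed.

(** Not normalised: its mass is only compared with its second moment. *)
Definition kern n z : R := ppow n (1 - c * sqn z).

Lemma continuous_sqn : continuous (@sqn R N).
Proof. exact: (hpoly_continuous (@hpoly_sqn R N)). Qed.

Lemma differentiable_1Msqn z : differentiable (fun z => 1 - c * sqn z) z.
Proof.
apply: differentiableB; first exact: differentiable_cst.
apply: differentiableM; first exact: differentiable_cst.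
exact: hpoly_diff z (@hpoly_sqn R N).
Qed.

Lemma cc_kern m : cc (kern m.+2).
Proof.
split.
  move=> x; apply: (@continuous_comp _ _ _ (fun z => 1 - c * sqn z) (ppow m.+2)).
    exact: differentiable_continuous (differentiable_1Msqn x).
  exact: ppow_continuous.
(* Outside of the ball |z|^2 <= 1/c the truncated power vanishes, and (1/c + 1)^2 > 1/c. *)
exists (c^-1 + 1) => z zM; rewrite /kern /ppow ifF//; apply/negbTE; rewrite -leNgt subr_le0.
rewrite mulrC -ler_pdivrMr// mul1r.
have ci : 0 < c^-1 by rewrite invr_gt0.
apply: le_trans (norm_sqr_le_sqn z).
move: zM; move: `|z| (c^-1) ci => s t; rewrite expr2; nra.
Qed.

Lemma kern_ge0 m z : 0 <= kern m z. Proof. exact: ppow_ge0. Qed.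

Lemma kernS_le m z : kern m.+1 z <= kern m z.
Proof.
rewrite /kern /ppow; case: ifPn => // h; rewrite exprS ler_piMl//; first by rewrite exprn_ge0// ltW.
by rewrite gerBl mulr_ge0 ?sqn_ge0// ltW.
Qed.

Lemma kern_mass_gt0 m : 0 < intV (kern m.+2).
Proof.
apply: (@intV_gt0 _ _ _ 0); [exact: cc_kern|exact: kern_ge0|].
rewrite /kern /sqn big1 ?mulr0 ?subr0; last by move=> i _; rewrite mxE expr0n.
by rewrite /ppow ltr01 expr1n.
Qed.

Lemma kern_derive m z i :
  differentiable (kern m.+2) z /\
  'd_i (kern m.+2) z = - (2 * c * m.+2%:R) * (z ord0 i * kern m.+1 z).
Proof.
have hq := hpoly_diff z (@hpoly_sqn R N).
have dg := differentiable_1Msqn z.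
have [h D] := ppow_derive m (1 - c * sqn z).
have [d1 ->] := chain_derive (delta_mx 0 i) dg h; split => //.
rewrite derive1E D.
have -> : 'd_i (fun z => 1 - c * sqn z) z = - (c * (2 * z ord0 i)).
  have [_ <-] : differentiable (@sqn R N) z /\ 'd_i (@sqn R N) z = 2 * z ord0 i := derive_sqr_enorm z i.
  rewrite (@deriveB _ _ _ (cst (1 : R)) (fun z : 'rV[R]_N => c * sqn z)); [|exact: derivable_cst|]; last first.
    by apply: derivableM; [exact: derivable_cst|exact: diff_derivable].
  by rewrite derive_cst sub0r (@deriveZ _ _ _ (@sqn R N)); last exact: diff_derivable.
by rewrite /kern; ring.
Qed.

(** The integral of div(z k(z)^(n+1)) vanishes, where k(z) = 1 - c|z|^2 is cut at 0.
    This bounds the second moment by O(1/n) times the mass without computing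
    either. *)
Lemma kern_moment m :
  intV (fun z => sqn z * kern m.+2 z) <= N%:R / (2 * c * m.+3%:R) * intV (kern m.+2).
Proof.
have ck2 := cc_kern m; have ck3 := cc_kern m.+1.
have E i z : 'd_i (fun z => z ord0 i * kern m.+3 z) z =
    kern m.+3 z + (- (2 * c * m.+3%:R)) * (z ord0 i ^+ 2 * kern m.+2 z).
  have [dk kE] := kern_derive m.+1 z i.
  by rewrite (derive_coordM _ _ dk) eqxx (_ : true%:R = 1 :> R)// kE; ring.
have ccs i : cc (fun z => z ord0 i ^+ 2 * kern m.+2 z).
  apply: ccMl => //; under eq_fun do rewrite expr2.
  exact: hpoly_continuous (hpolyX i (hpoly_coord i)).
have I0 i : intV (kern m.+3) + (- (2 * c * m.+3%:R)) * intV (fun z => z ord0 i ^+ 2 * kern m.+2 z) = 0.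
  rewrite -intVZ// -intVD//; last exact: ccZ.
  have FE : 'd_i (fun z => z ord0 i * kern m.+3 z) =
      fun z => kern m.+3 z + (- (2 * c * m.+3%:R)) * (z ord0 i ^+ 2 * kern m.+2 z).
    by apply/funext => z; exact: E.
  rewrite -FE; apply: intV_derive.
  - by apply: ccMl => //; exact: coord_continuous.
  - move=> z; apply: diff_derivable; apply: differentiableM; first exact: differentiable_coord.
    by have [] := kern_derive m.+1 z i.
  - by rewrite FE; apply: (proj1 (ccD _ _)) => //; exact: ccZ.
have : \sum_(i < N) (intV (kern m.+3) + (- (2 * c * m.+3%:R)) * intV (fun z => z ord0 i ^+ 2 * kern m.+2 z)) = 0.
  by rewrite big1.
rewrite big_split/= sumr_const card_ord -mulr_sumr -intV_sum// -[intV (kern m.+3) *+ N]mulr_natl.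
have -> : (fun z => \sum_(i < N) z ord0 i ^+ 2 * kern m.+2 z) = fun z => sqn z * kern m.+2 z.
  by apply/funext => z; rewrite -mulr_suml.
rewrite mulNr => /eqP; rewrite subr_eq0 => /eqP E2.
have cm : 0 < 2 * c * m.+3%:R by rewrite !mulr_gt0.
rewrite mulrAC ler_pdivlMr// mulrC -E2 ler_wpM2l//.
by apply: le_intV => // z; exact: kernS_le.
Qed.

(** By [uniform_modulus] the error is at most e/2 times the mass plus A times the
    second moment, which is small compared with the mass by [kern_moment]. *)
Lemma kern_approx f e : cc f -> 0 < e -> exists m0, forall m, (m0 <= m)%N -> forall x,
  `|intV (fun z => f (x - z) * kern m.+2 z) - intV (kern m.+2) * f x| <= e * intV (kern m.+2).
Proof.
move=> ccf e0; have e2 : 0 < e / 2 by rewrite divr_gt0.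
have [A A0 HA] := uniform_modulus ccf e2.
(* The bound A N/(2c(m+3)) of the error term is at most e/2 as soon as m >= B. *)
pose B := A * N%:R / (c * e).
exists (Num.truncn B).+1 => m mB x.
have ck := cc_kern m.
have kp := kern_mass_gt0 m.
have cfx : continuous (fun z => f (x - z)) by have [] := cc_reflect x ccf.
have c1 : cc (fun z => f (x - z) * kern m.+2 z) by exact: ccMl.
have c2 : cc (fun z => f x * kern m.+2 z) by exact: ccZ.
rewrite mulrC -intVZ// -intVB//.
have c3 : cc (fun z => f (x - z) * kern m.+2 z - f x * kern m.+2 z).
  by have := ccD c1 (ccZ (-1) c2); under eq_fun do rewrite mulN1r.
have c4 : cc (fun z => sqn z * kern m.+2 z) by apply: ccMl => //; exact: continuous_sqn.
apply: le_trans (ler_norm_intV c3) _.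
apply: (@le_trans _ _ (intV (fun z => e / 2 * kern m.+2 z + A * (sqn z * kern m.+2 z)))).
  apply: le_intV; [exact: cc_norm|by apply: ccD; exact: ccZ|move=> z].
  rewrite -mulrBl normrM (ger0_norm (kern_ge0 _ _)) mulrA -mulrDl.
  by apply: ler_wpM2r; [exact: kern_ge0|exact: HA].
rewrite intVD; [|exact: ccZ..]; rewrite !intVZ//.
rewrite [X in _ <= X * _](splitr e) mulrDl lerD2l.
apply: le_trans (ler_wpM2l A0 (kern_moment m)) _.
rewrite mulrA; apply: ler_wpM2r; first exact: ltW.
have Bm : B <= m.+3%:R.
  apply: ltW; apply: lt_le_trans (truncnS_gt B) _.
  by rewrite ler_nat; apply: leq_trans mB _; rewrite -addn3 leq_addr.
have ce : 0 < c * e by rewrite mulr_gt0.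
move: Bm; rewrite /B ler_pdivrMr// => Bm.
rewrite mulrA ler_pdivrMr ?mulr_gt0//.
by move: Bm; move: (m.+3%:R : R) (N%:R : R) => s t; lra.
Qed.

End kernel.

(** * Approximation by polynomials in the C^2 norm *)

Section polynomials.
Context {R : realType}.
Variable N : nat.
Implicit Types f g m p q : 'rV[R]_N -> R.

(** Polynomials as sums of homogeneous ones, the form in which they are
    decomposed. *)
Inductive polyn : ('rV[R]_N -> R) -> Prop :=
| polyn0 : polyn (fun _ => 0)
| polyn_add d m f : hpoly d m -> polyn f -> polyn (fun x => m x + f x).

Lemma polyn_hpoly d m : hpoly d m -> polyn m.
Proof. by move=> hm; have := polyn_add hm polyn0; under eq_fun do rewrite addr0. Qed.

Lemma polynD f g : polyn f -> polyn g -> polyn (fun x => f x + g x).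
Proof.
move=> pf pg; elim: pf => [|d m {}f hm _ IH]; first by under eq_fun do rewrite add0r.
by under eq_fun do rewrite -addrA; exact: polyn_add hm IH.
Qed.

Lemma polyn_hpolyM d m f : hpoly d m -> polyn f -> polyn (fun x => m x * f x).
Proof.
move=> hm; elim=> [|e l {}f hl _ IH]; first by under eq_fun do rewrite mulr0; exact: polyn0.
by under eq_fun do rewrite mulrDr; exact: polyn_add (hpolyM hm hl) IH.
Qed.

Lemma polynM f g : polyn f -> polyn g -> polyn (fun x => f x * g x).
Proof.
move=> pf pg; elim: pf => [|d m {}f hm _ IH]; first by under eq_fun do rewrite mul0r; exact: polyn0.
by under eq_fun do rewrite mulrDl; apply: polynD => //; exact: polyn_hpolyM hm pg.
Qed.

Lemma polynZ a f : polyn f -> polyn (fun x => a * f x).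
Proof. exact: polyn_hpolyM (hpolyC a). Qed.

Lemma polynX f n : polyn f -> polyn (fun x => f x ^+ n).
Proof.
move=> pf; elim: n => [|n IH].
  by under eq_fun do rewrite expr0; exact: polyn_hpoly (hpolyC 1).
by under eq_fun do rewrite exprS; exact: polynM.
Qed.

Lemma polyn_diff f x : polyn f -> differentiable f x.
Proof.
elim=> [|d m {}f hm _ IH]; first exact: differentiable_cst.
by apply: differentiableD => //; exact: hpoly_diff hm.
Qed.

Lemma polyn_continuous f : polyn f -> continuous f.
Proof. by move=> pf x; apply: differentiable_continuous; exact: polyn_diff. Qed.

Lemma polyn_derive f i : polyn f -> polyn ('d_i f).
Proof.
elim=> [|d m {}f hm pf IH].
  rewrite (_ : 'd_i _ = fun _ => 0); first exact: polyn0.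
  by apply/funext => x; rewrite derive_cst.
rewrite (_ : 'd_i _ = fun x => 'd_i m x + 'd_i f x).
  exact: polyn_add (proj1 (hpoly_derive i hm)) IH.
apply/funext => x; rewrite deriveD//; apply: diff_derivable; first exact: hpoly_diff hm.
exact: polyn_diff.
Qed.

Definition conv p f x : R := intV (fun z => f z * p (x - z)).

Lemma continuous_subr p x : continuous p -> continuous (fun z : 'rV[R]_N => p (x - z)).
Proof.
move=> cp z; apply: (@continuous_comp _ _ _ (fun z : 'rV[R]_N => x - z) p); last exact: cp.
by apply: differentiable_continuous; apply: differentiableB; [exact: differentiable_cst|exact: ex_diff].
Qed.

Lemma cc_conv p f x : cc f -> continuous p -> cc (fun z : 'rV[R]_N => f z * p (x - z)).
Proof. by move=> cf cp; apply: ccMr => //; exact: continuous_subr. Qed.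

Lemma convD p q f : cc f -> continuous p -> continuous q ->
  conv (fun x => p x + q x) f = fun x => conv p f x + conv q f x.
Proof.
move=> cf cp cq; apply/funext => x; rewrite /conv -intVD; [|exact: cc_conv..].
by congr intV; apply/funext => z; rewrite mulrDr.
Qed.

Lemma convZ a p f : cc f -> continuous p -> conv (fun x => a * p x) f = fun x => a * conv p f x.
Proof.
move=> cf cp; apply/funext => x; rewrite /conv -intVZ; last exact: cc_conv.
by congr intV; apply/funext => z; rewrite mulrCA.
Qed.

Lemma conv0 f : conv (fun _ => 0) f = fun _ => 0.
Proof.
by apply/funext => x; rewrite /conv; under eq_fun do rewrite mulr0; rewrite /intV Rintegral_cst ?mul0r.
Qed.

(** The factor is (x - z)_j = x_j - z_j, so the second term is the same convolution for
    another function of compact support.  This is the step of the induction below. *)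
Lemma conv_coordM j p f : cc f -> continuous p -> conv (fun x => x ord0 j * p x) f =
  fun x => x ord0 j * conv p f x + (-1) * conv p (fun z => z ord0 j * f z) x.
Proof.
move=> cf cp; apply/funext => x; rewrite /conv.
have cjf : cc (fun z : 'rV[R]_N => z ord0 j * f z) by apply: ccMl => //; exact: coord_continuous.
rewrite -!intVZ -?intVD; try (try apply: ccZ; exact: cc_conv).
by congr intV; apply/funext => z; rewrite sub_coord; ring.
Qed.

(** Induction on [p] for all [f] at once, since [conv_coordM] changes [f]. *)
Lemma conv_hpoly d p f : hpoly d p -> cc f ->
  polyn (conv p f) /\ forall i, 'd_i (conv p f) = conv ('d_i p) f.
Proof.
move=> hp; elim: hp f => [c|{}d j {}p hp IH|{}d|{}d p' q hp IHp hq IHq] f cf.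
- have -> : conv (fun _ => c) f = fun _ => intV (fun z => f z * c) by [].
  split=> [|i]; first exact: polyn_hpoly (hpolyC _).
  have dcst a : 'd_i (fun _ : 'rV[R]_N => a : R) = fun _ => 0.
    by apply/funext => x; rewrite derive_cst.
  by rewrite !dcst conv0.
- have cp := hpoly_continuous hp; have dp x := hpoly_diff x hp.
  have cjf : cc (fun z : 'rV[R]_N => z ord0 j * f z) by apply: ccMl => //; exact: coord_continuous.
  have [pA dA] := IH f cf; have [pB dB] := IH _ cjf.
  rewrite (conv_coordM j cf cp); split=> [|i].
    by apply: polynD; [exact: polyn_hpolyM (hpoly_coord j) pA|exact: polynZ].
  have -> : 'd_i (fun x : 'rV[R]_N => x ord0 j * p x) = fun x => (i == j)%:R * p x + x ord0 j * 'd_i p x.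
    by apply/funext => x; rewrite derive_coordM.
  have cdp := hpoly_continuous (proj1 (hpoly_derive i hp)).
  rewrite (convD cf (hpoly_continuous (hpolyZ _ hp)) (hpoly_continuous (hpolyX j (proj1 (hpoly_derive i hp))))).
  rewrite (convZ _ cf cp) (conv_coordM j cf cdp); apply/funext => x.
  have dAx : 'd_i (conv p f) x = _ := congr1 (@^~ x) (dA i).
  have dBx : 'd_i (conv p (fun z => z ord0 j * f z)) x = _ := congr1 (@^~ x) (dB i).
  rewrite deriveD; [|apply: diff_derivable..]; last 2 first.
  - exact: polyn_diff (polyn_hpolyM (hpoly_coord j) pA).
  - exact: polyn_diff (polynZ (-1) pB).
  rewrite derive_coordM; last exact: polyn_diff.
  rewrite (@deriveZ _ _ _ (conv p (fun z => z ord0 j * f z))); last exact: diff_derivable (polyn_diff x pB).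
  by rewrite dAx dBx /GRing.scale/= addrA.
- rewrite conv0; split=> [|i]; first exact: polyn0.
  by rewrite (_ : 'd_i _ = fun _ => 0) ?conv0//; apply/funext => x; rewrite derive_cst.
have cp := hpoly_continuous hp; have cq := hpoly_continuous hq.
have [pA dA] := IHp f cf; have [pB dB] := IHq f cf.
rewrite (convD cf cp cq); split=> [|i]; first exact: polynD.
rewrite (_ : 'd_i (fun x => p' x + q x) = fun x => 'd_i p' x + 'd_i q x); last first.
  by apply/funext => x; rewrite deriveD//; apply: diff_derivable; [exact: hpoly_diff hp|exact: hpoly_diff hq].
rewrite (convD cf (hpoly_continuous (proj1 (hpoly_derive i hp))) (hpoly_continuous (proj1 (hpoly_derive i hq)))).
apply/funext => x; rewrite deriveD; [|exact: diff_derivable (polyn_diff x pA)|exact: diff_derivable (polyn_diff x pB)].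
by rewrite -(dA i) -(dB i).
Qed.

Lemma conv_polyn p f : polyn p -> cc f ->
  polyn (conv p f) /\ forall i, 'd_i (conv p f) = conv ('d_i p) f.
Proof.
move=> pp cf; elim: pp => [|d m {}p hm pp [pB dB]].
  rewrite conv0; split=> [|i]; first exact: polyn0.
  by rewrite (_ : 'd_i _ = fun _ => 0) ?conv0//; apply/funext => x; rewrite derive_cst.
have cm := hpoly_continuous hm; have cp := polyn_continuous pp.
have [pA dA] := conv_hpoly hm cf.
rewrite (convD cf cm cp); split=> [|i]; first exact: polynD.
rewrite (_ : 'd_i (fun x => m x + p x) = fun x => 'd_i m x + 'd_i p x); last first.
  by apply/funext => x; rewrite deriveD//; apply: diff_derivable; [exact: hpoly_diff hm|exact: polyn_diff].
rewrite (convD cf (hpoly_continuous (proj1 (hpoly_derive i hm))) (polyn_continuous (polyn_derive i pp))).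
apply/funext => x; rewrite deriveD; [|exact: diff_derivable (polyn_diff x pA)|exact: diff_derivable (polyn_diff x pB)].
by rewrite -(dA i) -(dB i).
Qed.

(** The derivative falls on [p] by [conv_polyn], and z |-> p (x - z) has the opposite
    derivative in z, so partial integration moves it to [f]. *)
Lemma derive_conv p f i : polyn p -> cc f -> (forall x, differentiable f x) ->
  cc ('d_i f) -> 'd_i (conv p f) = conv p ('d_i f).
Proof.
move=> pp cf df cdf; rewrite (proj2 (conv_polyn pp cf)); apply/funext => x.
have pdp := polyn_derive i pp.
have E2 z : differentiable (fun z => p (x - z)) z /\
    'd_i (fun z => p (x - z)) z = - 'd_i p (x - z).
  split.
    apply: differentiable_comp; last exact: polyn_diff.
    by apply: differentiableB; [exact: differentiable_cst|exact: ex_diff].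
  have L (h : R) : p (x - (h *: delta_mx 0 i + z)) = p (h *: (- delta_mx 0 i) + (x - z)).
    by congr p; rewrite scalerN opprD addrCA.
  have [-> _] := @derive_line _ _ _ (fun z => p (x - z)) p z (delta_mx 0 i) (x - z) (- delta_mx 0 i) L.
  by rewrite !deriveE ?linearN//; exact: polyn_diff.
have c0 := cc_conv x cf (polyn_continuous pp).
have c1 := cc_conv x cf (polyn_continuous pdp).
have c2 := cc_conv x cdf (polyn_continuous pp).
have E3 : 'd_i (fun z => f z * p (x - z)) =
    fun z => 'd_i f z * p (x - z) - f z * 'd_i p (x - z).
  apply/funext => z; have [D E] := E2 z.
  have := @deriveM _ _ f (fun z => p (x - z)) z (delta_mx 0 i)
    (diff_derivable (df z)) (diff_derivable D).
  rewrite -[f * _]/(fun z => f z * p (x - z)) => ->.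
  by rewrite E /GRing.scale/= addrC mulrN [X in X - _]mulrC.
have : intV ('d_i (fun z => f z * p (x - z))) = 0.
  apply: intV_derive => //.
    move=> z; apply: diff_derivable; apply: differentiableM; first exact: df.
    by have [] := E2 z.
  rewrite E3; have [+ _] := ccD c2 (ccZ (-1) c1).
  by under eq_fun do rewrite mulN1r.
by rewrite E3 intVB// => /eqP; rewrite subr_eq0 => /eqP.
Qed.

(** Without the truncation of [kern], hence polynomial. *)
Definition pker c n (y : 'rV[R]_N) : R := (1 - c * sqn y) ^+ n.

Lemma polyn_pker c n : polyn (pker c n).
Proof.
apply: polynX; rewrite (_ : (fun _ => _) = fun y => 1 + (- c) * sqn y).
  apply: polynD; first exact: polyn_hpoly (hpolyC 1).
  exact: polynZ (polyn_hpoly (@hpoly_sqn R N)).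
by apply/funext => y; rewrite mulNr.
Qed.

(** For x and z of norm at most b one has |x - z|^2 <= 4 b^2, so the truncation in
    [kern] is inactive and the convolution with [kern] is a polynomial there. *)
Lemma conv_pker b n f x : 0 < b -> cc f -> (forall z, b < enorm z -> f z = 0) ->
  enorm x <= b ->
  conv (pker (4 * b ^+ 2)^-1 n.+1) f x = intV (fun z => f (x - z) * kern (4 * b ^+ 2)^-1 n.+1 z).
Proof.
move=> b0 cf fb xb; rewrite /conv.
set c := (_)^-1.
have c0 : 0 < c by rewrite invr_gt0 mulr_gt0// exprn_gt0.
have FE : (fun z => f z * pker c n.+1 (x - z)) = fun z => f z * kern c n.+1 (x - z).
  apply/funext => z; have [zb|zb] := ltP b (enorm z); first by rewrite fb// !mul0r.
  congr (_ * _); rewrite /pker /kern /ppow.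
  have sb (y : 'rV[R]_N) : enorm y <= b -> sqn y <= b ^+ 2.
    move=> yb; rewrite /sqn -enorm_sqr lerXn2r ?nnegrE ?enorm_ge0//; exact: ltW.
  have : 0 <= 1 - c * sqn (x - z).
    rewrite subr_ge0 /c mulrC ler_pdivrMr ?mulr_gt0 ?exprn_gt0// mul1r.
    by have := sqnD_le x z; have := sb _ xb; have := sb _ zb; lra.
  by rewrite le_eqVlt => /orP[/eqP <-|-> //]; rewrite ltxx expr0n.
rewrite FE -(intV_reflect x).
  by congr intV; apply/funext => z; rewrite subKr.
by rewrite -FE; exact: cc_conv cf (polyn_continuous (polyn_pker c n.+1)).
Qed.

Lemma derive_support b f i : (forall z, b < enorm z -> f z = 0) ->
  forall z, b < enorm z -> 'd_i f z = 0.
Proof.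
move=> fb z zb; apply: (proj1 (derive_near0 _ _)).
have : \forall y \near z, b < enorm y.
  by apply: (cvgr_gt (enorm z) (@continuous_enorm R N z)).
by apply: filterS => y; exact: fb.
Qed.

(** The approximations are normalised convolutions with [kern]; derivatives of f are
    approximated by the same operator since it commutes with derivatives.  A single
    exponent m serves all the functions involved. *)
Lemma polyn_approx b f e : (0 < N)%N -> 0 < b -> 0 < e ->
  cc f -> (forall z, b < enorm z -> f z = 0) ->
  (forall x, differentiable f x) -> (forall i, cc ('d_i f)) ->
  (forall i x, differentiable ('d_i f) x) -> (forall i, cc ('d_i ('d_i f))) ->
  exists2 p, polyn p & forall x, enorm x <= b ->
    `|p x - f x| <= e /\ forall i, `|'d_i p x - 'd_i f x| <= e /\
      `|'d_i ('d_i p) x - 'd_i ('d_i f) x| <= e.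
Proof.
move=> N0 b0 e0 cf fb df cdf ddf cddf.
pose c : R := (4 * b ^+ 2)^-1.
have c0 : 0 < c by rewrite invr_gt0 mulr_gt0// exprn_gt0.
have A (g : 'rV[R]_N -> R) : cc g -> \forall m \near \oo, forall x,
    `|intV (fun z => g (x - z) * kern c m.+2 z) - intV (@kern R N c m.+2) * g x| <= e * intV (@kern R N c m.+2).
  by move=> cg; have [m0 H] := kern_approx c0 cg e0; exists m0 => // m /= mm; exact: H.
have A1 := A _ cf.
have A2 : \forall m \near \oo, forall i x,
    `|intV (fun z => 'd_i f (x - z) * kern c m.+2 z) - intV (@kern R N c m.+2) * 'd_i f x| <= e * intV (@kern R N c m.+2).
  by apply: filter_forall => i; exact: (A _ (cdf i)).
have A3 : \forall m \near \oo, forall i x,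
    `|intV (fun z => 'd_i ('d_i f) (x - z) * kern c m.+2 z) - intV (@kern R N c m.+2) * 'd_i ('d_i f) x| <= e * intV (@kern R N c m.+2).
  by apply: filter_forall => i; exact: (A _ (cddf i)).
have [m [[H1 H2] H3]] := @filter_ex _ \oo _ _ (filterI (filterI A1 A2) A3).
have kp := @kern_mass_gt0 R N c c0 m.
set kap := intV (@kern R N c m.+2) in kp H1 H2 H3.
exists (fun x => kap^-1 * conv (pker c m.+2) f x).
  exact: polynZ (proj1 (conv_polyn (polyn_pker c m.+2) cf)).
have Q (g : 'rV[R]_N -> R) x : (forall z, b < enorm z -> g z = 0) -> cc g -> enorm x <= b ->
    `|intV (fun z => g (x - z) * kern c m.+2 z) - kap * g x| <= e * kap ->
    `|kap^-1 * conv (pker c m.+2) g x - g x| <= e.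
  move=> gb cg xb; rewrite -(conv_pker m.+1 b0 cg gb xb) => h.
  rewrite -[g x](mulKf (lt0r_neq0 kp)) -mulrBr normrM gtr0_norm ?invr_gt0//.
  by rewrite mulrC ler_pdivrMr.
have D (g : 'rV[R]_N -> R) i : cc g -> (forall x, differentiable g x) -> cc ('d_i g) ->
   'd_i (fun x => kap^-1 * conv (pker c m.+2) g x) = fun x => kap^-1 * conv (pker c m.+2) ('d_i g) x.
  move=> cg dg cdg; apply/funext => x.
  rewrite (@deriveZ _ _ _ (conv (pker c m.+2) g)); last first.
    by apply: diff_derivable; apply: polyn_diff; exact: (proj1 (conv_polyn (polyn_pker c m.+2) cg)).
  by rewrite -(derive_conv (polyn_pker c m.+2) cg dg cdg).
move=> x xb; split; first exact: Q.
move=> i; have E1 := D f i cf df (cdf i); have E2 := D _ i (cdf i) (ddf i) (cddf i).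
split.
  rewrite [X in X - _](congr1 (@^~ x) E1); apply: Q => //.
  exact: derive_support fb.
rewrite E1 [X in X - _](congr1 (@^~ x) E2); apply: Q => //.
apply: derive_support; exact: derive_support fb.
Qed.

End polynomials.

(** * Sums of radial functions times polynomials; test functions *)

Section radial_sums.
Context {R : realType}.
Variables (N : nat) (Rad : \bar R).
Hypothesis Rad_gt0 : (0 < Rad)%E.
Implicit Types (f Y v F : 'rV[R]_N -> R) (g w chi : R -> R).

(** A class of functions closed under derivatives when [P] is [hpoly], and on which the
    form is diagonalised when [P] is [hharm]. *)
Inductive rsum (P : nat -> ('rV[R]_N -> R) -> Prop) : ('rV[R]_N -> R) -> Prop :=
| rsum0 : rsum P (fun _ => 0)
| rsum_add g k Y f : tf Rad g -> P k Y -> rsum P f -> rsum P (fun x => rad g Y x + f x).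

Definition hharm k Y := hpoly k Y /\ harmonic Y.

Lemma rsumD P f F : rsum P f -> rsum P F -> rsum P (fun x => f x + F x).
Proof.
move=> sf sF; elim: sf => [|g k Y {}f tg hY _ IH]; first by under eq_fun do rewrite add0r.
by under eq_fun do rewrite -addrA; exact: rsum_add tg hY IH.
Qed.

Lemma rsum_rad (P : nat -> ('rV[R]_N -> R) -> Prop) g k Y :
  tf Rad g -> P k Y -> rsum P (rad g Y).
Proof.
move=> tg hY; have := rsum_add tg hY (rsum0 P).
by under eq_fun do rewrite addr0.
Qed.

Lemma rsum_family f : rsum hharm f -> exists n (k : 'I_n -> nat) (g : 'I_n -> R -> R)
    (Y : 'I_n -> 'rV[R]_N -> R),
  [/\ forall a, tf Rad (g a), forall a, hpoly (k a) (Y a), forall a, harmonic (Y a) &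
      f = fun x => \sum_(a < n) rad (g a) (Y a) x].
Proof.
elim=> [|g k Y {}f tg [hY HY] _ [n [k' [g' [Y' [tg' hY' HY' ->]]]]]].
  exists 0%N, (fun _ => 0%N), (fun _ _ => 0), (fun _ _ => 0); split; try by case.
  by apply/funext => x; rewrite big_ord0.
exists n.+1, (fun a => if unlift ord0 a is Some b then k' b else k),
  (fun a => if unlift ord0 a is Some b then g' b else g),
  (fun a => if unlift ord0 a is Some b then Y' b else Y); split.
- by move=> a; case: unliftP => [b _|_]; [exact: tg'|exact: tg].
- by move=> a; case: unliftP => [b _|_]; [exact: hY'|exact: hY].
- by move=> a; case: unliftP => [b _|_]; [exact: HY'|exact: HY].
apply/funext => x; rewrite big_ord_recl unlift_none; congr (_ + _).
by apply: eq_bigr => b _; rewrite liftK.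
Qed.

(** The factors |x|^(2j) are radial and join the cut-off. *)
Lemma rsum_fisch chi d f : tf Rad chi -> fisch d f -> rsum hharm (rad chi f).
Proof.
move=> tchi; elim=> [{}d|{}d j k h {}f _ hh Hh _ IH].
  by rewrite (_ : rad _ _ = fun _ => 0) ?/rsum0; [exact: rsum0|apply/funext => x; rewrite /rad mulr0].
rewrite (_ : rad _ _ = fun x => rad (fun r => (r ^+ (2 * j)) * chi r) h x + rad chi f x).
  exact: (rsum_add (tf_X _ tchi) (conj hh Hh : hharm k h) IH).
by apply/funext => x; rewrite /rad exprM enorm_sqr; rewrite -/(sqn x); ring.
Qed.

Lemma rsum_polyn chi f : (0 < N)%N -> tf Rad chi -> polyn f -> rsum hharm (rad chi f).
Proof.
move=> N0 tchi; elim=> [|d m {}f hm _ IH].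
  by rewrite (_ : rad _ _ = fun _ => 0); [exact: rsum0|apply/funext => x; rewrite /rad mulr0].
rewrite radDr; apply: rsumD IH.
exact: rsum_fisch tchi (fisch_of_hpoly N0 hm).
Qed.

Lemma derive_dir f x (v : 'rV[R]_N) : differentiable f x -> 'D_v f x = \sum_(i < N) v ord0 i * 'd_i f x.
Proof.
move=> df; rewrite deriveE// {1}(row_sum_delta v) linear_sum; apply: eq_bigr => i _.
by rewrite linearZ/= -deriveE.
Qed.

(** A derivative of g(|x|) Y is (g'/r)(|x|) times a polynomial plus g(|x|) times a
    polynomial; iterated, this gives the smoothness of [rad g Y]. *)
Lemma rsum_derive f (v : 'rV[R]_N) : rsum hpoly f ->
  (forall x, differentiable f x) /\ rsum hpoly ('D_v f).
Proof.
elim=> [|g k Y {}f tg hY _ [IH1 IH2]].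
  split=> [x|]; first exact: differentiable_cst.
  rewrite (_ : derive _ ^~ _ = fun _ => 0); first exact: rsum0.
  by apply/funext => x; rewrite derive_cst.
have dr x : differentiable (rad g Y) x.
  apply: differentiableM; last exact: hpoly_diff hY.
  have := hpolyC (N := N) (1 : R) => h1.
  (* In dimension 0 there is no partial derivative to appeal to, but the space is a point. *)
  have [i _|N0] := pickP 'I_N.
    have [] := rad_derive i (tf_c1r tg) (hpoly_diff x h1).
    by rewrite /rad; under eq_fun do rewrite mulr1.
  rewrite (_ : (fun y => g (enorm y)) = cst (g (enorm x))); first exact: differentiable_cst.
  by apply/funext => y; congr (g (enorm _)); apply/rowP => i; have := N0 i.
split=> [x|]; first exact: differentiableD.
rewrite (_ : derive _ ^~ _ = fun x => \sum_(i < N) (rad (over_r g) (fun x => v ord0 i * (x ord0 i * Y x)) x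
    + rad g (fun x => v ord0 i * 'd_i Y x) x) + 'D_v f x).
  apply: rsumD IH2.
  have : forall m (F : 'I_m -> 'rV[R]_N -> R), (forall i, rsum hpoly (F i)) ->
      rsum hpoly (fun x => \sum_(i < m) F i x).
    elim=> [|m IHm] F hF; first by under eq_fun do rewrite big_ord0; exact: rsum0.
    by under eq_fun do rewrite big_ord_recl; apply: rsumD => //; exact: IHm.
  apply => i; apply: rsumD.
    by apply: rsum_rad (hpolyZ _ (hpolyX i hY)); exact: tf_over_r.
  exact: rsum_rad tg (hpolyZ _ (proj1 (hpoly_derive i hY))).
apply/funext => x; rewrite deriveD//; [congr (_ + _)|exact: diff_derivable..].
rewrite derive_dir//; apply: eq_bigr => i _.
by rewrite (derive_radE i tg (hpoly_diff x hY)) /rad; ring.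
Qed.

Lemma rsum_smooth f : rsum hpoly f -> smooth_on setT f.
Proof.
move=> hf s x _.
suff : rsum hpoly (iter_derive s f) by move=> /(@rsum_derive _ 0)[].
by elim: s => [//|v s IH] /=; have [] := rsum_derive v IH.
Qed.

(** The support condition of test functions on the punctured ball; the bounds are
    as in [supp]. *)
Definition annulus (a b : R) F : Prop :=
  [/\ 0 < a, (b%:E < Rad)%E & forall x, enorm x < a \/ b < enorm x -> F x = 0].

Lemma annulus_near a b F x : annulus a b F -> ~ radii Rad (enorm x) ->
  \forall y \near x, F y = 0.
Proof.
move=> [a0 bR H] xR.
have cn := @continuous_enorm R N x.
have xab : enorm x < a \/ b < enorm x.
  have [|ax] := ltP (enorm x) a; first by left.
  right; rewrite ltNge; apply/negP => xb; apply: xR.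
  by apply: (supp_radii a0 bR); rewrite ax.
case: xab => h.
  have : \forall y \near x, enorm y < a by exact: (cvgr_lt (enorm x) cn).
  by apply: filterS => y ya; apply: H; left.
have : \forall y \near x, b < enorm y by exact: (cvgr_gt (enorm x) cn).
by apply: filterS => y ya; apply: H; right.
Qed.

Lemma annulus_derive a b F i : annulus a b F -> annulus a b ('d_i F).
Proof.
move=> [a0 bR H]; split => // x xab; apply: (proj1 (derive_near0 _ _)).
have cn := @continuous_enorm R N x.
case: xab => h.
  have : \forall y \near x, enorm y < a by exact: (cvgr_lt (enorm x) cn).
  by apply: filterS => y ya; apply: H; left.
have : \forall y \near x, b < enorm y by exact: (cvgr_gt (enorm x) cn).
by apply: filterS => y ya; apply: H; right.
Qed.

Lemma cc_annulus a b F : continuous F -> annulus a b F -> cc F.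
Proof.
move=> cF [_ _ H]; split => //; exists b => x bx; apply: H; right.
exact: lt_le_trans bx (norm_le_enorm x).
Qed.

(** The weights need only be continuous on the interval of radii; the product vanishes near
    the points where they are not. *)
Lemma cc_radial_mul a b w F : (forall r, radii Rad r -> {for r, continuous w}) ->
  continuous F -> annulus a b F -> cc (fun x => w (enorm x) * F x).
Proof.
move=> cw cF aF; apply: (@cc_annulus a b); last first.
  by have [a0 bR H] := aF; split => // x /H ->; rewrite mulr0.
move=> x; have [xR|xR] := pselect (radii Rad (enorm x)).
  apply: (@continuousM _ _ (fun x => w (enorm x)) F); last exact: cF.
  apply: (@continuous_comp _ _ _ (@enorm R N) w); first exact: continuous_enorm.
  exact: cw.
have E : \forall y \near x, (cst 0 : 'rV[R]_N -> R) y = w (enorm y) * F y.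
  by have := annulus_near aF xR; apply: filterS => y /= ->; rewrite mulr0.
rewrite /continuous_at -(nbhs_singleton E).
by apply: (cvg_trans (near_eq_cvg E)); exact: cvg_cst.
Qed.

Lemma intV_eball a b F : annulus a b F -> \int[lebesgue_rV N]_(x in eball Rad) F x = intV F.
Proof.
move=> [a0 bR H]; rewrite /intV Rintegral_mkcond; apply: eq_Rintegral => x _.
rewrite /patch; case: ifPn => // /negP xb; rewrite H//; right.
rewrite ltNge; apply/negP => h; apply: xb; apply/mem_set => /=.
by apply: le_lt_trans bR; rewrite lee_fin.
Qed.

(** The norm attains its bounds on the compact support, which avoids the origin and
    stays inside the open ball. *)
Lemma test_function_annulus v : test_function (eball Rad `\ 0) v ->
  smooth_on setT v /\ exists a b, annulus a b v.
Proof.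
move=> [sv cv suppv]; split => //.
set K := closure _ in cv suppv.
have [K0|/set0P K0] := eqVneq K set0.
  exists 1, 0; split => // x _; apply/eqP/negPn/negP => ux.
  have : K x by exact: subset_closure.
  by rewrite K0.
have cn : {within K, continuous (@enorm R N)}.
  by apply: continuous_subspaceT; exact: continuous_enorm.
have [xb /set_mem Kb hb] := compact_EVT_max K0 cv cn.
have [xa /set_mem Ka ha] := compact_EVT_min K0 cv cn.
exists (enorm xa), (enorm xb); split.
- have [_ /eqP xa0] := suppv _ Ka.
  by rewrite lt_neqAle enorm_ge0 andbT eq_sym enorm_eq0.
- by have [] := suppv _ Kb.
move=> x xab; apply/eqP/negPn/negP => ux.
have /mem_set Kx : K x by exact: subset_closure.
by case: xab; rewrite ltNge ?ha ?hb.
Qed.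

Lemma test_function_rad g Y k : tf Rad g -> hpoly k Y ->
  test_function (eball Rad `\ 0) (rad g Y).
Proof.
move=> tg hY; have [_ [a [b [a0 bR H]]]] := tg.
have sub : closure [set x | rad g Y x != 0] `<=` [set x : 'rV[R]_N | a <= enorm x <= b].
  have cl : closed [set x : 'rV[R]_N | a <= enorm x <= b].
    rewrite (_ : mkset _ = @enorm R N @^-1` `[a, b]%classic).
      by apply: preimage_closed; [move=> x _; exact: continuous_enorm|exact: itv_closed].
    by apply/seteqP; split => x /=; rewrite in_itv.
  rewrite [X in _ `<=` X](proj1 (closure_id _) cl).
  apply: closureS => x /= ux; apply/andP; split.
    by rewrite leNgt; apply/negP => xa; move/eqP: ux; apply; rewrite /rad H ?mul0r//; left.
  by rewrite leNgt; apply/negP => xa; move/eqP: ux; apply; rewrite /rad H ?mul0r//; right.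
split.
- by apply: rsum_smooth; exact: rsum_rad tg hY.
- apply: bounded_closed_compact; last exact: closed_closure.
  exists b; split; first exact: num_real.
  move=> M bM x /sub /= /andP[_ xb].
  exact: le_trans (norm_le_enorm x) (le_trans xb (ltW bM)).
- move=> x /sub /= /andP[ax xb]; split => /=; first by apply: le_lt_trans bR; rewrite lee_fin.
  by move/eqP; rewrite -enorm_eq0 => /eqP x0; move: ax; rewrite x0 leNgt a0.
Qed.

End radial_sums.

(** * From finite sums to arbitrary test functions *)

Section sufficiency.
Context {R : realType}.
Variables (N : nat) (Rad : \bar R) (V W : R -> R).
Hypothesis Rad_gt0 : (0 < Rad)%E.
Hypothesis N0 : (0 < N)%N.
Hypothesis sV : smooth1 (radii Rad) V.
Hypothesis sW : smooth1 (radii Rad) W.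
Implicit Types (f Y v e : 'rV[R]_N -> R) (g chi : R -> R).

Definition twice_diff f : Prop :=
  (forall x, differentiable f x) /\ (forall i x, differentiable ('d_i f) x).

Lemma continuous_mul (F G : 'rV[R]_N -> R) : continuous F -> continuous G ->
  continuous (fun x => F x * G x).
Proof. by move=> cF cG x; exact: (@continuousM _ _ _ _ x (cF x) (cG x)). Qed.

Lemma continuous_norm (F : 'rV[R]_N -> R) : continuous F -> continuous (fun x => `|F x|).
Proof.
move=> cF x; apply: (@continuous_comp _ _ _ F (fun r : R => `|r|)); first exact: cF.
exact: norm_continuous.
Qed.

Lemma continuous_add (F G : 'rV[R]_N -> R) : continuous F -> continuous G ->
  continuous (fun x => F x + G x).
Proof. by move=> cF cG x; exact: (@continuousD _ _ _ _ _ x (cF x) (cG x)). Qed.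

Lemma continuous_sum n (F : 'I_n -> 'rV[R]_N -> R) : (forall i, continuous (F i)) ->
  continuous (fun x => \sum_(i < n) F i x).
Proof.
elim: n F => [|n IH] F cF.
  by under eq_fun do rewrite big_ord0; exact: cst_continuous.
by under eq_fun do rewrite big_ord_recl; apply: continuous_add => //; exact: IH.
Qed.

Lemma continuous_scale c (F : 'rV[R]_N -> R) : continuous F -> continuous (fun x => c * F x).
Proof. by move=> cF; apply: continuous_mul => //; exact: cst_continuous. Qed.

Lemma radii_above b : (b%:E < Rad)%E -> exists b' : R, [/\ b < b', 0 < b' & (b'%:E < Rad)%E].
Proof.
move=> bR; have [r0 [r00 r0R]] := radii_point Rad_gt0.
have : ((Num.max b r0)%:E < Rad)%E by rewrite EFin_max gt_max bR.
have mb : b <= Num.max b r0 by rewrite le_max lexx.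
have mr : 0 < Num.max b r0 by rewrite lt_max r00 orbT.
move: mb mr; set m := Num.max b r0 => mb mr.
case: Rad => [r|_|//]; last by exists (m + 1); split; rewrite ?ltry//; lra.
by rewrite lte_fin => mr'; exists ((m + r) / 2); split; rewrite ?lte_fin; lra.
Qed.

Lemma derive1_outside a b g : (forall r, r < a \/ b < r -> g r = 0) ->
  forall r, r < a \/ b < r -> over_r g r = 0.
Proof.
move=> H r rab; rewrite /over_r derive1E.
suff [-> _] : 'D_1 g r = 0 /\ derivable g r 1 by rewrite mulr0.
apply: derive_near0; case: rab => h.
  have : \forall y \near r, y < a by exact: lt_nbhsl.
  by apply: filterS => y ya; apply: H; left.
have : \forall y \near r, b < y by exact: lt_nbhsr.
by apply: filterS => y ya; apply: H; right.
Qed.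

(** Times eps, it bounds the Laplacian and the first derivatives of [rad chi e] when eps
    bounds [e] and its derivatives near the support of the cut-off, by the product rule
    ([dominatorP]).  It is continuous, so these bounds are integrable against the
    weights. *)
Definition dominator chi x : R := \sum_(i < N)
  (`|over_r (over_r chi) (enorm x)| * x ord0 i ^+ 2 +
   `|over_r chi (enorm x)| * (1 + 2 * `|x ord0 i|) + `|chi (enorm x)|).

Lemma dominator_ge0 chi x : 0 <= dominator chi x.
Proof.
by apply: sumr_ge0 => i _; rewrite !addr_ge0// mulr_ge0// ?sqr_ge0.
Qed.

Lemma continuous_dominator chi : tf Rad chi -> continuous (dominator chi).
Proof.
move=> tc; have to := tf_over_r tc; have too := tf_over_r to.
have cn g : tf Rad g -> continuous (fun x : 'rV[R]_N => `|g (enorm x)|).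
  move=> tg x; apply: (@continuous_comp _ _ _ (fun x : 'rV[R]_N => g (enorm x)) (fun r : R => `|r|)).
    apply: (@continuous_comp _ _ _ (@enorm R N) g); first exact: continuous_enorm.
    exact: (proj1 (tf_ccr tg)).
  exact: norm_continuous.
have cc i : continuous (fun x : 'rV[R]_N => x ord0 i) by exact: coord_continuous.
apply: continuous_sum => i; apply: continuous_add; last exact: cn.
apply: continuous_add; apply: continuous_mul; try exact: cn.
  by under eq_fun do rewrite expr2; exact: continuous_mul.
apply: continuous_add; first exact: cst_continuous.
by apply: continuous_scale; exact: continuous_norm.
Qed.

Lemma dominatorP a b chi e eps x : tf Rad chi ->
  (forall r, r < a \/ b < r -> chi r = 0) -> twice_diff e ->
  (forall x, enorm x <= b -> `|e x| <= eps /\ forall i, `|'d_i e x| <= eps /\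
      `|'d_i ('d_i e) x| <= eps) ->
  `|laplacian (rad chi e) x| <= eps * dominator chi x /\
  forall i, `|'d_i (rad chi e) x| <= eps * dominator chi x.
Proof.
move=> tc chi0 [de dde] He.
have to := tf_over_r tc.
have E1 i := derive_radE i tc (de x).
have E2 i := proj2 (derive2_rad x tc de (dde i)).
have [xb|xb] := leP (enorm x) b; last first.
  have x0 g : (forall r, r < a \/ b < r -> g r = 0) -> g (enorm x) = 0 by apply; right.
  have z0 := x0 _ chi0; have z1 := x0 _ (derive1_outside chi0).
  have z2 := x0 _ (derive1_outside (derive1_outside chi0)).
  have -> : dominator chi x = 0.
    by rewrite /dominator big1// => i _; rewrite z0 z1 z2 !normr0 !mul0r !addr0.
  rewrite mulr0; split; last by move=> i; rewrite E1 /rad z0 z1 !mul0r addr0 normr0.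
  by rewrite /laplacian big1 ?normr0// => i _; rewrite E2 z0 z1 z2 !mul0r !addr0.
have [He0 He12] := He x xb.
have eps0 : 0 <= eps by exact: le_trans (normr_ge0 _) He0.
split.
  rewrite /laplacian /dominator mulr_sumr; apply: le_trans (ler_norm_sum _ _ _) _.
  apply: ler_sum => i _; rewrite E2; have [He1 He2] := He12 i.
  apply: le_trans (ler_normD _ _) _; rewrite [leRHS]mulrDr; apply: lerD; last first.
    by rewrite normrM mulrC; exact: ler_wpM2r.
  apply: le_trans (ler_normD _ _) _; rewrite [leRHS]mulrDr; apply: lerD.
    rewrite normrM (ger0_norm (sqr_ge0 (x ord0 i))) normrM [leRHS]mulrA; apply: ler_wpM2r; first exact: sqr_ge0.
    by rewrite mulrC; exact: ler_wpM2r.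
  rewrite normrM [leRHS]mulrCA; apply: ler_wpM2l => //.
  apply: le_trans (ler_normD _ _) _; rewrite [leRHS]mulrDr mulr1; apply: lerD => //.
  rewrite !normrM ger0_norm// [leRHS]mulrCA ler_wpM2l// mulrC.
  exact: ler_wpM2r.
move=> i; rewrite E1 /rad.
have [He1 He2] := He12 i.
apply: (@le_trans _ _ (eps * (`|over_r (over_r chi) (enorm x)| * x ord0 i ^+ 2 +
   `|over_r chi (enorm x)| * (1 + 2 * `|x ord0 i|) + `|chi (enorm x)|))); last first.
  apply: ler_wpM2l => //; rewrite /dominator (bigD1 i)//= lerDl; apply: sumr_ge0 => j _.
  by rewrite !addr_ge0// mulr_ge0// ?sqr_ge0.
apply: le_trans (ler_normD _ _) _; rewrite [leRHS]mulrDr; apply: lerD; last first.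
  by rewrite normrM mulrC; exact: ler_wpM2r.
rewrite !normrM [leRHS]mulrDr; apply: ler_wpDl.
  by apply: mulr_ge0 => //; apply: mulr_ge0 => //; exact: sqr_ge0.
rewrite [leRHS]mulrCA; apply: ler_wpM2l => //.
apply: (@le_trans _ _ (`|x ord0 i| * eps)); first exact: ler_wpM2l.
rewrite mulrC; apply: ler_wpM2l => //.
by have := normr_ge0 (x ord0 i); lra.
Qed.

Variable v : 'rV[R]_N -> R.
Hypothesis sv : smooth_on setT v.
Variables a b : R.
Hypothesis av : annulus Rad a b v.

Lemma smooth_twice_diff : twice_diff v.
Proof.
split=> [x|i x]; first exact: (sv [::] (x := x) Logic.I).
exact: (sv [:: delta_mx 0 i] (x := x) Logic.I).
Qed.

Lemma smooth_continuous : [/\ continuous v, forall i, continuous ('d_i v) &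
  forall i, continuous ('d_i ('d_i v))].
Proof.
have [d dd] := smooth_twice_diff; split.
- by move=> x; exact: differentiable_continuous.
- by move=> i x; exact: differentiable_continuous.
- move=> i x; apply: differentiable_continuous.
  exact: (sv [:: delta_mx 0 i; delta_mx 0 i] (x := x) Logic.I).
Qed.

Lemma continuous_laplacian : continuous (laplacian v).
Proof.
have [_ _ c2] := smooth_continuous.
exact: continuous_sum.
Qed.

Lemma annulus_laplacian : annulus Rad a b (laplacian v).
Proof.
have [a0 bR _] := av; split => // x xab; rewrite /laplacian big1// => i _.
by have [_ _ ->] := annulus_derive i (annulus_derive i av).
Qed.

Definition lap_energy x : R := V (enorm x) * (laplacian v x * laplacian v x).
Definition grad_energy x : R := W (enorm x) * \sum_(i < N) 'd_i v x * 'd_i v x.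

Lemma cc_lap_energy : cc lap_energy.
Proof.
apply: (@cc_radial_mul _ _ Rad a b).
- by move=> r Rr; exact: smooth1_continuous sV Rr.
- by apply: continuous_mul; exact: continuous_laplacian.
- by have [a0 bR H] := annulus_laplacian; split => // x /H ->; rewrite mulr0.
Qed.

Lemma annulus_grad : annulus Rad a b (fun x => \sum_(i < N) 'd_i v x * 'd_i v x).
Proof.
have [a0 bR _] := av; split => // x xab; rewrite big1// => i _.
by have [_ _ ->] := annulus_derive i av; rewrite ?mulr0.
Qed.

Lemma cc_grad_energy : cc grad_energy.
Proof.
apply: (@cc_radial_mul _ _ Rad a b); last exact: annulus_grad.
  by move=> r Rr; exact: smooth1_continuous sW Rr.
apply: continuous_sum => i; have [_ c1 _] := smooth_continuous.
by apply: continuous_mul; exact: c1.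
Qed.

Lemma Bform_energy : Bform V W v v = intV lap_energy - intV grad_energy.
Proof. by rewrite -intVB//; [exact: cc_lap_energy|exact: cc_grad_energy]. Qed.

Hypothesis qf_nneg : forall K u, tf Rad u -> 0 <= qf N Rad V W (eigen N K) u u.

(** Let p be a polynomial within eps of v in the C^2 sense and chi a cut-off that is 1 on
    the support of v.  Then chi p = v + eta with eta = chi (p - v) of order eps, and
    B(chi p) >= 0 because chi p is a finite sum of products.  Hence
    B(v) >= - eps I for a number I that does not depend on eps. *)
Lemma Bform_ge0 : 0 <= Bform V W v v.
Proof.
have [a0 bR v0] := av.
have [rho [rho_tf rho_ge0 rho1]] := mollifier_exists Rad_gt0.
have [b' [bb b'0 b'R]] := radii_above bR.
(* The cut-off is 1 for a <= |x| <= b and vanishes outside of a/2 <= |x| <= b'. *)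
have [chi [schi chi1 chi0]] := @cutoff_exists R (a / 2) a b b' ltac:(lra) bb.
have tchi : tf Rad chi by split => //; exists (a / 2), b'; split => //; lra.
have vE : v = rad chi v.
  apply/funext => x; rewrite /rad.
  have [xa|ax] := ltP (enorm x) a; first by rewrite v0 ?mulr0//; left.
  have [xb|bx] := ltP b (enorm x); first by rewrite v0 ?mulr0//; right.
  by rewrite chi1 ?mul1r// ax.
have [dv ddv] := smooth_twice_diff.
have [cv0 cv1 cv2] := smooth_continuous.
have av1 i := annulus_derive i av.
have ccv := cc_annulus cv0 av.
have ccv1 i := cc_annulus (cv1 i) (av1 i).
have ccv2 i := cc_annulus (cv2 i) (annulus_derive i (av1 i)).
pose kap := dominator chi.
have ck : continuous kap by exact: continuous_dominator.
have k0 x : 0 <= kap x by exact: dominator_ge0.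
have ka : annulus Rad (a / 2) b' kap.
  split => //; first by lra.
  move=> x xab; rewrite /kap /dominator big1// => i _.
  have z g : (forall r, r < a / 2 \/ b' < r -> g r = 0) -> g (enorm x) = 0 by apply.
  rewrite (z _ chi0) (z _ (derive1_outside chi0)) (z _ (derive1_outside (derive1_outside chi0))).
  by rewrite !normr0 !mul0r !addr0.
pose D1 x := 2 * `|laplacian v x| * kap x + kap x ^+ 2.
pose D2 x := \sum_(i < N) (2 * `|'d_i v x| * kap x + kap x ^+ 2).
(* eps D bounds the change of the density of B when v is replaced by v + eta, eps <= 1. *)
pose D x := `|V (enorm x)| * D1 x + `|W (enorm x)| * D2 x.
have ck2 : continuous (fun x => kap x ^+ 2) by under eq_fun do rewrite expr2; exact: continuous_mul.
have cD : cc D.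
  apply: ccD.
    apply: (@cc_radial_mul _ _ Rad (a / 2) b' (fun r => `|V r|)).
    - move=> r Rr; apply: (@continuous_comp _ _ _ V (fun r : R => `|r|)); last exact: norm_continuous.
      exact: smooth1_continuous sV Rr.
    - apply: continuous_add => //; apply: continuous_mul => //.
      by apply: continuous_scale; apply: continuous_norm; exact: continuous_laplacian.
    - by have [? ? H] := ka; split => // x /H; rewrite /D1 => ->; rewrite mulr0 expr0n addr0.
  apply: (@cc_radial_mul _ _ Rad (a / 2) b' (fun r => `|W r|)).
  - move=> r Rr; apply: (@continuous_comp _ _ _ W (fun r : R => `|r|)); last exact: norm_continuous.
    exact: smooth1_continuous sW Rr.
  - apply: continuous_sum => i; apply: continuous_add => //; apply: continuous_mul => //.
    by apply: continuous_scale; apply: continuous_norm; exact: cv1.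
  - by have [? ? H] := ka; split => // x /H; rewrite /D2 => ->; rewrite big1// => i _; rewrite mulr0 expr0n addr0.
have main eps : 0 < eps -> eps <= 1 -> 0 <= Bform V W v v + eps * intV D.
  move=> e0 e1.
  have [p pp Hp] := polyn_approx N0 b'0 e0 ccv
    (fun z bz => v0 z (or_intror (lt_trans bb bz))) dv ccv1 ddv ccv2.
  pose e x := p x - v x.
  have dp x : differentiable p x by exact: polyn_diff.
  have ddp i x : differentiable ('d_i p) x by apply: polyn_diff; exact: polyn_derive.
  have eE i : 'd_i e = fun x => 'd_i p x - 'd_i v x.
    by apply/funext => x; rewrite deriveB//; exact: diff_derivable.
  have eE2 i x : 'd_i ('d_i e) x = 'd_i ('d_i p) x - 'd_i ('d_i v) x.
    by rewrite eE deriveB//; exact: diff_derivable.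
  have de : twice_diff e.
    split=> [x|i x]; first exact: differentiableB.
    by rewrite eE; exact: differentiableB.
  have He x : enorm x <= b' -> `|e x| <= eps /\ forall i, `|'d_i e x| <= eps /\ `|'d_i ('d_i e) x| <= eps.
    move=> /Hp[h0 h12]; split => // i; have [h1 h2] := h12 i.
    by rewrite eE2 [X in `|X|](congr1 (@^~ x) (eE i)).
  pose eta := rad chi e.
  have [deta ddeta] : twice_diff eta.
    have [d1 d2] := de; split=> [x|i x].
      have i0 : 'I_N by exact: Ordinal N0.
      by have [] := rad_derive i0 (tf_c1r tchi) (d1 x).
    by have [] := derive2_rad x tchi d1 (d2 i).
  have Heta x := dominatorP x tchi chi0 de He.
  have pE : rad chi p = fun x => v x + eta x.
    by apply/funext => x; rewrite {1}vE /eta /rad /e; ring.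
  have [n [k [g [Y [tg hY HY fE]]]]] := rsum_family (rsum_polyn N0 tchi pp).
  have [cB _] := Bform_sum_rad sV sW tg hY HY.
  have B0 := Bform_sum_rad_ge0 Rad_gt0 N0 sV sW rho_tf rho1 tg hY HY rho_ge0 qf_nneg.
  rewrite -fE pE in cB B0.
  apply: (le_trans B0).
  have cBv : cc (Bdens V W v v).
    by have := ccD cc_lap_energy (ccZ (-1) cc_grad_energy); under eq_fun do rewrite mulN1r.
  rewrite -intVZ// -intVD//; last exact: ccZ.
  apply: le_intV => //; first by apply: ccD => //; exact: ccZ.
  move=> x; have [h1 h2] := Heta x.
  rewrite /Bdens (laplacianD _ dv deta ddv ddeta).
  have -> : \sum_(i < N) 'd_i (fun x => v x + eta x) x * 'd_i (fun x => v x + eta x) x =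
     \sum_(i < N) 'd_i v x * 'd_i v x + \sum_(i < N) (2 * 'd_i v x * 'd_i eta x + 'd_i eta x ^+ 2).
    rewrite -big_split/=; apply: eq_bigr => i _.
    by rewrite deriveD; [ring|exact: diff_derivable..].
  have key s t : `|t| <= eps * kap x ->
      `|2 * s * t + t ^+ 2| <= eps * (2 * `|s| * kap x + kap x ^+ 2).
    move=> ht; have kx := k0 x.
    apply: le_trans (ler_normD _ _) _; rewrite [leRHS]mulrDr; apply: lerD.
      have -> : eps * (2 * `|s| * kap x) = 2 * `|s| * (eps * kap x) by ring.
      by rewrite !normrM (ger0_norm (ler0n _ 2)); apply: ler_wpM2l => //; rewrite mulr_ge0.
    rewrite normrX.
    have : `|t| ^+ 2 <= (eps * kap x) ^+ 2 by rewrite lerXn2r ?nnegrE ?mulr_ge0// ltW.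
    move/le_trans; apply; rewrite exprMn ler_wpM2r ?sqr_ge0//.
    by rewrite expr2 ler_piMr// ltW.
  have hL := key (laplacian v x) _ h1.
  have hG : `|\sum_(i < N) (2 * 'd_i v x * 'd_i eta x + 'd_i eta x ^+ 2)| <= eps * D2 x.
    rewrite /D2 mulr_sumr; apply: le_trans (ler_norm_sum _ _ _) _.
    by apply: ler_sum => i _; exact: key (h2 i).
  move: hL hG; rewrite /D -/(D1 x).
  move: (\sum_(i < N) (2 * 'd_i v x * 'd_i eta x + 'd_i eta x ^+ 2)) => G.
  move: (\sum_(i < N) 'd_i v x * 'd_i v x) => G0.
  move: (laplacian v x) (laplacian eta x) (V (enorm x)) (W (enorm x)) (D1 x) (D2 x).
  move=> L l Vx Wx d1 d2 hL hG.
  have hV : Vx * (2 * L * l + l ^+ 2) <= eps * (`|Vx| * d1).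
    apply: le_trans (ler_norm _) _; rewrite normrM [leRHS]mulrCA; exact: ler_wpM2l.
  have hW : - (Wx * G) <= eps * (`|Wx| * d2).
    apply: le_trans (ler_norm _) _; rewrite normrN normrM [leRHS]mulrCA; exact: ler_wpM2l.
  have -> : Vx * ((L + l) * (L + l)) - Wx * (G0 + G) =
     Vx * (L * L) - Wx * G0 + (Vx * (2 * L * l + l ^+ 2) + (- (Wx * G))) by ring.
  by rewrite lerD2l [leRHS]mulrDr; exact: lerD.
rewrite leNgt; apply/negP => B0.
move: main B0; move: (Bform V W v v) (intV D) => B I main B0.
(* Chosen so that eps |I| < - B, which contradicts B + eps I >= 0. *)
pose eps := Num.min 1 (- B / (2 * (`|I| + 1))).
have nI := normr_ge0 I.
have e0 : 0 < eps by rewrite lt_min ltr01 divr_gt0; lra.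
have e1 : eps <= 1 by rewrite ge_min lexx.
have e2 : eps * (2 * (`|I| + 1)) <= - B.
  by rewrite -ler_pdivlMr; [rewrite ge_min lexx orbT|lra].
have := main _ e0 e1.
have : eps * I <= eps * `|I| by apply: ler_wpM2l; [exact: ltW|exact: ler_norm].
by lra.
Qed.

End sufficiency.

(** * The equivalence *)

Section equivalence.
Context {R : realType}.
Variables (N : nat) (Rad : \bar R) (V W : R -> R).
Hypothesis Rad_gt0 : (0 < Rad)%E.
Hypothesis N0 : (0 < N)%N.
Hypothesis sV : smooth1 (radii Rad) V.
Hypothesis sW : smooth1 (radii Rad) W.
Implicit Types (u : R -> R) (v Y : 'rV[R]_N -> R).

(** The exponent N-1-n may be negative, which the pair of natural exponents
    avoids. *)
Lemma radius_power n (r : R) : r != 0 -> r ^ (N%:Z - n.+1%:R) = r ^+ N.-1 * r^-1 ^+ n.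
Proof.
move=> r0; have -> : N%:Z - n.+1%:R = N.-1%:Z - n%:Z :> int.
  by rewrite -{1}(prednK N0) natz !intS; ring.
by rewrite expfzDr// -exprnP -exprnN exprVn.
Qed.

Lemma wintE f n u :
  \int[lebesgue_measure]_(r in radii Rad) (f r * r ^ (N%:Z - n.+1%:R) * `|u r| ^+ 2) =
  wint N Rad f n u.
Proof.
apply: eq_intR => r /radii_neq0 r0.
by rewrite radius_power// -normrX ger0_norm ?sqr_ge0//; ring.
Qed.

Lemma ball_energy v : test_function (eball Rad `\ 0) v ->
  \int[lebesgue_rV N]_(x in eball Rad) (V (enorm x) * `|laplacian v x| ^+ 2)
  - \int[lebesgue_rV N]_(x in eball Rad) (W (enorm x) * enorm (gradient v x) ^+ 2)
  = Bform V W v v.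
Proof.
move=> /(test_function_annulus Rad_gt0) [sv [a [b av]]].
have scale f F : annulus Rad a b F -> annulus Rad a b (fun x => f (enorm x) * F x).
  by move=> [a0 bR H]; split => // x /H ->; rewrite mulr0.
have aL : annulus Rad a b (lap_energy V v).
  apply: scale; have [a0 bR H] := annulus_laplacian av.
  by split => // x /H ->; rewrite mulr0.
rewrite (Bform_energy sV sW sv av) -(intV_eball aL) -(intV_eball (scale _ W _ (annulus_grad av))).
congr (_ - _); apply: eq_Rintegral => x _.
  by rewrite -normrX ger0_norm ?sqr_ge0.
rewrite enorm_sqr; congr (_ * _); apply: eq_bigr => i _.
by rewrite mxE expr2.
Qed.

Lemma harmonic_const c : harmonic (fun _ : 'rV[R]_N => c).
Proof.
move=> x; rewrite /laplacian big1// => i _.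
rewrite (_ : 'd_i (fun _ => c) = fun _ => 0); last by apply/funext => y; exact: derive_cst.
exact: derive_cst.
Qed.

Lemma harmonic_coord i : harmonic (fun x : 'rV[R]_N => x ord0 i).
Proof.
move=> x; rewrite /laplacian big1// => j _.
rewrite (_ : 'd_j _ = fun _ => (j == i)%:R : R); first exact: derive_cst.
by apply/funext => y; have [-> _] := derive_coord y j i.
Qed.

Lemma enorm_axis i (r : R) : 0 <= r -> enorm (r *: delta_mx 0 i : 'rV[R]_N) = r.
Proof.
move=> r0; rewrite /enorm (bigD1 i)//= big1 ?addr0 => [|j ji].
  by rewrite !mxE !eqxx mulr1 sqrtr_sqr ger0_norm.
by rewrite !mxE (negbTE ji) mulr0 expr0n.
Qed.

(** The profile is positive at some radius r, and the integrand at the point of norm r on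
    the i-th axis. *)
Lemma sphere_mean_gt0 rho d i (H : 'rV[R]_N -> R) : tf Rad rho -> (forall r, 0 <= rho r) ->
  intR Rad rho = 1 -> hpoly d H -> (forall x, 0 <= H x) ->
  (forall r, 0 < r -> 0 < H (r *: delta_mx 0 i)) -> 0 < sphere_mean rho d H.
Proof.
move=> trho rho0 rho1 hH H0 Hi.
have [r Rr rhor] : exists2 r, radii Rad r & 0 < rho r.
  apply: contrapT => no; have : intR Rad rho = 0 * intR Rad rho.
    rewrite -intRZ//; last exact: tf_ccr.
    apply: eq_intR => r Rr; rewrite mul0r; apply/eqP; move: (rho0 r); rewrite le_eqVlt eq_sym.
    by case/orP => // rhor; case: no; exists r.
  by rewrite mul0r rho1 => /eqP; rewrite oner_eq0.
have r0 := radii_gt0 Rr.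
apply: (@intV_gt0 _ _ _ (r *: delta_mx 0 i)).
- apply: (@cc_rad _ _ Rad); last exact: hpoly_continuous hH.
  by apply: ccr_invX => //; exact: tf_ccr.
- move=> x; rewrite /rad mulr_ge0// mulr_ge0// exprn_ge0// invr_ge0; exact: enorm_ge0.
- by rewrite /rad enorm_axis ?ltW// mulr_gt0 ?Hi// mulr_gt0// exprn_gt0// invr_gt0.
Qed.

(** Apply the inequality on the ball to v = r^-k u(|x|) Y, for which the diagonal form
    is a positive multiple of q. *)
Lemma mode_ge0 k i Y u : hpoly k Y -> harmonic Y ->
  (forall r : R, 0 < r -> Y (r *: delta_mx 0 i) != 0) ->
  (forall v, test_function (eball Rad `\ 0) v -> 0 <= Bform V W v v) ->
  tf Rad u -> 0 <= qf N Rad V W (eigen N k) u u.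
Proof.
move=> hY HY Yi B0 tu.
(* The profile g with r^k g = u. *)
have tg : tf Rad (fun r => r^-1 ^+ k * u r) by exact: tf_invX.
have [rho [rho_tf rho_ge0 rho1]] := mollifier_exists Rad_gt0.
have := B0 _ (test_function_rad tg hY).
rewrite (Bform_rad N0 sV sW rho_tf rho1 tg tg hY hY HY HY) eqxx mul1r.
have -> : (fun r => r ^+ k * (r^-1 ^+ k * u r)) = u.
  apply/funext => r; have [->|r0] := eqVneq r 0; last by rewrite exprVn mulVKf ?expf_neq0.
  by rewrite (supp_out (proj2 tu)) ?mulr0// => /radii_neq0; rewrite eqxx.
rewrite pmulr_rge0//; apply: (@sphere_mean_gt0 _ _ i) => //; first exact: hpolyM.
  by move=> x; rewrite -expr2 sqr_ge0.
by move=> r r0; rewrite -expr2 exprn_even_gt0/=// Yi.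
Qed.

(** Degrees 0 and 1 are the two given forms, and the degrees k >= 2 have
    k(N+k-2) >= 2N. *)
Lemma rellich_modes : (forall r, radii Rad r -> 0 <= V r) ->
  (forall u, tf Rad u -> 0 <= 2 * wint N Rad V 2 (derive1 u)
     - wint N Rad (derive1 (derive1 V)) 2 u - (N%:R - 5) * wint N Rad (derive1 V) 3 u
     + (5 * N%:R - 9) * wint N Rad V 4 u - wint N Rad W 2 u) ->
  (forall v, test_function (eball Rad `\ 0) v -> 0 <= Bform V W v v) <->
  (forall u, tf Rad u -> 0 <= qf N Rad V W 0 u u /\ 0 <= qf N Rad V W (N%:R - 1) u u).
Proof.
move=> V0 H; have e0 : eigen N 0 = 0 :> R by rewrite /eigen mul0r.
have e1 : eigen N 1 = N%:R - 1 :> R by rewrite /eigen; ring.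
split=> [B0 u tu|q01 v].
  pose i := Ordinal N0; rewrite -e1 -[X in qf _ _ _ _ X]e0; split.
    apply: (mode_ge0 (i := i) (hpolyC 1) (harmonic_const 1)) => // r _; exact: oner_neq0.
  apply: (mode_ge0 (i := i) (hpoly_coord i) (harmonic_coord i)) => // r r0.
  by rewrite !mxE !eqxx mulr1 gt_eqF.
move=> /(test_function_annulus Rad_gt0) [sv [a [b av]]].
apply: (Bform_ge0 Rad_gt0 N0 sV sW sv av) => -[|[|K]] u tu.
- by rewrite e0; exact: (q01 u tu).1.
- by rewrite e1; exact: (q01 u tu).2.
- apply: qf_ge0 => //; [exact: H|exact: (q01 u tu).2|].
  have N1 : 1 <= N%:R :> R by rewrite ler1n.
  have K0 : 0 <= K%:R :> R by exact: ler0n.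
  by rewrite /eigen -(addn2 K) natrD; nra.
Qed.

End equivalence.

Theorem theorem1p7 (R : realType) (N : nat) (Rad : \bar R) (V2 W2 : R -> R)
  (N_ge1 : (1 <= N)%N) (Rad_gt0 : (0 < Rad)%E)
  (V2_smooth : smooth_on (radii Rad) V2)
  (W2_smooth : smooth_on (radii Rad) W2)
  (V2_ge0 : forall r, radii Rad r -> 0 <= V2 r)
  (V2W2 : forall u : R -> R, test_function (radii Rad) u ->
     0 <= 2 * (\int[lebesgue_measure]_(r in radii Rad)
                 (V2 r * r ^ (N%:Z - 3) * `|derive1 u r| ^+ 2))
          - \int[lebesgue_measure]_(r in radii Rad)
              (derive1n 2 V2 r * r ^ (N%:Z - 3) * `|u r| ^+ 2)
          - (N%:R - 5) * (\int[lebesgue_measure]_(r in radii Rad)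
              (derive1 V2 r * r ^ (N%:Z - 4) * `|u r| ^+ 2))
          + (5 * N%:R - 9) * (\int[lebesgue_measure]_(r in radii Rad)
              (V2 r * r ^ (N%:Z - 5) * `|u r| ^+ 2))
          - \int[lebesgue_measure]_(r in radii Rad)
              (W2 r * r ^ (N%:Z - 3) * `|u r| ^+ 2)) :
  let c1 : R := N%:R - 1 in
  (forall v : 'rV[R]_N -> R, test_function (eball Rad `\ 0) v ->
     \int[lebesgue_rV N]_(x in eball Rad)
       (W2 (enorm x) * enorm (gradient v x) ^+ 2) <=
     \int[lebesgue_rV N]_(x in eball Rad)
       (V2 (enorm x) * `|laplacian v x| ^+ 2))
  <->
  (forall u : R -> R, test_function (radii Rad) u ->
     \int[lebesgue_measure]_(r in radii Rad)
       (W2 r * r ^ (N%:Z - 1) * `|derive1 u r| ^+ 2) <=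
     \int[lebesgue_measure]_(r in radii Rad)
       (V2 r * r ^ (N%:Z - 1) * `|derive1n 2 u r| ^+ 2)
     + (N%:R - 1) * (\int[lebesgue_measure]_(r in radii Rad)
         (V2 r * r ^ (N%:Z - 3) * `|derive1 u r| ^+ 2))
     - (N%:R - 1) * (\int[lebesgue_measure]_(r in radii Rad)
         (derive1 V2 r * r ^ (N%:Z - 2) * `|derive1 u r| ^+ 2))
     /\
     \int[lebesgue_measure]_(r in radii Rad)
       (W2 r * r ^ (N%:Z - 1) * `|derive1 u r| ^+ 2)
     + c1 * (\int[lebesgue_measure]_(r in radii Rad)
         (W2 r * r ^ (N%:Z - 3) * `|u r| ^+ 2)) <=
     \int[lebesgue_measure]_(r in radii Rad)
       (V2 r * r ^ (N%:Z - 1) * `|derive1n 2 u r| ^+ 2)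
     + ((N%:R - 1) + 2 * c1) * (\int[lebesgue_measure]_(r in radii Rad)
         (V2 r * r ^ (N%:Z - 3) * `|derive1 u r| ^+ 2))
     + (c1 ^+ 2 + 2 * (N%:R - 4) * c1) *
         (\int[lebesgue_measure]_(r in radii Rad)
           (V2 r * r ^ (N%:Z - 5) * `|u r| ^+ 2))
     - (N%:R - 1) * (\int[lebesgue_measure]_(r in radii Rad)
         (derive1 V2 r * r ^ (N%:Z - 2) * `|derive1 u r| ^+ 2))
     - (N%:R - 5) * c1 * (\int[lebesgue_measure]_(r in radii Rad)
         (derive1 V2 r * r ^ (N%:Z - 4) * `|u r| ^+ 2))
     - c1 * (\int[lebesgue_measure]_(r in radii Rad)
         (derive1n 2 V2 r * r ^ (N%:Z - 3) * `|u r| ^+ 2))).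
Proof.
move=> c1.
have sV := smooth_on_smooth1 V2_smooth; have sW := smooth_on_smooth1 W2_smooth.
have tE u : test_function (radii Rad) u <-> tf Rad u := test_function_tf Rad_gt0 u.
have w0 f u : \int[lebesgue_measure]_(r in radii Rad) (f r * r ^ (N%:Z - 1) * `|u r| ^+ 2) =
  wint N Rad f 0 u := wintE Rad N_ge1 f 0 u.
have w1 f u : \int[lebesgue_measure]_(r in radii Rad) (f r * r ^ (N%:Z - 2) * `|u r| ^+ 2) =
  wint N Rad f 1 u := wintE Rad N_ge1 f 1 u.
have w2 f u : \int[lebesgue_measure]_(r in radii Rad) (f r * r ^ (N%:Z - 3) * `|u r| ^+ 2) =
  wint N Rad f 2 u := wintE Rad N_ge1 f 2 u.
have w3 f u : \int[lebesgue_measure]_(r in radii Rad) (f r * r ^ (N%:Z - 4) * `|u r| ^+ 2) =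
  wint N Rad f 3 u := wintE Rad N_ge1 f 3 u.
have w4 f u : \int[lebesgue_measure]_(r in radii Rad) (f r * r ^ (N%:Z - 5) * `|u r| ^+ 2) =
  wint N Rad f 4 u := wintE Rad N_ge1 f 4 u.
have H u : tf Rad u -> 0 <= 2 * wint N Rad V2 2 (derive1 u)
     - wint N Rad (derive1 (derive1 V2)) 2 u - (N%:R - 5) * wint N Rad (derive1 V2) 3 u
     + (5 * N%:R - 9) * wint N Rad V2 4 u - wint N Rad W2 2 u.
  by move=> /tE/V2W2; rewrite !w2 w3 w4.
have [suf nec] := rellich_modes Rad_gt0 N_ge1 sV sW V2_ge0 H.
have Q u : tf Rad u -> _ := fun tu c => qf_expand N_ge1 sV sW c tu.
have d2 (f : R -> R) : derive1n 2 f = derive1 (derive1 f) by [].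
split=> [ball u /tE tu|nodes v tv].
  have [v tv|] := suf _ u tu.
    by rewrite -(ball_energy Rad_gt0 sV sW tv) subr_ge0; exact: ball.
  rewrite !Q// !(w0, w1, w2, w3, w4) !d2 -/c1.
  move: (wint N Rad V2 0 _) (wint N Rad V2 2 _) (wint N Rad V2 4 _) (wint _ _ _ 1 _)
    (wint _ _ _ 3 _) (wint _ _ (derive1 _) 2 _) (wint _ _ W2 0 _) (wint _ _ W2 2 _) => *.
  by split; lra.
rewrite -subr_ge0 (ball_energy Rad_gt0 sV sW tv); apply: nec tv => u tu.
have := nodes u (proj2 (tE u) tu).
rewrite !Q// !(w0, w1, w2, w3, w4) !d2 -/c1.
move: (wint N Rad V2 0 _) (wint N Rad V2 2 _) (wint N Rad V2 4 _) (wint _ _ _ 1 _)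
  (wint _ _ _ 3 _) (wint _ _ (derive1 _) 2 _) (wint _ _ W2 0 _) (wint _ _ W2 2 _) => a b c d e f g h [].
by split; lra.
Qed.
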